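(* Let $m_1,m_2,m_3$ be the continuous solution on $\mathbb{T}=\{(x,\xi)\in\mathbb{R}^2:0\le\xi\le x\le1\}$ of the observer kernel equations given in the context, and let $p_i(x)=-\mu m_i(x,0)$ for $i=1,2,3$. Consider the plant $$\partial_t u_1+\gamma_1\partial_x u_1=\sigma_{11}u_1+\sigma_{12}u_2+\alpha(x)w,$$ $$\partial_t u_2+\gamma_2\partial_x u_2=\sigma_{21}u_1+\sigma_{22}u_2+\alpha(x)w,$$ $$\partial_t w-\mu\partial_x w=\theta_1(x)u_1+\theta_2(x)u_2,$$ for $t>0$, $x\in(0,1)$, with $$u_i(t,0)=q_iw(t,0)\ (i=1,2),\qquad w(t,1)=\rho_1u_1(t,1)+\rho_2u_2(t,1)+U(t),$$ and measured output $y(t)=w(t,0)$, together with the observer $$\partial_t\hat u_1+\gamma_1\partial_x\hat u_1=\sigma_{11}\hat u_1+\sigma_{12}\hat u_2+\alpha(x)\hat w-p_1(x)[y(t)-\hat w(t,0)],$$ $$\partial_t\hat u_2+\gamma_2\partial_x\hat u_2=\sigma_{21}\hat u_1+\sigma_{22}\hat u_2+\alpha(x)\hat w-p_2(x)[y(t)-\hat w(t,0)],$$ $$\partial_t\hat w-\mu\partial_x\hat w=\theta_1(x)\hat u_1+\theta_2(x)\hat u_2-p_3(x)[y(t)-\hat w(t,0)],$$ $$\hat u_i(t,0)=q_iy(t)\ (i=1,2),\qquad \hat w(t,1)=\rho_1\hat u_1(t,1)+\rho_2\hat u_2(t,1)+U(t),$$ with the same input $U(t)$. Then, for initial data of plant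 and observer in $(L^2([0,1]))^3$, the observer state $(\hat u_1,\hat u_2,\hat w)$ converges exponentially to the plant state $(u_1,u_2,w)$ in the $L^2$ sense.
   Context: Coefficients. Let $g,a,C_f,H^*,V^*>0$ be physical constants (gravity, sediment parameter, friction, steady water depth and velocity), with Froude number $Fr=V^*/\sqrt{gH^*}$ either $<1$ (subcritical) or $>1$ (supercritical). Let $\lambda_1<0<\lambda_2<\lambda_3$ be the eigenvalues of $$\begin{pmatrix}V^*&H^*&0\\ g&V^*&g\\ 0&aV^{*2}&0\end{pmatrix}.$$ For $\{i,j,k\}=\{1,2,3\}$ put $r_k=C_f\frac{V^*}{H^*}\frac{\lambda_k}{(\lambda_k-\lambda_i)(\lambda_k-\lambda_j)}$ and $\alpha_k=(3V^*-2\lambda_k)r_k$. Set $\mu=-\lambda_1>0$, $\gamma_1=\lambda_2>0$, $\gamma_2=\lambda_3>0$, $\sigma_{11}=\sigma_{21}=\alpha_2$, $\sigma_{12}=\sigma_{22}=\alpha_3$, and, for $x\in[0,1]$, $\alpha(x)=\alpha_1e^{\alpha_1x/\mu}$, $\theta_j(x)=\alpha_{j+1}e^{\alpha_1x/\mu}$ for $j=1,2$. The numbers $q_1,q_2,\rho_1,\rho_2$ are real constants, and $U(t)$ is a scalar boundary control input. Observer kernel equations, on $\mathbb{T}$: $$\gamma_1\partial_xm_1-\mu\partial_\xi m_1=\sigma_{11}m_1+\sigma_{12}m_2+\alpha(x)m_3,$$ $$\gamma_2\partial_xm_2-\mu\partial_\xi m_2=\sigma_{21}m_1+\sigma_{22}m_2+\alpha(x)m_3,$$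 $$\mu\partial_xm_3+\mu\partial_\xi m_3=-\theta_1(x)m_1-\theta_2(x)m_2,$$ with $m_1(x,x)=\frac{\alpha(x)}{\gamma_1+\mu}$, $m_2(x,x)=\frac{\alpha(x)}{\gamma_2+\mu}$, $m_3(1,\xi)=\rho_1m_1(1,\xi)+\rho_2m_2(1,\xi)$ (solution understood along characteristics). Exponential convergence in the $L^2$ sense: there exist $C,\nu>0$, independent of the initial data, such that the $L^2([0,1])$ norm of the error $(u_1-\hat u_1,u_2-\hat u_2,w-\hat w)$ at time $t\ge0$ is at most $Ce^{-\nu t}$ times its norm at time $0$. Solutions are weak ($L^2$) solutions. *)

(* Defs.v *)
From HB Require Import structures.
From mathcomp Require Import all_boot all_order all_algebra.
From mathcomp Require Import all_classical all_reals all_analysis.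

Set Implicit Arguments.
Unset Strict Implicit.
Unset Printing Implicit Defensive.

Import Order.TTheory GRing.Theory Num.Theory.
Import numFieldNormedType.Exports.

Local Open Scope classical_set_scope.
Local Open Scope ring_scope.

Definition froude (R : realType) (g H V : R) : R := V / Num.sqrt (g * H).

Definition sve_matrix (R : realType) (g a H V : R) : 'M[R]_3 :=
  \matrix_(i < 3, j < 3)
    nth 0 (nth [::] [:: [:: V; H; 0];
                        [:: g; V; g];
                        [:: 0; a * V ^+ 2; 0] ] i) j.

Definition r_coef (R : realType) (Cf H V lk li lj : R) : R :=
  Cf * (V / H) * (lk / ((lk - li) * (lk - lj))).

Definition alpha_coef (R : realType) (Cf H V lk li lj : R) : R :=
  (3 * V - 2 * lk) * r_coef Cf H V lk li lj.

Record coefficients (R : realType) := Coefficients {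
  mu : R;
  gamma1 : R; gamma2 : R;
  sigma11 : R; sigma12 : R; sigma21 : R; sigma22 : R;
  alpha : R -> R;
  theta1 : R -> R; theta2 : R -> R;
  q1 : R; q2 : R;
  rho1 : R; rho2 : R }.

Definition sve_coefficients (R : realType)
    (Cf H V l1 l2 l3 q1 q2 rho1 rho2 : R) : coefficients R :=
  let a1 := alpha_coef Cf H V l1 l2 l3 in
  let a2 := alpha_coef Cf H V l2 l1 l3 in
  let a3 := alpha_coef Cf H V l3 l1 l2 in
  let m := - l1 in
  {| mu := m;
     gamma1 := l2; gamma2 := l3;
     sigma11 := a2; sigma12 := a3; sigma21 := a2; sigma22 := a3;
     alpha := fun x => a1 * expR (a1 * x / m);
     theta1 := fun x => a2 * expR (a1 * x / m);
     theta2 := fun x => a3 * expR (a1 * x / m);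
     q1 := q1; q2 := q2; rho1 := rho1; rho2 := rho2 |}.

Definition triangle (R : realType) : set (R * R) :=
  [set z | 0 <= z.2 /\ z.2 <= z.1 /\ z.1 <= 1].

(* [cx * dm/dx + cxi * dm/dxi = f] on the triangle along characteristics: the
   equation is integrated over every characteristic segment with both end
   points (hence, by convexity, all its points) in the triangle. *)
Definition solves_along_characteristics (R : realType) (cx cxi : R)
    (m f : R -> R -> R) : Prop :=
  forall x xi s : R, 0 <= s ->
    triangle (x, xi) -> triangle (x + cx * s, xi + cxi * s) ->
    m (x + cx * s) (xi + cxi * s) - m x xi =
    \int[lebesgue_measure]_(tau in `[0, s])
      f (x + cx * tau) (xi + cxi * tau).

Definition observer_kernel (R : realType) (K : coefficients R)
    (m1 m2 m3 : R -> R -> R) : Prop :=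
  [/\ solves_along_characteristics (gamma1 K) (- mu K) m1
        (fun x xi => sigma11 K * m1 x xi + sigma12 K * m2 x xi
                     + alpha K x * m3 x xi),
      solves_along_characteristics (gamma2 K) (- mu K) m2
        (fun x xi => sigma21 K * m1 x xi + sigma22 K * m2 x xi
                     + alpha K x * m3 x xi),
      solves_along_characteristics (mu K) (mu K) m3
        (fun x xi => - theta1 K x * m1 x xi - theta2 K x * m2 x xi),
      (forall x : R, 0 <= x <= 1 ->
         m1 x x = alpha K x / (gamma1 K + mu K) /\
         m2 x x = alpha K x / (gamma2 K + mu K)) &
      (forall xi : R, 0 <= xi <= 1 ->
         m3 1 xi = rho1 K * m1 1 xi + rho2 K * m2 1 xi)].

Definition continuous_on_triangle (R : realType) (m : R -> R -> R) : Prop :=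
  {within @triangle R, continuous (fun z : R * R => m z.1 z.2)}.

(* Elements of L^2 are represented by Borel functions. *)
Definition L2_on (R : realType) (D : set R) (f : R -> R) : Prop :=
  measurable_fun D f /\
  (\int[lebesgue_measure]_(x in D) ((f x) ^+ 2)%:E < +oo)%E.

Definition L2loc (R : realType) (f : R -> R) : Prop :=
  forall T : R, 0 <= T -> L2_on `[0, T] f.

Definition L2norm (R : realType) (f : R -> R) : R :=
  Num.sqrt (\int[lebesgue_measure]_(x in `[0, 1]) (f x) ^+ 2).

Record triple (A : Type) := Triple { comp1 : A; comp2 : A; comp3 : A }.

Definition L2_triple (R : realType) (s : triple (R -> R)) : Prop :=
  [/\ L2_on `[0, 1] (comp1 s),
      L2_on `[0, 1] (comp2 s) &
      L2_on `[0, 1] (comp3 s)].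

Definition L2norm_triple (R : realType) (s : triple (R -> R)) : R :=
  Num.sqrt (L2norm (comp1 s) ^+ 2 + L2norm (comp2 s) ^+ 2
            + L2norm (comp3 s) ^+ 2).

(* A scalar function of (t, x) together with its traces t |-> v(t, 0) and
   t |-> v(t, 1). The traces are separate data because an L^2 function of x has
   no value at a point; [weak_transport] determines them almost everywhere. *)
Record trajectory (R : realType) := Trajectory {
  profile : R -> R -> R;
  trace0 : R -> R;
  trace1 : R -> R }.

(* v belongs to C^0([0, +oo[; L^2([0, 1])) and has L^2_loc traces. *)
Definition L2_trajectory (R : realType) (v : trajectory R) : Prop :=
  [/\ measurable_fun (`[0, +oo[%classic `*` `[0, 1]%classic : set (R * R))
        (fun z : R * R => profile v z.1 z.2),
      (forall t : R, 0 <= t -> L2_on `[0, 1] (profile v t)),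
      (forall t0 : R, 0 <= t0 ->
         L2norm (fun x => profile v t x - profile v t0 x)
           @[t --> within `[0, +oo[%classic (nbhs t0)] --> (0 : R)),
      L2loc (trace0 v) &
      L2loc (trace1 v)].

Definition C1_test (R : realType) (phi phit phix : R -> R -> R) : Prop :=
  [/\ (forall t x : R, is_derive t (1 : R) (fun s => phi s x) (phit t x)),
      (forall t x : R, is_derive x (1 : R) (fun y => phi t y) (phix t x)),
      continuous (fun z : R * R => phit z.1 z.2) &
      continuous (fun z : R * R => phix z.1 z.2)].

(* Weak form of [dv/dt + c * dv/dx = f] for t > 0 and 0 < x < 1, with
   v(0, .) = v0: the equation is multiplied by phi and integrated by parts over
   [0, T] x [0, 1]. Test functions need not vanish at the boundary, so the
   identity also characterizes the traces. *)
Definition weak_transport (R : realType) (c : R) (v : trajectory R)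
    (f : R -> R -> R) (v0 : R -> R) : Prop :=
  [/\ L2_trajectory v,
      {ae lebesgue_measure, forall x : R, 0 <= x <= 1 -> profile v 0 x = v0 x} &
      forall phi phit phix : R -> R -> R, C1_test phi phit phix ->
      forall T : R, 0 <= T ->
        \int[lebesgue_measure]_(x in `[0, 1]) (profile v T x * phi T x)
        - \int[lebesgue_measure]_(x in `[0, 1]) (v0 x * phi 0 x)
        + c * \int[lebesgue_measure]_(t in `[0, T])
                (trace1 v t * phi t 1 - trace0 v t * phi t 0)
        = \int[lebesgue_measure]_(t in `[0, T])
            (\int[lebesgue_measure]_(x in `[0, 1])
               (profile v t x * (phit t x + c * phix t x) + f t x * phi t x))].

Definition plant (R : realType) (K : coefficients R) (U : R -> R)
    (z0 : triple (R -> R)) (z : triple (trajectory R)) : Prop :=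
  let u1 := comp1 z in let u2 := comp2 z in let w := comp3 z in
  [/\ weak_transport (gamma1 K) u1
        (fun t x => sigma11 K * profile u1 t x + sigma12 K * profile u2 t x
                    + alpha K x * profile w t x) (comp1 z0),
      weak_transport (gamma2 K) u2
        (fun t x => sigma21 K * profile u1 t x + sigma22 K * profile u2 t x
                    + alpha K x * profile w t x) (comp2 z0),
      weak_transport (- mu K) w
        (fun t x => theta1 K x * profile u1 t x + theta2 K x * profile u2 t x)
        (comp3 z0) &
      {ae lebesgue_measure, forall t : R, 0 <= t ->
        [/\ trace0 u1 t = q1 K * trace0 w t,
            trace0 u2 t = q2 K * trace0 w t &
            trace1 w t =
              rho1 K * trace1 u1 t + rho2 K * trace1 u2 t + U t]}].

Definition observer (R : realType) (K : coefficients R) (p1 p2 p3 : R -> R)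
    (U y : R -> R) (z0 : triple (R -> R)) (z : triple (trajectory R)) : Prop :=
  let u1 := comp1 z in let u2 := comp2 z in let w := comp3 z in
  [/\ weak_transport (gamma1 K) u1
        (fun t x => sigma11 K * profile u1 t x + sigma12 K * profile u2 t x
                    + alpha K x * profile w t x - p1 x * (y t - trace0 w t))
        (comp1 z0),
      weak_transport (gamma2 K) u2
        (fun t x => sigma21 K * profile u1 t x + sigma22 K * profile u2 t x
                    + alpha K x * profile w t x - p2 x * (y t - trace0 w t))
        (comp2 z0),
      weak_transport (- mu K) w
        (fun t x => theta1 K x * profile u1 t x + theta2 K x * profile u2 t x
                    - p3 x * (y t - trace0 w t))
        (comp3 z0) &
      {ae lebesgue_measure, forall t : R, 0 <= t ->
        [/\ trace0 u1 t = q1 K * y t,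
            trace0 u2 t = q2 K * y t &
            trace1 w t =
              rho1 K * trace1 u1 t + rho2 K * trace1 u2 t + U t]}].

Definition measured_output (R : realType) (z : triple (trajectory R)) :
    R -> R :=
  trace0 (comp3 z).

Definition observer_error (R : realType) (z zhat : triple (trajectory R))
    (t : R) : triple (R -> R) :=
  {| comp1 := fun x => profile (comp1 z) t x - profile (comp1 zhat) t x;
     comp2 := fun x => profile (comp2 z) t x - profile (comp2 zhat) t x;
     comp3 := fun x => profile (comp3 z) t x - profile (comp3 zhat) t x |}.

(* Main.v *)
Require Import Defs.
From HB Require Import structures.
From mathcomp Require Import all_boot all_order all_algebra.
From mathcomp Require Import all_classical all_reals all_analysis.
From mathcomp Require Import measurable_realfun ring lra.
Import Order.TTheory GRing.Theory Num.Theory.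
Import numFieldNormedType.Exports.
Local Open Scope classical_set_scope.
Local Open Scope ring_scope.

(** Let [e] be the difference between the plant state and the observer state.
    It solves a linear transport system with output injection, and only in a
    weak sense, so it is neither transformed nor inserted into a Lyapunov
    functional. All smoothness is put on test functions instead: the decay is
    proved for classical solutions of the adjoint problem and carried over to
    [e] by duality.

    Fix a final time [T], continuous functions [h1], [h2], [h3] and a pulse
    [eta], nonnegative, of mass one, supported in a short interval [[0, d]].
    In the reversed time [s = T - t] the adjoint system ([dual_solution]) is
    driven by the source [eta(s) h_j(x)] and has zero state at [s = 0]. It is
    solved as an evolution in [x] starting from the line [x = 1]
    ([cauchy_problem], [dual_solution_ex]): this produces C^1 solutions at once
    and leaves the value [beta(s)] of the third component at [x = 1] free.

    The observer kernels enter through the Volterra transform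
    [Q(s, xi) = p3(s, xi) + sum_k int_xi^1 m_k(x, xi) p_k(s, x) dx]. The kernel
    equations say that [Q] is purely transported, with source [eta k] where [k]
    is the same transform of [h] ([transform_sourceE]). Hence [beta] can be
    chosen so that [Q(s, 0) = 0] for all [s] ([transform_at0]). As the
    injection gains are [- mu m_j(x, 0)], the equation [Q(s, 0) = 0] is
    precisely the cancellation of the boundary term of the third component at
    [x = 0] with the injection terms.

    In terms of [p1], [p2] and [Q] the adjoint system is a cascade, and
    [int e^(l x) (p1^2 + p2^2) + B int (2 - x) Q^2] decays exponentially once
    [l] and then [B] are large ([energy_rate_le], [dual_decay]); the third
    component is recovered from [Q] because a large [l] makes the Volterra
    integrals small ([third_component_le]).

    Testing the weak formulations of plant and observer with
    [p_j(T - t, x)] gives, all boundary terms being cancelled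
    ([duality_identity]),
    [sum_j <e_j(0), p_j(T)> = int_0^T eta(T - t) sum_j <e_j(t), h_j> dt].
    As [d] tends to [0] the right-hand side tends to [sum_j <e_j(T), h_j>]
    ([concentrate]), while the left-hand side is at most
    [C e^(- nu T / 2) |e(0)| |h|]. Continuous functions [h] suffice to compute
    the norm of [e(T)] ([L2norm_le_dual]), and the decay follows. *)

(** * Derivatives and antiderivatives on the line *)

Section calculus.
Context {R : realType}.
Implicit Types (f g F G : R -> R) (x a b c d e : R).

Lemma is_derive_fct f (x df df' : R) :
  is_derive x 1 f df -> df = df' -> is_derive x 1 f df'.
Proof. by move=> + <-. Qed.

Lemma derD f g (x df dg : R) : is_derive x 1 f df -> is_derive x 1 g dg ->
  is_derive x 1 (fun y => f y + g y) (df + dg).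
Proof. by move=> *; exact: is_deriveD. Qed.

Lemma derB f g (x df dg : R) : is_derive x 1 f df -> is_derive x 1 g dg ->
  is_derive x 1 (fun y => f y - g y) (df - dg).
Proof. by move=> *; exact: is_deriveB. Qed.

Lemma derM f g (x df dg : R) : is_derive x 1 f df -> is_derive x 1 g dg ->
  is_derive x 1 (fun y => f y * g y) (f x * dg + g x * df).
Proof. by move=> *; exact: is_deriveM. Qed.

Lemma derC (c x : R) : is_derive x 1 (fun=> c) 0.
Proof. exact: is_derive_cst. Qed.

Lemma derZ f (x df c : R) : is_derive x 1 f df ->
  is_derive x 1 (fun y => c * f y) (c * df).
Proof. by move=> ?; exact: is_deriveZ. Qed.

Lemma der_affine (a b x : R) : is_derive x 1 (fun y => a + b * y) b.
Proof.
have := derD _ _ _ _ _ (derC a x) (derZ _ _ _ b (is_derive_id x 1)).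
by rewrite add0r mulr1.
Qed.

Lemma der_comp f g (x df dg : R) : is_derive x 1 g dg ->
  is_derive (g x) 1 f df -> is_derive x 1 (fun y => f (g y)) (df * dg).
Proof. by move=> ? ?; exact: is_derive1_comp. Qed.

Lemma der_continuous f (x df : R) : is_derive x 1 f df -> {for x, continuous f}.
Proof.
by move=> [fx _]; apply: differentiable_continuous; apply/derivable1_diffP.
Qed.

(** Difference quotients spelled out: the form in which the estimates below
    produce and consume derivatives. *)
Lemma is_derive_epsP f (x l : R) :
  is_derive x 1 f l <->
  (forall e, 0 < e -> exists2 d, 0 < d &
    forall h, `|h| < d -> `|f (x + h) - f x - l * h| <= e * `|h|).
Proof.
split=> [[fx fl] e e0|H].
- have := fx; rewrite /derivable.
  have : (fun h : R => h^-1 *: (f (h *: (1 : R) + x) - f x)) @ 0^' --> l by rewrite -fl; exact: fx.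
  move=> /cvgrPdist_le /(_ _ e0); rewrite near_withinE => -[/= d d0 H] _.
  exists d => // h hd; have [->|h0] := eqVneq h 0.
    by rewrite addr0 subrr mulr0 subr0 normr0 mulr0.
  have := H h; rewrite /= sub0r normrN => /(_ hd h0).
  rewrite /GRing.scale/= mulr1 => {}H.
  have -> : f (x + h) - f x - l * h = - (l - h^-1 * (f (h + x) - f x)) * h.
    by rewrite (addrC h); field.
  by rewrite normrM normrN ler_wpM2r.
- have H' : (fun h : R => h^-1 *: (f (h *: (1 : R) + x) - f x)) @ 0^' --> l.
    apply/cvgrPdist_le => e e0; have [d d0 {}H] := H _ e0.
    rewrite near_withinE; exists d => //= h hd0 h0; have hd : `|h| < d by move: hd0; rewrite /ball_ /= sub0r normrN.
    rewrite /GRing.scale/= mulr1.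
    have {}H := H h hd.
    have -> : l - h^-1 * (f (h + x) - f x) = - h^-1 * (f (x + h) - f x - l * h).
      by rewrite (addrC h); field.
    rewrite normrM normrN normfV mulrC ler_pdivrMr ?normr_gt0 //.
  by split; [apply/cvg_ex; exists l | exact: cvg_lim H'].
Qed.

(** The mean value theorem whatever the order of [a] and [b]: the oriented
    integrals below run in both directions. *)
Lemma mvt_unordered f (df : R -> R) a b :
  (forall x, is_derive x 1 f (df x)) -> exists2 c, `|c - a| <= `|b - a| /\ `|c - b| <= `|b - a| & f b - f a = df c * (b - a).
Proof.
move=> fdf.
have cf A : {within A, continuous f}.
  by apply: continuous_subspaceT => x; exact: der_continuous (fdf x).
have [ab|ba] := leP a b.
- have [c] := MVT_segment ab (fun x _ => fdf x) (cf _).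
  rewrite in_itv/= => /andP[ac cb] E; exists c => //.
  by rewrite [`|b - a|]ger0_norm ?subr_ge0 // ger0_norm ?ler0_norm ?subr_ge0 ?subr_le0 //; split; lra.
- have [c] := MVT_segment (ltW ba) (fun x _ => fdf x) (cf _).
  rewrite in_itv/= => /andP[ac cb] E; exists c; last by rewrite -[LHS]opprB E -mulrN opprB.
  by rewrite [`|b - a|]ler0_norm ?subr_le0 ?(ltW ba) // ler0_norm ?ger0_norm ?subr_ge0 ?subr_le0 //; split; lra.
Qed.

Lemma eq_increment F G a b (df : R -> R) :
  (forall x, is_derive x 1 F (df x)) -> (forall x, is_derive x 1 G (df x)) ->
  F b - F a = G b - G a.
Proof.
move=> dF dG.
have [c _] := @mvt_unordered (fun x => F x - G x) (fun=> 0) a b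
  (fun x => is_derive_fct _ _ _ _ (derB _ _ _ _ _ (dF x) (dG x)) (subrr _)).
rewrite mul0r => E; lra.
Qed.

(** An antiderivative on the whole line: the two terms make the integral
    oriented, one of them being over an empty interval. *)
Definition prim f x : R :=
  \int[lebesgue_measure]_(y in `[0, x]) f y
  - \int[lebesgue_measure]_(y in `[x, 0]) f y.

Definition oint f a b : R := prim f b - prim f a.

Lemma continuous_integrable_itv f a b : continuous f ->
  lebesgue_measure.-integrable `[a, b] (EFin \o f).
Proof.
move=> cf; apply: continuous_compact_integrable; first exact: segment_compact.
exact: continuous_subspaceT.
Qed.

Lemma prim_from f a x : continuous f -> a <= 0 -> a <= x ->
  prim f x = \int[lebesgue_measure]_(y in `[a, x]) f y
    - \int[lebesgue_measure]_(y in `[a, 0]) f y.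
Proof.
move=> cf a0 ax; rewrite /prim.
have chasles u v : a <= u -> u <= v ->
   \int[lebesgue_measure]_(y in `[a, v]) f y - \int[lebesgue_measure]_(y in `[a, u]) f y =
   \int[lebesgue_measure]_(y in `[u, v]) f y.
  move=> au uv; rewrite Rintegral_itvB ?bnd_simp //; last exact: continuous_integrable_itv.
  apply: Rintegral_itv_obnd_cbnd.
  apply: integrableS (continuous_integrable_itv f u v cf) => //.
  by move=> y /=; rewrite !in_itv/= => /andP[/ltW -> ->].
have [x0|x0] := leP 0 x.
  rewrite (chasles 0 x a0 x0); move: x0; rewrite le_eqVlt => /predU1P[<-|x0].
    by rewrite set_itv1 !Rintegral_set1 subr0.
  by rewrite [in X in _ - X]set_itv_ge ?bnd_simp -?ltNge // Rintegral_set0 subr0.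
rewrite [in X in X - _]set_itv_ge ?bnd_simp -?ltNge // Rintegral_set0 sub0r.
by rewrite -(chasles x 0) ?(ltW x0) // opprB.
Qed.

Lemma der_prim f x : continuous f -> is_derive x 1 (prim f) (f x).
Proof.
move=> cf; pose a := Num.min 0 x - 1.
have a0 : a <= 0 by rewrite /a lerBlDr ge_min; apply/orP; left; lra.
have ax : a < x by rewrite /a ltrBlDr gt_min; apply/orP; right; lra.
have xx : x < x + 1 by lra.
have [dF F'] := continuous_FTC1_closed xx (continuous_integrable_itv f a (x + 1) cf) ax (cf x).
have D : is_derive x 1 (fun x => \int[lebesgue_measure]_(y in `[a, x]) f y) (f x).
  by rewrite -F' derive1E; exact: derivableP.
have := derB _ _ _ _ _ D (derC (\int[lebesgue_measure]_(y in `[a, 0]) f y) x).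
rewrite subr0; apply: near_eq_is_derive; near=> y.
rewrite (prim_from _ a) //; apply: ltW; near: y.
exact: lt_nbhsr.
Unshelve. all: by end_near. Qed.

End calculus.

(** * Integrals depending on parameters *)

Section contcomb.
Context {R : realType} {T : topologicalType}.
Implicit Types (f g : T -> R).

Lemma ctsC (U : topologicalType) (c : U) : continuous (fun _ : T => c).
Proof. by move=> x; exact: cvg_cst. Qed.
Lemma ctsD f g : continuous f -> continuous g -> continuous (fun x => f x + g x).
Proof. by move=> cf cg x; exact: cvgD (cf x) (cg x). Qed.
Lemma ctsN f : continuous f -> continuous (fun x => - f x).
Proof. by move=> cf x; exact: cvgN (cf x). Qed.
Lemma ctsM f g : continuous f -> continuous g -> continuous (fun x => f x * g x).
Proof. by move=> cf cg x; exact: cvgM (cf x) (cg x). Qed.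
Lemma ctsX f n : continuous f -> continuous (fun x => f x ^+ n).
Proof.
move=> cf; elim: n => [|n IH]; first by under eq_fun do rewrite expr0; exact: ctsC.
by under eq_fun do rewrite exprS; exact: ctsM.
Qed.
Lemma cts1 (f : R -> R) g : continuous f -> continuous g -> continuous (fun x => f (g x)).
Proof. by move=> cf cg x; apply: continuous_comp; [exact: cg|exact: cf]. Qed.
Lemma cts2 (U V W : topologicalType) (P : U -> V -> W) (u : T -> U) (v : T -> V) :
  continuous (fun z : U * V => P z.1 z.2) -> continuous u -> continuous v ->
  continuous (fun x => P (u x) (v x)).
Proof.
move=> cP cu cv x.
apply: (@continuous_comp _ _ _ (fun x => (u x, v x)) (fun z => P z.1 z.2)); last exact: cP.
by apply: cvg_pair; [exact: cu|exact: cv].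
Qed.
Lemma cts_pair (U V : topologicalType) (u : T -> U) (v : T -> V) :
  continuous u -> continuous v -> continuous (fun x => (u x, v x)).
Proof. by move=> cu cv x; apply: cvg_pair; [exact: cu|exact: cv]. Qed.
Lemma cts_id : continuous (fun x : T => x). Proof. by move=> x. Qed.
Lemma cts_fst (U V : topologicalType) (u : T -> U * V) : continuous u -> continuous (fun x => (u x).1).
Proof. by move=> cu x; apply: continuous_comp; [exact: cu| exact: cvg_fst]. Qed.
Lemma cts_snd (U V : topologicalType) (u : T -> U * V) : continuous u -> continuous (fun x => (u x).2).
Proof. by move=> cu x; apply: continuous_comp; [exact: cu| exact: cvg_snd]. Qed.
End contcomb.

(** Continuity by the shape of the function. A hypothesis on the uncurried
    form of a function of two variables is used for each of its partial
    applications and compositions. *)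
Ltac cts_step :=
  lazymatch goal with
  | |- continuous (fun x => x) => exact cts_id
  | |- continuous id => exact cts_id
  | |- continuous (fun _ => ?c) => exact (ctsC _ c)
  | |- continuous (fun x => @GRing.add _ (@?f x) (@?g x)) => refine (ctsD f g _ _)
  | |- continuous (fun x => @GRing.opp _ (@?f x)) => refine (ctsN f _)
  | |- continuous (fun x => @GRing.mul _ (@?f x) (@?g x)) => refine (ctsM f g _ _)
  | |- continuous (fun x => @GRing.exp _ (@?f x) ?n) => refine (ctsX f n _)
  | |- continuous (fun x => fst (@?u x)) => refine (cts_fst _ _ u _)
  | |- continuous (fun x => snd (@?u x)) => refine (cts_snd _ _ u _)
  | H : continuous ?f |- continuous ?f => exact H
  | H : continuous (fun z => ?P z.1 z.2) |- continuous (fun x => ?P (@?u x) (@?v x)) =>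
      refine (cts2 _ _ _ P u v H _ _)
  | H : continuous (fun z => ?P z.1 z.2) |- continuous (?P ?a) =>
      refine (cts2 _ _ _ P (fun _ => a) (fun x => x) H _ _)
  | H : continuous ?f |- continuous (fun x => ?f (@?u x)) => refine (cts1 f u H _)
  end.
Ltac cts := repeat (cbv beta; cts_step).

Section parametric.
Context {R : realType}.
Implicit Types (f g F G : R -> R) (a b c d e : R).

Lemma oint_Rint f a b : continuous f -> a <= b ->
  oint f a b = \int[lebesgue_measure]_(x in `[a, b]) f x.
Proof.
move=> cf ab; pose c := Num.min a 0.
have ca : c <= a by rewrite /c ge_min lexx.
have c0 : c <= 0 by rewrite /c ge_min lexx orbT.
have cb : c <= b by exact: le_trans ab.
rewrite /oint (prim_from f c b) ?(prim_from f c a) //.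
rewrite opprB addrA subrK.
rewrite Rintegral_itvB ?bnd_simp //; last exact: continuous_integrable_itv.
apply: Rintegral_itv_obnd_cbnd.
apply: integrableS (continuous_integrable_itv f a b cf) => //.
by move=> y /=; rewrite !in_itv/= => /andP[/ltW -> ->].
Qed.

Lemma oint_ftc f F a b : continuous f -> (forall x : R, is_derive x 1 F (f x)) ->
  oint f a b = F b - F a.
Proof. by move=> cf dF; apply: (eq_increment _ _ _ _ f) => // x; exact: der_prim. Qed.

Lemma oint_chasles f a b c : oint f a b + oint f b c = oint f a c.
Proof. by rewrite /oint; ring. Qed.

Lemma oint_rev f a b : oint f a b = - oint f b a.
Proof. by rewrite /oint; ring. Qed.

Lemma oint_id f a : oint f a a = 0.
Proof. by rewrite /oint subrr. Qed.

Lemma ointD f g a b : continuous f -> continuous g ->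
  oint (fun x => f x + g x) a b = oint f a b + oint g a b.
Proof.
move=> cf cg; rewrite (oint_ftc _ _ a b (ctsD _ _ cf cg)
  (fun x => derD _ _ _ _ _ (der_prim f x cf) (der_prim g x cg))).
by rewrite /oint; ring.
Qed.

Lemma ointZ f c a b : continuous f -> oint (fun x => c * f x) a b = c * oint f a b.
Proof.
move=> cf; rewrite (oint_ftc _ _ a b _ (fun x => derZ _ _ _ c (der_prim f x cf))); last by cts.
by rewrite /oint; ring.
Qed.

Lemma ointB f g a b : continuous f -> continuous g ->
  oint (fun x => f x - g x) a b = oint f a b - oint g a b.
Proof.
move=> cf cg; rewrite (oint_ftc _ _ a b (ctsD _ _ cf (ctsN _ cg))
  (fun x => derB _ _ _ _ _ (der_prim f x cf) (der_prim g x cg))).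
by rewrite /oint; ring.
Qed.

Lemma oint_shift f a b c : continuous f ->
  oint (fun x => f (x + c)) a b = oint f (a + c) (b + c).
Proof.
move=> cf; have D (x : R) : is_derive x 1 (fun x => prim f (c + 1 * x)) (f (x + c)).
  have := der_comp _ _ _ _ _ (der_affine c 1 x) (der_prim f _ cf).
  by rewrite mulr1 mul1r addrC.
rewrite (oint_ftc _ _ a b _ D); last by cts.
by rewrite /oint !mul1r ![c + _]addrC.
Qed.

Lemma oint_bound f a b M : continuous f ->
  (forall x, `|x - a| <= `|b - a| -> `|f x| <= M) -> `|oint f a b| <= M * `|b - a|.
Proof.
move=> cf fM; rewrite /oint.
have [c [ca cb] ->] := mvt_unordered (prim f) f a b (fun x => der_prim f x cf).
by rewrite normrM ler_wpM2r // fM.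
Qed.

Lemma le_oint f g a b : continuous f -> continuous g -> a <= b ->
  (forall x, a <= x <= b -> f x <= g x) -> oint f a b <= oint g a b.
Proof.
move=> cf cg ab fg; rewrite !oint_Rint //.
apply: le_Rintegral => //; first exact: continuous_integrable_itv.
exact: continuous_integrable_itv.
Qed.

Lemma eq_oint f g a b : continuous f -> continuous g -> a <= b ->
  (forall x, a <= x <= b -> f x = g x) -> oint f a b = oint g a b.
Proof.
move=> cf cg ab fg; apply/eqP; rewrite eq_le.
by rewrite !le_oint // => x xab; rewrite fg.
Qed.

Lemma abs_oint f g a b : continuous f -> continuous g -> a <= b ->
  (forall x, a <= x <= b -> `|f x| <= g x) -> `|oint f a b| <= oint g a b.
Proof.
move=> cf cg ab fg; rewrite ler_norml; apply/andP; split.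
- rewrite lerNl; have -> : - oint f a b = oint (fun x => -1 * f x) a b by rewrite ointZ // mulN1r.
  by apply: le_oint => //; [cts|move=> x /fg; rewrite ler_norml; lra].
- by apply: le_oint => // x /fg; rewrite ler_norml; lra.
Qed.

(** Compactness of [[- X, X]] makes the continuity in [t] uniform in [y]. *)
Lemma tube {T : topologicalType} (P : T -> R -> R) (t0 : T) (X e : R) :
  continuous (fun z : T * R => P z.1 z.2) -> 0 < e ->
  \forall t \near t0, forall y, `|y| <= X -> `|P t y - P t0 y| <= e.
Proof.
move=> cP e0.
have e2 : 0 < e / 2 by rewrite divr_gt0.
have /compact_near_coveringP K : compact (`[- X, X]%classic : set R) by exact: segment_compact.
have H : forall y, `[- X, X]%classic y ->
    \forall y' \near y & t \near t0, `|P t y' - P t0 y'| <= e.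
  move=> y _.
  have /cvgrPdist_le /(_ _ e2)[[A B] /= [At By] H] := cP (t0, y).
  exists (B, A) => // -[y' t] /= [By' At'].
  have := H (t, y') (conj At' By').
  have := H (t0, y') (conj (nbhs_singleton At) By').
  rewrite /= => h1 h2.
  rewrite (_ : _ - _ = (P t0 y - P t0 y') - (P t0 y - P t y')); last ring.
  by rewrite (le_trans (ler_normB _ _)) // [leRHS](splitr e) lerD.
apply: filterS (K _ (nbhs t0) (fun t y => `|P t y - P t0 y| <= e) _ H).
by move=> t /= Ht y yX; apply: Ht; rewrite /= in_itv/= -ler_norml.
Qed.

Lemma cts_prim {T : topologicalType} (P : T -> R -> R) :
  continuous (fun z : T * R => P z.1 z.2) ->
  continuous (fun z : T * R => prim (P z.1) z.2).
Proof.
move=> cP [t0 x0]; apply/cvgrPdist_le => e e0 /=.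
have cPt t : continuous (P t) by cts.
have X0 : 0 < `|x0| + 1 by rewrite ltr_wpDl.
have e2 : 0 < e / 2 by rewrite divr_gt0.
have d0 : 0 < e / 2 / (`|x0| + 1) by rewrite divr_gt0.
have N1 (A : set T) : nbhs t0 A -> \forall z \near (t0, x0), A z.1.
  by move=> At; exact: (@cvg_fst _ _ (nbhs t0) (nbhs x0) _ A At).
have N2 (A : set R) : nbhs x0 A -> \forall z \near (t0, x0), A z.2.
  by move=> Ax; exact: (@cvg_snd _ _ (nbhs t0) (nbhs x0) _ A Ax).
near=> z.
have zX : `|z.2| <= `|x0| + 1.
  have : `|x0 - z.2| <= 1.
    near: z; apply: (N2 (fun y => `|x0 - y| <= 1)).
    by apply: (@cvgr_dist_le _ _ _ (nbhs x0) _ id x0) => //; exact: cvg_id.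
  have := ler_normB x0 (x0 - z.2); rewrite opprB addrC subrK; lra.
have h1 : `|prim (P t0) x0 - prim (P t0) z.2| <= e / 2.
  near: z; apply: (N2 (fun y => `|prim (P t0) x0 - prim (P t0) y| <= e / 2)).
  have := der_continuous _ _ _ (der_prim (P t0) x0 (cPt t0)).
  by move=> /cvgrPdist_le /(_ _ e2).
have h2 : `|prim (P t0) z.2 - prim (P z.1) z.2| <= e / 2.
  have p0 t : prim (P t) z.2 = oint (P t) 0 z.2.
    by rewrite /oint /prim set_itv1 !Rintegral_set1 subrr subr0.
  have tub : forall y, `|y| <= `|x0| + 1 -> `|P z.1 y - P t0 y| <= e / 2 / (`|x0| + 1).
    near: z; apply: (N1 (fun t => forall y, `|y| <= `|x0| + 1 -> `|P t y - P t0 y| <= e / 2 / (`|x0| + 1))).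
    exact: tube.
  rewrite !p0 -ointB // (le_trans (oint_bound _ _ _ (e / 2 / (`|x0| + 1)) _ _)) //.
  - by cts.
  - by move=> y; rewrite !subr0 => yz; rewrite distrC tub // (le_trans yz).
  - by rewrite subr0 mulrAC ler_pdivrMr //; apply: ler_wpM2l => //; exact: ltW.
rewrite (_ : _ - _ = (prim (P t0) x0 - prim (P t0) z.2) + (prim (P t0) z.2 - prim (P z.1) z.2)); last ring.
by rewrite (le_trans (ler_normD _ _)) // [leRHS](splitr e) lerD.
Unshelve. all: by end_near. Qed.

Lemma cts_oint {T : topologicalType} (P : T -> R -> R) (u v : T -> R) :
  continuous (fun z : T * R => P z.1 z.2) -> continuous u -> continuous v ->
  continuous (fun t => oint (P t) (u t) (v t)).
Proof.
move=> cP cu cv; have := cts_prim _ cP; set Q := fun t => prim (P t) => cQ.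
by apply: ctsD; [|apply: ctsN]; refine (cts2 _ _ _ Q (fun t => t) _ cQ _ _) => //; exact: cts_id.
Qed.

(** The mean value theorem in [t] bounds the difference quotient of the
    integrand uniformly by [tube], in place of dominated convergence. *)
Lemma der_param (P P' : R -> R -> R) (t0 a b : R) :
  continuous (fun z : R * R => P z.1 z.2) -> continuous (fun z : R * R => P' z.1 z.2) ->
  (forall t x : R, is_derive t 1 (P^~ x) (P' t x)) ->
  is_derive t0 1 (fun t => oint (P t) a b) (oint (P' t0) a b).
Proof.
move=> cP cP' dP; apply/is_derive_epsP => e e0.
pose X := `|a| + `|b - a|; pose M := e / (`|b - a| + 1).
have M0 : 0 < M by rewrite divr_gt0 // ltr_wpDl.
have /nbhs_ballP[d /= d0 tub] := tube P' t0 X M cP' M0.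
exists d => // h hd.
have c1 : continuous (P (t0 + h)) by cts.
have c2 : continuous (P t0) by cts.
have c3 : continuous (P' t0) by cts.
rewrite mulrC -ointZ // -!ointB //; [|by cts..].
have B x : `|x - a| <= `|b - a| -> `|P (t0 + h) x - P t0 x - h * P' t0 x| <= M * `|h|.
  move=> xa; have [c [ca _] ->] := mvt_unordered (P^~ x) (P'^~ x) t0 (t0 + h) (dP^~ x).
  have -> : P' c x * (t0 + h - t0) - h * P' t0 x = (P' c x - P' t0 x) * h by ring.
  rewrite normrM ler_wpM2r // tub //.
    by rewrite /ball /= distrC (le_lt_trans ca) // [t0 + h]addrC addrK.
  by have := ler_normD a (x - a); rewrite addrC subrK /X; lra.
rewrite (le_trans (oint_bound _ _ _ _ _ B)) //; first by cts.
rewrite mulrAC ler_wpM2r // /M mulrAC ler_pdivrMr ?ltr_wpDl //.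
by rewrite ler_wpM2l ?ltW //; lra.
Qed.

(** A chain rule in which only one of the two partial derivatives is
    continuous: first [x] moves while [r] keeps its base value, where the
    derivative in [x] is used at a single point; then [r] moves, and the mean
    value theorem applies. *)
Lemma der_line (V Vr Vx : R -> R -> R) (a b c d t0 : R) :
  (forall r x : R, is_derive r 1 (V^~ x) (Vr r x)) ->
  (forall r x : R, is_derive x 1 (V r) (Vx r x)) ->
  continuous (fun z : R * R => Vr z.1 z.2) ->
  is_derive t0 1 (fun t => V (a + b * t) (c + d * t))
    (b * Vr (a + b * t0) (c + d * t0) + d * Vx (a + b * t0) (c + d * t0)).
Proof.
move=> dr dx cr; apply/is_derive_epsP => e e0.
pose r0 := a + b * t0; pose x0 := c + d * t0.
have e2 : 0 < e / 2 by rewrite divr_gt0.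
have D2 : is_derive t0 1 (fun t => V r0 (c + d * t)) (Vx r0 x0 * d).
  by apply: (der_comp (V r0) (fun t => c + d * t)); exact: der_affine.
have /is_derive_epsP /(_ _ e2)[d2 d20 H2] := D2.
pose M := e / 2 / (`|b| + 1).
have b1 : 0 < `|b| + 1 by rewrite ltr_wpDl.
have M0 : 0 < M by rewrite divr_gt0.
have /cvgrPdist_le /(_ _ M0)[[A B] /= [/nbhs_ballP[dA /= dA0 At] /nbhs_ballP[dB /= dB0 Bt]] H] := cr (r0, x0).
pose dd := Num.min d2 (Num.min (dA / (`|b| + 1)) (dB / (`|d| + 1))).
have d1 : 0 < `|d| + 1 by rewrite ltr_wpDl.
exists dd; first by rewrite !lt_min d20 !divr_gt0.
move=> h; rewrite !lt_min => /andP[hd2 /andP[hA hB]].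
have hA' : `|b * h| < dA.
  rewrite normrM (@le_lt_trans _ _ ((`|b| + 1) * `|h|)) //; last by rewrite mulrC -ltr_pdivlMr.
  by rewrite ler_wpM2r // lerDl.
have hB' : `|d * h| < dB.
  rewrite normrM (@le_lt_trans _ _ ((`|d| + 1) * `|h|)) //; last by rewrite mulrC -ltr_pdivlMr.
  by rewrite ler_wpM2r // lerDl.
have {}H2 := H2 h hd2.
pose x1 := c + d * (t0 + h); pose r1 := a + b * (t0 + h).
have [r [ra rb] E] := mvt_unordered (V^~ x1) (Vr^~ x1) r0 r1 (dr^~ x1).
have H1 : `|Vr r0 x0 - Vr r x1| <= M.
  apply: (H (r, x1)); split; [apply: At|apply: Bt]; rewrite /ball /=.
    rewrite distrC (le_lt_trans ra) // /r1 /r0 (_ : _ - _ = b * h) //; ring.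
  rewrite (_ : _ - _ = - (d * h)) ?normrN //; rewrite /x0 /x1; ring.
rewrite -/r1 -/x1 -/r0 -/x0.
have -> : V r1 x1 - V r0 x0 - (b * Vr r0 x0 + d * Vx r0 x0) * h =
   - (Vr r0 x0 - Vr r x1) * b * h + (V r0 x1 - V r0 x0 - Vx r0 x0 * d * h).
  have -> : V r1 x1 = V r0 x1 + Vr r x1 * (r1 - r0) by rewrite -E; ring.
  by rewrite /r1 /r0; ring.
rewrite (le_trans (ler_normD _ _)) // [e in leRHS]splitr mulrDl lerD //.
rewrite !normrM normrN ler_wpM2r //.
rewrite (@le_trans _ _ (M * (`|b| + 1))) //; last by rewrite /M divfK // gt_eqF.
by apply: ler_pM => //; lra.
Qed.

(** Reynolds transport theorem, for an integrand that is only known to be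
    differentiable along the lines of slope [- c]: translating the interval
    along these lines reduces the claim to a derivative under the integral
    sign plus the motion of the end points relative to the lines. *)
Lemma der_transport (P g : R -> R -> R) (c a a' b b' t0 : R) :
  continuous (fun z : R * R => P z.1 z.2) -> continuous (fun z : R * R => g z.1 z.2) ->
  (forall t x : R, is_derive t 1 (fun t => P t (x - c * t)) (g t (x - c * t))) ->
  is_derive t0 1 (fun t => oint (P t) (a + a' * t) (b + b' * t))
    ((b' + c) * P t0 (b + b' * t0) - (a' + c) * P t0 (a + a' * t0)
     + oint (g t0) (a + a' * t0) (b + b' * t0)).
Proof.
move=> cP cg dP.
pose W t x := P t (x - c * t); pose W' t x := g t (x - c * t).
have cW : continuous (fun z : R * R => W z.1 z.2) by rewrite /W; cts.
have cW' : continuous (fun z : R * R => W' z.1 z.2) by rewrite /W'; cts.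
have cWt t : continuous (W t) by cts.
have cW't t : continuous (W' t) by cts.
have E t u v : oint (P t) u v = oint (W t) (u + c * t) (v + c * t).
  rewrite -oint_shift //; congr (oint _ _ _).
  by apply/funext => x; rewrite /W addrK.
have E' t u v : oint (g t) u v = oint (W' t) (u + c * t) (v + c * t).
  rewrite -oint_shift //; congr (oint _ _ _).
  by apply/funext => x; rewrite /W' addrK.
pose Pi t x := oint (W t) 0 x; pose Pi' t x := oint (W' t) 0 x.
have cPi' : continuous (fun z : R * R => Pi' z.1 z.2).
  refine (cts_oint (fun z : R * R => W' z.1) (fun=> 0) (fun z => z.2) _ _ _); [by cts|exact: ctsC|by cts].
have dPi (t x : R) : is_derive t 1 (Pi^~ x) (Pi' t x) by exact: der_param.
have dPix (t x : R) : is_derive x 1 (Pi t) (W t x).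
  have := derB _ _ _ _ _ (der_prim _ x (cWt t)) (derC (prim (W t) 0) x).
  by rewrite subr0.
have D u u' : is_derive t0 1 (fun t => Pi t (u + u' * t + c * t))
    (Pi' t0 (u + u' * t0 + c * t0) + (u' + c) * W t0 (u + u' * t0 + c * t0)).
  have := der_line _ _ _ 0 1 u (u' + c) t0 dPi dPix cPi'.
  rewrite !add0r !mul1r mulrDl addrA.
  by under eq_fun do rewrite add0r mul1r mulrDl addrA.
have -> : (fun t => oint (P t) (a + a' * t) (b + b' * t)) =
   (fun t => Pi t (b + b' * t + c * t) - Pi t (a + a' * t + c * t)).
  by apply/funext => t; rewrite E /Pi /oint; ring.
apply: (is_derive_fct _ _ _ _ (derB _ _ _ _ _ (D b b') (D a a'))).
by rewrite E' /Pi' /W !addrK /oint; ring.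
Qed.

End parametric.

(** * Hyperbolic systems as evolutions in space *)

Section finite_sums.
Context {R : realType}.

Lemma cts_sum {U : topologicalType} {I : finType} (f : I -> U -> R) :
  (forall i, continuous (f i)) -> continuous (fun x => \sum_i f i x).
Proof.
move=> cf; have H (s : seq I) : continuous (fun x => \sum_(i <- s) f i x).
  elim: s => [|i s IH]; first by under eq_fun do rewrite big_nil; exact: ctsC.
  by under eq_fun do rewrite big_cons; exact: ctsD.
exact: H.
Qed.

Lemma der_sum {I : finType} (f f' : I -> R -> R) (x : R) :
  (forall i, is_derive x 1 (f i) (f' i x)) ->
  is_derive x 1 (fun y => \sum_i f i y) (\sum_i f' i x).
Proof.
move=> df; have H (s : seq I) : is_derive x 1 (fun y => \sum_(i <- s) f i y) (\sum_(i <- s) f' i x).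
  elim: s => [|i s IH].
    by rewrite big_nil; under eq_fun do rewrite big_nil; exact: derC.
  by rewrite big_cons; under eq_fun do rewrite big_cons; exact: derD.
exact: H.
Qed.

End finite_sums.

(** In the coordinate [r = s + tau j * x], constant along the characteristics
    of component [j], the system [phx j - tau j * phs j = sum_k a j k * ph k]
    becomes an integral equation in [x], which treats both directions of
    propagation alike. *)
Section picard.
Context {R : realType} {n : nat}.
Variables (tau : 'I_n -> R) (a : 'I_n -> 'I_n -> R -> R) (M : R).
Hypothesis a_cts : forall j k, continuous (a j k).
Hypothesis a_bd : forall j k y, `|a j k y| <= M.
Hypothesis M_gt0 : 0 < M.
Hypothesis n_gt0 : (0 < n)%N.

(* The weight grows on both sides of [x = 1], because the system is solved to
   the left and to the right; the rate [L] makes [T] a contraction of ratio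
   one half. *)
Let L : R := 2 * (n%:R * M).
Let w : R -> R := fun x => expR (L * (x - 1)) + expR (- L * (x - 1)).

Let L_gt0 : 0 < L. Proof. by rewrite !mulr_gt0 // ltr0n. Qed.

Let w_gt0 x : 0 < w x. Proof. by apply: addr_gt0; exact: expR_gt0. Qed.

Let w_ge0 x : 0 <= w x. Proof. exact: ltW. Qed.

Let w_ge1 x : 1 <= w x.
Proof.
have e1 (y : R) : 0 <= y -> 1 <= expR y by move=> y0; rewrite -expR0 ler_expR.
rewrite /w; have [h|h] := leP 0 (L * (x - 1)).
  by rewrite (le_trans (e1 _ h)) // lerDl expR_ge0.
have {}h : 0 <= - L * (x - 1) by rewrite mulNr oppr_ge0 ltW.
by rewrite (le_trans (e1 _ h)) // lerDr expR_ge0.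
Qed.

Let w_cts : continuous w.
Proof.
rewrite /w; apply: ctsD; apply: (cts1 _ _ (@continuous_expR R)); cts.
Qed.

Let oint_w x : oint w 1 x = (expR (L * (x - 1)) - expR (- L * (x - 1))) / L.
Proof.
have D (c y : R) : is_derive y 1 (fun y => expR (c * (y - 1))) (c * expR (c * (y - 1))).
  have h : is_derive y 1 (fun y => c * (y - 1)) (c * 1).
    by apply: derZ; have := derB _ _ _ _ _ (is_derive_id y 1) (derC 1 y); rewrite subr0.
  have := der_comp _ _ _ _ _ h (is_derive_expR _).
  by rewrite mulr1 mulrC.
have DD (y : R) : is_derive y 1 (fun y => L^-1 * (expR (L * (y - 1)) - expR (- L * (y - 1)))) (w y).
  apply: (is_derive_fct _ _ _ _ (derZ _ _ _ L^-1 (derB _ _ _ _ _ (D L y) (D (- L) y)))).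
  by rewrite mulNr opprK -mulrDr mulKf // gt_eqF.
rewrite (oint_ftc _ _ 1 x w_cts DD) subrr !mulr0 subrr mulr0 subr0 mulrC //.
Qed.

Let oint_w_le (f : R -> R) c x : continuous f -> 0 <= c -> (forall y, `|f y| <= c * w y) ->
  `|oint f 1 x| <= c / L * w x.
Proof.
move=> cf c0 fw.
have key : `|oint w 1 x| <= w x / L.
  have iL : 0 < L^-1 by rewrite invr_gt0.
  rewrite oint_w normrM (gtr0_norm iL); apply: ler_wpM2r; first exact: ltW.
  by rewrite (le_trans (ler_normB _ _)) // /w !gtr0_norm ?expR_gt0.
have ccw : continuous (fun y => c * w y) by cts.
have H : `|oint f 1 x| <= c * `|oint w 1 x|.
  have [x1|x1] := leP 1 x.
    by rewrite (le_trans (abs_oint _ _ _ _ cf ccw x1 (fun y _ => fw y))) // ointZ // ler_wpM2l // ler_norm.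
  rewrite oint_rev normrN (oint_rev w) normrN.
  by rewrite (le_trans (abs_oint _ _ _ _ cf ccw (ltW x1) (fun y _ => fw y))) // ointZ // ler_wpM2l // ler_norm.
rewrite (le_trans H) // (le_trans (ler_wpM2l c0 key)) //.
by rewrite mulrA mulrAC.
Qed.

Definition ctsF (v : 'I_n -> R -> R -> R) := forall j, continuous (fun z : R * R => v j z.1 z.2).

Let rhs (v : 'I_n -> R -> R -> R) j r y := \sum_k a j k y * v k (r + (tau k - tau j) * y) y.
Let T (v : 'I_n -> R -> R -> R) j r x := oint (rhs v j r) 1 x.

Let rhs_cts v j : ctsF v -> continuous (fun z : R * R => rhs v j z.1 z.2).
Proof.
move=> cv; apply: cts_sum => k; have ck := cv k; have cjk := a_cts j k.
rewrite /=; cts.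
Qed.

Let T_cts v : ctsF v -> ctsF (T v).
Proof.
move=> cv j; refine (cts_oint (fun z : R * R => rhs v j z.1) (fun=> 1) (fun z => z.2) _ _ _); [|exact: ctsC|by cts].
by have := rhs_cts v j cv => c; cts.
Qed.

Let rhs_le v j r y c : 0 <= c -> (forall k r y, `|v k r y| <= c * w y) ->
  `|rhs v j r y| <= (n%:R * M * c) * w y.
Proof.
move=> c0 vc; rewrite (le_trans (ler_norm_sum _ _ _)) //.
rewrite (@le_trans _ _ (\sum_(k < n) M * (c * w y))) //.
  by apply: ler_sum => k _; rewrite normrM ler_pM.
by rewrite sumr_const card_ord -[leLHS]mulr_natl !mulrA.
Qed.

Let T_le v c : ctsF v -> 0 <= c -> (forall k r y, `|v k r y| <= c * w y) ->
  forall k r y, `|T v k r y| <= c / 2 * w y.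
Proof.
move=> cv c0 vc k r y; have cr := rhs_cts v k cv.
have cf : continuous (rhs v k r) by cts.
rewrite (le_trans (oint_w_le _ (n%:R * M * c) _ cf _ _)) //.
- by rewrite !mulr_ge0 // ltW.
- by move=> z; exact: rhs_le.
- rewrite le_eqVlt; apply/orP; left; apply/eqP; rewrite /L; field.
  by rewrite (gt_eqF M_gt0) pnatr_eq0 -lt0n n_gt0.
Qed.

Let T_sub v v' : ctsF v -> ctsF v' ->
  forall k r y, T v k r y - T v' k r y = T (fun k r y => v k r y - v' k r y) k r y.
Proof.
move=> cv cv' k r y; have cr := rhs_cts v k cv; have cr' := rhs_cts v' k cv'.
have cf : continuous (rhs v k r) by cts.
have cf' : continuous (rhs v' k r) by cts.
rewrite /T -ointB //; congr (oint _ _ _); apply/funext => z.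
by rewrite /rhs -sumrB; apply: eq_bigr => i _; rewrite mulrBr.
Qed.

Section data.
Variables (d : 'I_n -> R -> R) (kap : R).
Hypothesis d_cts : forall j, continuous (d j).
Hypothesis d_bd : forall j r, `|d j r| <= kap.

Let kap_ge0 : 0 <= kap.
Proof. exact: le_trans (normr_ge0 _) (d_bd (Ordinal n_gt0) 0). Qed.

Fixpoint iter_S (m : nat) : 'I_n -> R -> R -> R :=
  if m is m'.+1 then fun j r x => d j r + T (iter_S m') j r x else fun _ _ _ => 0.

Lemma iter_S_cts m : ctsF (iter_S m).
Proof.
elim: m => [|m IH] j; first exact: ctsC.
have cT := T_cts _ IH j; have c1 := d_cts j.
by refine (ctsD (fun z : R * R => d j z.1) (fun z : R * R => T (iter_S m) j z.1 z.2) _ _); cts.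
Qed.

Let S_step m k r y : `|iter_S m.+1 k r y - iter_S m k r y| <= kap / 2 ^+ m * w y.
Proof.
have cS := iter_S_cts.
elim: m k r y => [|m IH] k r y.
  rewrite /= subr0 expr0 divr1 /T /oint.
  have -> : rhs (fun _ _ _ => 0) k r = (fun y => 0 * 1).
    by apply/funext => z; rewrite mulr1 /rhs big1 // => i _; rewrite mulr0.
  rewrite -/(oint _ 1 y) ointZ ?mul0r ?addr0; last exact: ctsC.
  by rewrite (le_trans (d_bd _ _)) // ler_peMr.
rewrite [iter_S m.+1 in X in _ - X]/= [iter_S m.+2]/= -/iter_S.
rewrite opprD addrACA subrr add0r T_sub //; last exact: iter_S_cts m.+1.
rewrite exprSr invfM mulrA; apply: T_le => //.
- by move=> j; apply: ctsD; [exact: iter_S_cts m.+1 j|apply: ctsN; exact: iter_S_cts m j].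
- by rewrite divr_ge0 // exprn_ge0.
Qed.

Let S_far m p k r y : `|iter_S (p + m) k r y - iter_S m k r y| <= (2 - 2 / 2 ^+ p) * kap / 2 ^+ m * w y.
Proof.
elim: p => [|p IH].
  by rewrite add0n subrr normr0 expr0 divr1 subrr !mul0r.
rewrite addSn (_ : _ - _ = (iter_S (p + m).+1 k r y - iter_S (p + m) k r y) + (iter_S (p + m) k r y - iter_S m k r y)); last ring.
rewrite (le_trans (ler_normD _ _)) // (le_trans (lerD (S_step _ _ _ _) IH)) //.
rewrite -mulrDl ler_wpM2r ?w_ge0 // le_eqVlt; apply/orP; left; apply/eqP.
rewrite exprD exprS; field.
by rewrite !expf_neq0 // pnatr_eq0.
Qed.

Let S_far_le m p k r y : (m <= p)%N -> `|iter_S p k r y - iter_S m k r y| <= 2 * kap / 2 ^+ m * w y.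
Proof.
move=> mp; rewrite -(subnK mp) (le_trans (S_far _ _ _ _ _)) // ler_wpM2r ?w_ge0 //.
rewrite ler_wpM2r ?invr_ge0 ?exprn_ge0 // ler_wpM2r //.
by rewrite lerBlDr lerDl divr_ge0 // exprn_ge0.
Qed.

Definition iter_lim j r x := lim (iter_S m j r x @[m --> \oo]).

Let small (C e : R) : 0 < e -> exists m, `|C| / 2 ^+ m <= e.
Proof.
move=> e0; have [m hm] : exists m : nat, `|C| / e <= m%:R.
  by exists (Num.truncn (`|C| / e)).+1; apply: ltW; apply: truncnS_gt.
exists m; rewrite ler_pdivrMr ?exprn_gt0 // mulrC -ler_pdivrMr //.
apply: (le_trans hm); rewrite -natrX ler_nat; exact: ltnW (ltn_expl _ _).
Qed.

Let lim_cvg j r x : iter_S m j r x @[m --> \oo] --> iter_lim j r x.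
Proof.
suff H : cvg (iter_S m j r x @[m --> \oo]) by exact: H.
apply/cauchy_cvgP; apply: cauchy_exP => e e0.
have [m hm] := small (2 * kap * w x) (e / 2) (divr_gt0 e0 (ltr0n _ 2)).
have mm : 2 * kap / 2 ^+ m * w x <= e / 2.
  by move: hm; rewrite ger0_norm ?mulr_ge0 ?w_ge0 // mulrAC.
exists (iter_S m j r x); exists m => // p /= mp.
rewrite /ball /= distrC (le_lt_trans (S_far_le _ _ _ _ _ mp)) // (le_lt_trans mm) //.
by rewrite ltr_pdivrMr // ltr_pMr // ltr1n.
Qed.

Lemma iter_lim_far m j r x : `|iter_lim j r x - iter_S m j r x| <= 2 * kap / 2 ^+ m * w x.
Proof.
have H : `|iter_S p j r x - iter_S m j r x| @[p --> \oo] --> `|iter_lim j r x - iter_S m j r x|.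
  by apply: cvg_norm; apply: cvgB; [exact: lim_cvg|exact: cvg_cst].
rewrite -(cvg_lim (@norm_hausdorff _ _) H); apply: limr_le; first by apply/cvg_ex; eexists; exact: H.
by exists m => // p /= mp; exact: S_far_le.
Qed.

Lemma iter_lim_bd j r x : `|iter_lim j r x| <= 2 * kap * w x.
Proof. by have := iter_lim_far 0 j r x; rewrite /= subr0 expr0 divr1. Qed.

Lemma iter_lim_cts : ctsF iter_lim.
Proof.
move=> j z0; apply/cvgrPdist_le => e e0 /=.
have W0 : 0 < w z0.2 + 1 by rewrite addr_gt0.
have e3 : 0 < e / 3 by rewrite divr_gt0.
have [m hm] := small (2 * kap * (w z0.2 + 1)) (e / 3) e3.
have mm (z : R * R) : w z.2 <= w z0.2 + 1 -> `|iter_lim j z.1 z.2 - iter_S m j z.1 z.2| <= e / 3.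
  move=> wz; rewrite (le_trans (iter_lim_far m _ _ _)) //; apply: le_trans hm.
  rewrite ger0_norm ?mulr_ge0 // ?(ltW W0) // mulrAC ler_wpM2r ?invr_ge0 ?exprn_ge0 //.
  by rewrite ler_wpM2l // mulr_ge0.
have cw : continuous (fun z : R * R => w z.2) by cts.
near=> z.
have wz : w z.2 <= w z0.2 + 1.
  have : `|w z0.2 - w z.2| <= 1.
    by near: z; have /cvgrPdist_le := cw z0; apply.
  by rewrite ler_distlC => /andP[_].
have S3 : `|iter_S m j z0.1 z0.2 - iter_S m j z.1 z.2| <= e / 3.
  by near: z; have /cvgrPdist_le := iter_S_cts m j z0; apply.
have h1 := mm z wz; have h0 := mm z0 (ltW (ltr_pwDr ltr01 (lexx _))).
rewrite (_ : _ - _ = (iter_lim j z0.1 z0.2 - iter_S m j z0.1 z0.2)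
  + (iter_S m j z0.1 z0.2 - iter_S m j z.1 z.2) - (iter_lim j z.1 z.2 - iter_S m j z.1 z.2)); last ring.
rewrite (le_trans (ler_normB _ _)) // (le_trans (lerD (ler_normD _ _) (lexx _))) //.
lra.
Unshelve. all: by end_near. Qed.

Lemma squeeze0 (C z : R) : (forall m, `|z| <= C / 2 ^+ m) -> z = 0.
Proof.
move=> H; apply/eqP; rewrite -normr_eq0 eq_le normr_ge0 andbT.
apply/ler_addgt0Pl => e e0; rewrite addr0.
have [m hm] := small C e e0; rewrite (le_trans (H m)) // (le_trans _ hm) //.
by rewrite ler_wpM2r ?invr_ge0 ?exprn_ge0 // ler_norm.
Qed.

Lemma iter_lim_eq j r x : iter_lim j r x = d j r + T iter_lim j r x.
Proof.
have cS := iter_S_cts.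
(* Both limits are replaced by the [m]-th iterates, up to a geometric error. *)
apply/eqP; rewrite -subr_eq0; apply/eqP; apply: (squeeze0 (4 * kap * w x)) => m.
rewrite (_ : _ - _ = (iter_lim j r x - iter_S m.+1 j r x) - (T iter_lim j r x - T (iter_S m) j r x)); last by rewrite /=; ring.
rewrite T_sub //; last exact: iter_lim_cts.
have H := T_le (fun k r y => iter_lim k r y - iter_S m k r y) (2 * kap / 2 ^+ m) _ _ (iter_lim_far m).
have {}H := H _ _ j r x.
rewrite (le_trans (ler_normB _ _)) //.
rewrite (le_trans (lerD (iter_lim_far _ _ _ _) (H _ _))) //.
- by move=> k; apply: ctsD; [exact: iter_lim_cts|apply: ctsN; exact: iter_S_cts m k].
- by rewrite divr_ge0 ?mulr_ge0 // exprn_ge0.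
- rewrite -mulrDl (mulrAC (4 * kap)) ler_wpM2r ?w_ge0 // exprS.
  rewrite (_ : _ + _ = 2 * kap / 2 ^+ m); last by field; rewrite expf_neq0 // pnatr_eq0.
  by rewrite !ler_wpM2r ?invr_ge0 ?exprn_ge0 // ler_nat.
Qed.

End data.

(** Differentiating the iteration in [r] gives the same iteration for the data
    [d'], so that the limits can be compared through the fundamental theorem of
    calculus. *)
Lemma iter_lim_der (d d' : 'I_n -> R -> R) (kap kap' : R) :
  (forall j, continuous (d j)) -> (forall j r, `|d j r| <= kap) ->
  (forall j, continuous (d' j)) -> (forall j r, `|d' j r| <= kap') ->
  (forall j (r : R), is_derive r 1 (d j) (d' j r)) ->
  forall j (r x : R), is_derive r 1 (fun r => iter_lim d j r x) (iter_lim d' j r x).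
Proof.
move=> dc db dc' db' dd.
have S_c := iter_S_cts d dc; have S_c' := iter_S_cts d' dc'.
have D m j (r x : R) : is_derive r 1 (fun r => iter_S d m j r x) (iter_S d' m j r x).
  elim: m j r x => [|m IH] j r x; first exact: derC.
  refine (derD (d j) (fun r => T (iter_S d m) j r x) r (d' j r) (T (iter_S d' m) j r x) (dd j r) _).
  apply: der_param; [exact: rhs_cts|exact: rhs_cts|].
  move=> t y; refine (der_sum (fun k t => a j k y * iter_S d m k (t + (tau k - tau j) * y) y)
    (fun k t => a j k y * iter_S d' m k (t + (tau k - tau j) * y) y) t _) => k; apply: derZ.
  have h : is_derive t 1 (fun t => t + (tau k - tau j) * y) 1.
    by have := derD _ _ _ _ _ (is_derive_id t 1) (derC ((tau k - tau j) * y) t); rewrite addr0.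
  have := der_comp (fun r => iter_S d m k r y) _ _ _ _ h (IH k _ y).
  by rewrite mulr1.
have cl' j := iter_lim_cts d' kap' dc' db' j.
have E j r x : iter_lim d j r x - iter_lim d j 0 x = oint (fun r => iter_lim d' j r x) 0 r.
  apply/eqP; rewrite -subr_eq0; apply/eqP.
  apply: (squeeze0 (4 * kap * w x + 2 * kap' * w x * `|r|)) => m.
  have c1 : continuous (fun r => iter_S d' m j r x) by have cc := S_c' m j; cts.
  have c2 : continuous (fun r => iter_lim d' j r x) by have cc := cl' j; cts.
  have F := oint_ftc _ _ 0 r c1 (fun r => D m j r x).
  rewrite (_ : _ - _ = ((iter_lim d j r x - iter_S d m j r x) - (iter_lim d j 0 x - iter_S d m j 0 x))
    - (oint (fun r => iter_lim d' j r x) 0 r - oint (fun r => iter_S d' m j r x) 0 r)); last by rewrite F; ring.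
  rewrite -ointB // mulrDl; apply: (le_trans (ler_normB _ _)); apply: lerD.
    apply: (le_trans (ler_normB _ _)).
    apply: (le_trans (lerD (iter_lim_far d kap dc db m _ _ _) (iter_lim_far d kap dc db m _ _ _))).
    by rewrite le_eqVlt; apply/orP; left; apply/eqP; field; rewrite expf_neq0 // pnatr_eq0.
  have c3 : continuous (fun r => iter_lim d' j r x - iter_S d' m j r x) by cts.
  apply: (le_trans (oint_bound _ _ _ _ c3 (fun y _ => iter_lim_far d' kap' dc' db' m j y x))).
  by rewrite subr0 le_eqVlt; apply/orP; left; apply/eqP; field; rewrite expf_neq0 // pnatr_eq0.
move=> j r x.
have -> : (fun r => iter_lim d j r x) = (fun r => (iter_lim d j 0 x - prim (fun r => iter_lim d' j r x) 0) + prim (fun r => iter_lim d' j r x) r).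
  by apply/funext => s; have := E j s x; rewrite /oint => E'; lra.
have c2 : continuous (fun r => iter_lim d' j r x) by have cc := cl' j; cts.
have := derD _ _ _ _ _ (derC (iter_lim d j 0 x - prim (fun r => iter_lim d' j r x) 0) r) (der_prim _ r c2).
by rewrite add0r.
Qed.

(** A linear hyperbolic system can be solved as an evolution in [x] for data
    given on the line [x = 1], whatever the signs of the speeds. *)
Theorem cauchy_problem (D D' : 'I_n -> R -> R) (kap kap' : R) :
  (forall j, continuous (D j)) -> (forall j r, `|D j r| <= kap) ->
  (forall j, continuous (D' j)) -> (forall j r, `|D' j r| <= kap') ->
  (forall j (r : R), is_derive r 1 (D j) (D' j r)) ->
  exists ph phs phx : 'I_n -> R -> R -> R,
  [/\ ctsF ph /\ ctsF phs /\ ctsF phx,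
      forall j (s x : R), is_derive s 1 (fun s => ph j s x) (phs j s x) /\
                          is_derive x 1 (ph j s) (phx j s x),
      forall j s, ph j s 1 = D j s,
      forall j s x, phx j s x - tau j * phs j s x = \sum_k a j k x * ph k s x &
      exists B, forall j s x, 0 <= x <= 1 -> `|ph j s x| <= B].
Proof.
move=> Dc Db Dc' Db' DD.
(* At [x = 1] the characteristic coordinate is [r = s + tau j]. *)
pose d j r := D j (r - tau j); pose d' j r := D' j (r - tau j).
have dc j : continuous (d j) by have := Dc j; rewrite /d => ?; cts.
have dc' j : continuous (d' j) by have := Dc' j; rewrite /d' => ?; cts.
have db j r : `|d j r| <= kap by exact: Db.
have db' j r : `|d' j r| <= kap' by exact: Db'.
have dd j (r : R) : is_derive r 1 (d j) (d' j r).
  have h : is_derive r 1 (fun r => r - tau j) 1.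
    by have := derB _ _ _ _ _ (is_derive_id r 1) (derC (tau j) r); rewrite subr0.
  by have := der_comp (D j) _ _ _ _ h (DD j _); rewrite mulr1.
pose v := iter_lim d; pose vr := iter_lim d'; pose vx := rhs v.
have cv j : continuous (fun z : R * R => v j z.1 z.2) by exact: iter_lim_cts db j.
have cvr j : continuous (fun z : R * R => vr j z.1 z.2) by exact: iter_lim_cts db' j.
have cvx j : continuous (fun z : R * R => vx j z.1 z.2) by exact: rhs_cts.
have dvr j (r x : R) : is_derive r 1 (fun r => v j r x) (vr j r x) by exact: iter_lim_der db dc' db' dd j r x.
have dvx j (r x : R) : is_derive x 1 (v j r) (vx j r x).
  have -> : v j r = fun x => (d j r - prim (vx j r) 1) + prim (vx j r) x.
    apply/funext => y; rewrite /v (iter_lim_eq d kap dc db) /T /oint /vx -/v; ring.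
  have c1 : continuous (vx j r) by have cc := cvx j; cts.
  by have := derD _ _ _ _ _ (derC (d j r - prim (vx j r) 1) x) (der_prim _ x c1); rewrite add0r.
exists (fun j s x => v j (s + tau j * x) x), (fun j s x => vr j (s + tau j * x) x),
  (fun j s x => tau j * vr j (s + tau j * x) x + vx j (s + tau j * x) x); split.
- by split; [|split] => j; have c1 := cv j; have c2 := cvr j; have c3 := cvx j; rewrite /=; cts.
- move=> j s x; split.
    have h : is_derive s 1 (fun t => t + tau j * x) 1.
      by have := derD _ _ _ _ _ (is_derive_id s 1) (derC (tau j * x) s); rewrite addr0.
    by have := der_comp (fun r => v j r x) _ _ _ _ h (dvr j _ x); rewrite mulr1.
  have := der_line (v j) (vr j) (vx j) s (tau j) 0 1 x (dvr j) (dvx j) (cvr j).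
  by under eq_fun do rewrite add0r mul1r; rewrite add0r !mul1r.
- move=> j s; rewrite mulr1 /v (iter_lim_eq d kap dc db) /T oint_id addr0 /d addrK //.
- move=> j s x; rewrite [LHS]addrC addKr /vx /rhs; apply: eq_bigr => k _.
  by congr (_ * v k _ _); ring.
- exists (2 * kap * (expR L + 1)) => j s x /andP[x0 x1].
  rewrite (le_trans (iter_lim_bd d kap dc db _ _ _)) //.
  rewrite ler_wpM2l //.
    by rewrite mulr_ge0 // (le_trans _ (Db (Ordinal n_gt0) 0)).
  have key (l : R) : 0 < l -> - l * (x - 1) <= l /\ l * (x - 1) <= 0 by nra.
  have [h1 h2] := key _ L_gt0.
  by rewrite /w addrC lerD // ?ler_expR // -[leRHS](@expR0 R) ler_expR.
Qed.

End picard.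

(** * Kernels continued to the plane *)

Section kernel.
Context {R : realType}.

Definition clamp01 (x : R) : R := Num.max 0 (Num.min x 1).
Definition clamp_tri (x xi : R) : R := Num.max 0 (Num.min xi (clamp01 x)).

Lemma cts_max {T : topologicalType} (f g : T -> R) :
  continuous f -> continuous g -> continuous (fun x => Num.max (f x) (g x)).
Proof. by move=> cf cg x; apply: continuous_max; [exact: cf|exact: cg]. Qed.

Lemma cts_min {T : topologicalType} (f g : T -> R) :
  continuous f -> continuous g -> continuous (fun x => Num.min (f x) (g x)).
Proof. by move=> cf cg x; apply: continuous_min; [exact: cf|exact: cg]. Qed.

Lemma clamp01_cts : continuous clamp01.
Proof. by refine (cts_max (fun=> 0) _ _ (cts_min id (fun=> 1) _ _)); cts. Qed.

Lemma clamp01_itv x : 0 <= clamp01 x <= 1.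
Proof. by rewrite /clamp01 le_max lexx /= ge_max ler01 ge_min lexx orbT. Qed.

Lemma clamp01_id x : 0 <= x <= 1 -> clamp01 x = x.
Proof. by move=> /andP[x0 x1]; rewrite /clamp01 min_l // max_r. Qed.

Lemma clamp_triP x xi : triangle (clamp01 x, clamp_tri x xi).
Proof.
have /andP[c0 c1] := clamp01_itv x.
split => /=; first by rewrite /clamp_tri le_max lexx.
by split => //; rewrite /clamp_tri ge_max c0 /= ge_min lexx orbT.
Qed.

Lemma clamp_tri_id x xi : triangle (x, xi) -> clamp01 x = x /\ clamp_tri x xi = xi.
Proof.
move=> [/= a [b c]]; have x01 : 0 <= x <= 1 by rewrite c (le_trans a b).
by rewrite /clamp_tri !clamp01_id // min_l // max_r.
Qed.

(** Composition with a retraction of the plane onto the triangle. *)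
Definition ret_tri (m : R -> R -> R) x xi := m (clamp01 x) (clamp_tri x xi).

Lemma ret_tri_id m x xi : triangle (x, xi) -> ret_tri m x xi = m x xi.
Proof. by move=> /clamp_tri_id[e1 e2]; rewrite /ret_tri e1 e2. Qed.

Lemma ret_tri_cts m : continuous_on_triangle m ->
  continuous (fun z : R * R => ret_tri m z.1 z.2).
Proof.
move=> cm z.
pose r (z : R * R) := (clamp01 z.1, clamp_tri z.1 z.2).
have c01 := clamp01_cts.
have cr1 : continuous (fun z : R * R => clamp01 z.1) by cts.
have cr2 : continuous (fun z : R * R => clamp_tri z.1 z.2).
  refine (cts_max (fun=> 0) (fun z => Num.min z.2 (clamp01 z.1)) _
    (cts_min (fun z => z.2) (fun z => clamp01 z.1) _ _)); cts.
have cr : continuous (fun z : R * R => (clamp01 z.1, clamp_tri z.1 z.2)).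
  exact: (cts_pair _ _ _ _ cr1 cr2).
have /subspace_continuousP/(_ (r z) (clamp_triP _ _)) H := cm.
apply: (@cvg_comp _ _ _ r (fun z => m z.1 z.2) _ _ _ _ H).
move=> A /= wA.
have H1 : \forall y \near z, triangle (r y) -> A (r y) by exact: (cr z _ wA).
by apply: filterS H1 => y; apply; exact: clamp_triP.
Qed.

Lemma triangle_convex (x xi cx cxi s t : R) : 0 <= t <= s ->
  triangle (x, xi) -> triangle (x + cx * s, xi + cxi * s) ->
  triangle (x + cx * t, xi + cxi * t).
Proof.
move=> /andP[t0 ts] [/= a1 [a2 a3]] [/= b1 [b2 b3]].
have key (A B : R) : 0 <= A -> 0 <= A + B * s -> 0 <= A + B * t.
  move=> hA hB; have [B0|B0] := leP 0 B; first by rewrite addr_ge0 // mulr_ge0.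
  by apply: (le_trans hB); rewrite lerD2l ler_nM2l.
have k1 := key xi cxi a1 b1.
have k2 : 0 <= (x - xi) + (cx - cxi) * t by apply: key; rewrite ?subr_ge0 // mulrBl; lra.
have k3 : 0 <= (1 - x) + (- cx) * t by apply: key; rewrite ?subr_ge0 // mulNr; lra.
split; rewrite /=; first lra.
split; [rewrite mulrBl in k2|rewrite mulNr in k3]; lra.
Qed.

(** A kernel that solves its equation on the triangle is continued to the
    plane along the characteristics, starting from a part of the boundary. The
    continuation is differentiable in the characteristic direction everywhere,
    at the boundary of the triangle as well as inside. The affine function
    [p * x + q * xi + r] is the time taken from that part of the boundary. *)
Lemma extend_along_characteristics (cx cxi p q r : R) (m F G : R -> R -> R) :
  p * cx + q * cxi = 1 ->
  (forall x xi, triangle (x, xi) ->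
     triangle (x - (p * x + q * xi + r) * cx, xi - (p * x + q * xi + r) * cxi)) ->
  continuous_on_triangle m ->
  continuous (fun z : R * R => G z.1 z.2) ->
  (forall x xi, triangle (x, xi) -> G x xi = F x xi) ->
  solves_along_characteristics cx cxi m F ->
  exists n : R -> R -> R,
  [/\ continuous (fun z : R * R => n z.1 z.2),
      forall x xi, triangle (x, xi) -> n x xi = m x xi &
      forall x xi t : R, is_derive t 1 (fun t => n (x + cx * t) (xi + cxi * t))
                                       (G (x + cx * t) (xi + cxi * t))].
Proof.
move=> pq bT cm cG GF sol.
pose tm x xi := p * x + q * xi + r.
pose n x xi := ret_tri m (x - tm x xi * cx) (xi - tm x xi * cxi)
  + oint (fun t : R => G (x - tm x xi * cx + t * cx) (xi - tm x xi * cxi + t * cxi)) 0 (tm x xi).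
exists n; split.
- have c1 := ret_tri_cts _ cm.
  apply: ctsD; first by rewrite /tm; cts.
  refine (cts_oint (fun z t => G (z.1 - tm z.1 z.2 * cx + t * cx) (z.2 - tm z.1 z.2 * cxi + t * cxi))
    (fun=> 0) (fun z => tm z.1 z.2) _ _ _); rewrite /tm; [cts|exact: ctsC|cts].
- move=> x xi Tx; rewrite /n; set t := tm x xi.
  have Tb := bT _ _ Tx; rewrite -/(tm x xi) -/t in Tb.
  set bx := x - t * cx in Tb *; set bxi := xi - t * cxi in Tb *.
  have ex : x = bx + cx * t by rewrite /bx; ring.
  have exi : xi = bxi + cxi * t by rewrite /bxi; ring.
  have cGl : continuous (fun t : R => G (bx + t * cx) (bxi + t * cxi)) by cts.
  suff -> : oint (fun t : R => G (bx + t * cx) (bxi + t * cxi)) 0 t = m x xi - m bx bxi.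
    by rewrite ret_tri_id // addrC subrK.
  have [t0|t0] := leP 0 t.
    have Tt : triangle (bx + cx * t, bxi + cxi * t) by rewrite -ex -exi.
    rewrite [in RHS]ex [in X in m _ X]exi sol // oint_Rint //.
    apply: eq_Rintegral => s; rewrite inE /= in_itv /= => st.
    by rewrite !(mulrC s) GF //; apply: (triangle_convex _ _ _ _ t).
  have nt : 0 <= - t by rewrite oppr_ge0 ltW.
  have Tt : triangle (x + cx * (- t), xi + cxi * (- t)).
    by rewrite !mulrN -!(mulrC t).
  have -> : m bx bxi = m (x + cx * (- t)) (xi + cxi * (- t)) by rewrite /bx /bxi; congr (m _ _); ring.
  rewrite oint_rev -[RHS]opprB sol //; congr (- _).
  have := oint_shift (fun t : R => G (bx + t * cx) (bxi + t * cxi)) 0 (- t) t cGl.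
  rewrite add0r addNr => <-.
  rewrite oint_Rint //; last by cts.
  apply: eq_Rintegral => s; rewrite inE /= in_itv /= => st.
  have -> : bx + (s + t) * cx = x + cx * s by rewrite /bx; ring.
  have -> : bxi + (s + t) * cxi = xi + cxi * s by rewrite /bxi; ring.
  by rewrite GF //; exact: (triangle_convex _ _ _ _ (- t)).
- move=> x xi t.
  have tmE s : tm (x + cx * s) (xi + cxi * s) = tm x xi + s.
    by rewrite /tm -[s in RHS]mul1r -pq; ring.
  set bx := x - tm x xi * cx; set bxi := xi - tm x xi * cxi.
  have -> : (fun s => n (x + cx * s) (xi + cxi * s)) = (fun s =>
     ret_tri m bx bxi - prim (fun t : R => G (bx + t * cx) (bxi + t * cxi)) 0
     + prim (fun t : R => G (bx + t * cx) (bxi + t * cxi)) (tm x xi + 1 * s)).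
    apply/funext => s; rewrite /n tmE mul1r /oint.
    have -> : x + cx * s - (tm x xi + s) * cx = bx by rewrite /bx; ring.
    have -> : xi + cxi * s - (tm x xi + s) * cxi = bxi by rewrite /bxi; ring.
    by ring.
  have cGl : continuous (fun t : R => G (bx + t * cx) (bxi + t * cxi)) by cts.
  have := derD _ _ _ _ _ (derC (ret_tri m bx bxi - prim (fun t : R => G (bx + t * cx) (bxi + t * cxi)) 0) t)
     (der_comp _ _ _ _ _ (der_affine (tm x xi) 1 t) (der_prim _ _ cGl)).
  rewrite add0r mulr1 /=; congr (is_derive _ _ _ (G _ _)); rewrite /bx /bxi; ring.
Qed.

End kernel.

Section kernel_system.
Context {R : realType}.
Variable K : coefficients R.

(** The kernel equations for kernels living on the whole plane: [f k] is the
    derivative of [n k] along its characteristics, and the coefficients only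
    have to be the right ones over the triangle. *)
Record plane_kernel (n1 n2 n3 f1 f2 f3 : R -> R -> R) : Prop := PlaneKernel {
  pk_n1 : continuous (fun z : R * R => n1 z.1 z.2);
  pk_n2 : continuous (fun z : R * R => n2 z.1 z.2);
  pk_n3 : continuous (fun z : R * R => n3 z.1 z.2);
  pk_f1 : continuous (fun z : R * R => f1 z.1 z.2);
  pk_f2 : continuous (fun z : R * R => f2 z.1 z.2);
  pk_f3 : continuous (fun z : R * R => f3 z.1 z.2);
  pk_d1 : forall x xi t : R, is_derive t 1 (fun t => n1 (x + gamma1 K * t) (xi + - mu K * t))
                                   (f1 (x + gamma1 K * t) (xi + - mu K * t));
  pk_d2 : forall x xi t : R, is_derive t 1 (fun t => n2 (x + gamma2 K * t) (xi + - mu K * t))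
                                   (f2 (x + gamma2 K * t) (xi + - mu K * t));
  pk_d3 : forall x xi t : R, is_derive t 1 (fun t => n3 (x + mu K * t) (xi + mu K * t))
                                   (f3 (x + mu K * t) (xi + mu K * t));
  pk_e1 : forall x xi, 0 <= xi -> xi <= x -> x <= 1 ->
    f1 x xi = sigma11 K * n1 x xi + sigma12 K * n2 x xi + alpha K x * n3 x xi;
  pk_e2 : forall x xi, 0 <= xi -> xi <= x -> x <= 1 ->
    f2 x xi = sigma21 K * n1 x xi + sigma22 K * n2 x xi + alpha K x * n3 x xi;
  pk_e3 : forall x xi, 0 <= xi -> xi <= x -> x <= 1 ->
    f3 x xi = - theta1 K x * n1 x xi - theta2 K x * n2 x xi;
  pk_b1 : forall x, 0 <= x <= 1 -> (gamma1 K + mu K) * n1 x x = alpha K x;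
  pk_b2 : forall x, 0 <= x <= 1 -> (gamma2 K + mu K) * n2 x x = alpha K x;
  pk_b3 : forall xi, 0 <= xi <= 1 -> n3 1 xi = rho1 K * n1 1 xi + rho2 K * n2 1 xi }.

Lemma plane_kernel_ex (m1 m2 m3 : R -> R -> R) :
  0 < mu K -> 0 < gamma1 K -> 0 < gamma2 K ->
  continuous (alpha K) -> continuous (theta1 K) -> continuous (theta2 K) ->
  continuous_on_triangle m1 -> continuous_on_triangle m2 -> continuous_on_triangle m3 ->
  observer_kernel K m1 m2 m3 ->
  exists n1 n2 n3 f1 f2 f3, plane_kernel n1 n2 n3 f1 f2 f3 /\
   (forall x, 0 <= x <= 1 -> [/\ n1 x 0 = m1 x 0, n2 x 0 = m2 x 0 & n3 x 0 = m3 x 0]).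
Proof.
move=> mu0 g10 g20 ca ct1 ct2 c1 c2 c3 [s1 s2 s3 bd bd3].
have cl := @clamp01_cts R.
have r1 := ret_tri_cts _ c1; have r2 := ret_tri_cts _ c2; have r3 := ret_tri_cts _ c3.
(* The first two families of characteristics are followed from the diagonal. *)
have tri_s (g : R) : 0 < g -> forall x xi, triangle (x, xi) ->
    triangle (x - ((g + mu K)^-1 * x + - (g + mu K)^-1 * xi + 0) * g,
              xi - ((g + mu K)^-1 * x + - (g + mu K)^-1 * xi + 0) * (- mu K)).
  move=> g0 x xi [/= a [b c]].
  have gm : g + mu K != 0 by rewrite gt_eqF // addr_gt0.
  set d := (mu K * x + g * xi) / (g + mu K).
  have -> : x - ((g + mu K)^-1 * x + - (g + mu K)^-1 * xi + 0) * g = d by rewrite /d; field.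
  have -> : xi - ((g + mu K)^-1 * x + - (g + mu K)^-1 * xi + 0) * (- mu K) = d by rewrite /d; field.
  split; rewrite /=; last split => //.
    by rewrite divr_ge0 ?addr_ge0 ?mulr_ge0 ?(ltW mu0) ?(ltW g0) // (le_trans a).
  rewrite /d ler_pdivrMr ?addr_gt0 // mul1r addrC lerD //.
    by rewrite ler_piMr ?(ltW g0) // (le_trans b).
  by rewrite ler_piMr // ltW.
have pq (g : R) : 0 < g -> (g + mu K)^-1 * g + - (g + mu K)^-1 * - mu K = 1.
  by move=> g0; field; rewrite gt_eqF // addr_gt0.
pose f1 x xi := sigma11 K * ret_tri m1 x xi + sigma12 K * ret_tri m2 x xi + alpha K x * ret_tri m3 x xi.
pose f2 x xi := sigma21 K * ret_tri m1 x xi + sigma22 K * ret_tri m2 x xi + alpha K x * ret_tri m3 x xi.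
pose f3 x xi := - theta1 K x * ret_tri m1 x xi - theta2 K x * ret_tri m2 x xi.
have cf1 : continuous (fun z : R * R => f1 z.1 z.2) by rewrite /f1; cts.
have cf2 : continuous (fun z : R * R => f2 z.1 z.2) by rewrite /f2; cts.
have cf3 : continuous (fun z : R * R => f3 z.1 z.2) by rewrite /f3; cts.
have [n1 [cn1 e1 d1]] := extend_along_characteristics _ _ _ _ _ m1 _ f1 (pq _ g10) (tri_s _ g10) c1 cf1
  (fun x xi T => ltac:(rewrite /f1 !ret_tri_id //)) s1.
have [n2 [cn2 e2 d2]] := extend_along_characteristics _ _ _ _ _ m2 _ f2 (pq _ g20) (tri_s _ g20) c2 cf2
  (fun x xi T => ltac:(rewrite /f2 !ret_tri_id //)) s2.
have pq3 : (mu K)^-1 * mu K + 0 * mu K = 1 by rewrite mulVf ?gt_eqF // mul0r addr0.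
(* The third family is followed backwards from the side [x = 1]. *)
have tri3 x xi : triangle (x, xi) ->
    triangle (x - ((mu K)^-1 * x + 0 * xi + - (mu K)^-1) * mu K,
              xi - ((mu K)^-1 * x + 0 * xi + - (mu K)^-1) * mu K).
  move=> [/= a [b c]].
  have m0 : mu K != 0 by rewrite gt_eqF.
  have -> : x - ((mu K)^-1 * x + 0 * xi + - (mu K)^-1) * mu K = 1 by field.
  have -> : xi - ((mu K)^-1 * x + 0 * xi + - (mu K)^-1) * mu K = xi + 1 - x by field.
  by split => /=; [lra|split; lra].
have [n3 [cn3 e3 d3]] := extend_along_characteristics _ _ _ _ _ m3 _ f3 pq3 tri3 c3 cf3
  (fun x xi T => ltac:(rewrite /f3 !ret_tri_id //)) s3.
have T x xi : 0 <= xi -> xi <= x -> x <= 1 -> triangle (x, xi) by [].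
exists n1, n2, n3, f1, f2, f3; split; last first.
  by move=> x /andP[x0 x1]; rewrite e1 ?e2 ?e3.
split => //.
- by move=> x xi a b c; rewrite /f1 !ret_tri_id // e1 // e2 // e3.
- by move=> x xi a b c; rewrite /f2 !ret_tri_id // e1 // e2 // e3.
- by move=> x xi a b c; rewrite /f3 !ret_tri_id // e1 // e2.
- move=> x /[dup] x01 /andP[x0 x1]; rewrite e1 //; have [-> _] := bd x x01.
  by rewrite mulrC divfK // gt_eqF // addr_gt0.
- move=> x /[dup] x01 /andP[x0 x1]; rewrite e2 //; have [_ ->] := bd x x01.
  by rewrite mulrC divfK // gt_eqF // addr_gt0.
- by move=> xi /[dup] x01 /andP[x0 x1]; rewrite e1 // e2 // e3 // bd3.
Qed.

End kernel_system.

(** * The dual system *)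

Section bounds.
Context {R : realType}.

Lemma bounded01 (f : R -> R) : continuous f ->
  exists2 M, 0 <= M & forall x, 0 <= x <= 1 -> `|f x| <= M.
Proof.
move=> cf; have c : compact (f @` `[0, 1]%classic).
  by apply: continuous_compact; [exact: continuous_subspaceT|exact: segment_compact].
have [M [_ HM]] := compact_bounded c.
exists (`|M| + 1); first by rewrite addr_ge0.
move=> x x01; apply: (HM (`|M| + 1)); first by rewrite (le_lt_trans (ler_norm M)) // ltrDl.
by exists x; rewrite //= in_itv.
Qed.

Lemma bounded01_fin {I : finType} (f : I -> R -> R) : (forall i, continuous (f i)) ->
  exists2 M, 0 < M & forall i x, 0 <= x <= 1 -> `|f i x| <= M.
Proof.
move=> cf.
have [M M0 HM] : exists2 M, 0 < M & forall i x, i \in enum I -> 0 <= x <= 1 -> `|f i x| <= M.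
  elim: (enum I) => [|i s [M M0 IH]]; first by exists 1.
  have [N N0 HN] := bounded01 _ (cf i).
  exists (M + N); first by rewrite ltr_wpDr.
  move=> j x; rewrite inE => /predU1P[->|js] x01.
    by rewrite (le_trans (HN x x01)) // lerDr ltW.
  by rewrite (le_trans (IH j x js x01)) // lerDl.
by exists M => // i x; apply: HM; rewrite mem_enum.
Qed.

End bounds.

Section dual.
Context {R : realType}.
Variable K : coefficients R.
Hypotheses (mu0 : 0 < mu K) (g10 : 0 < gamma1 K) (g20 : 0 < gamma2 K).
Hypotheses (ca : continuous (alpha K)) (ct1 : continuous (theta1 K)) (ct2 : continuous (theta2 K)).

(** Classical solutions of the formal adjoint, in reversed time [s], of the
    error system without injection, with source [eta s * h_j x]. The boundary
    conditions at [x = 1] are the adjoint of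
    [w = rho1 * u1 + rho2 * u2]; they leave the function [beta] free. *)
Record dual_solution (h1 h2 h3 eta beta : R -> R) (p1 p2 p3 p1s p2s p3s p1x p2x p3x : R -> R -> R) : Prop := DualSolution {
  du_c1 : continuous (fun z : R * R => p1 z.1 z.2);
  du_c2 : continuous (fun z : R * R => p2 z.1 z.2);
  du_c3 : continuous (fun z : R * R => p3 z.1 z.2);
  du_c1s : continuous (fun z : R * R => p1s z.1 z.2);
  du_c2s : continuous (fun z : R * R => p2s z.1 z.2);
  du_c3s : continuous (fun z : R * R => p3s z.1 z.2);
  du_c1x : continuous (fun z : R * R => p1x z.1 z.2);
  du_c2x : continuous (fun z : R * R => p2x z.1 z.2);
  du_c3x : continuous (fun z : R * R => p3x z.1 z.2);
  du_d1s : forall s x : R, is_derive s 1 (fun s => p1 s x) (p1s s x);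
  du_d2s : forall s x : R, is_derive s 1 (fun s => p2 s x) (p2s s x);
  du_d3s : forall s x : R, is_derive s 1 (fun s => p3 s x) (p3s s x);
  du_d1x : forall s x : R, is_derive x 1 (p1 s) (p1x s x);
  du_d2x : forall s x : R, is_derive x 1 (p2 s) (p2x s x);
  du_d3x : forall s x : R, is_derive x 1 (p3 s) (p3x s x);
  du_e1 : forall s x : R, 0 <= x <= 1 -> p1s s x = gamma1 K * p1x s x
    + (sigma11 K * p1 s x + sigma21 K * p2 s x + theta1 K x * p3 s x + eta s * h1 x);
  du_e2 : forall s x : R, 0 <= x <= 1 -> p2s s x = gamma2 K * p2x s x
    + (sigma12 K * p1 s x + sigma22 K * p2 s x + theta2 K x * p3 s x + eta s * h2 x);
  du_e3 : forall s x : R, 0 <= x <= 1 -> p3s s x = - mu K * p3x s x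
    + (alpha K x * p1 s x + alpha K x * p2 s x + eta s * h3 x);
  du_b1 : forall s, gamma1 K * p1 s 1 = mu K * rho1 K * beta s;
  du_b2 : forall s, gamma2 K * p2 s 1 = mu K * rho2 K * beta s;
  du_b3 : forall s, p3 s 1 = beta s;
  du_bd : exists B, forall s x, 0 <= x <= 1 -> [/\ `|p1 s x| <= B, `|p2 s x| <= B & `|p3 s x| <= B] }.

Let i0 : 'I_4 := @Ordinal 4 0 isT.
Let i1 : 'I_4 := @Ordinal 4 1 isT.
Let i2 : 'I_4 := @Ordinal 4 2 isT.
Let i3 : 'I_4 := @Ordinal 4 3 isT.

Let ord4P (P : 'I_4 -> Prop) : P i0 -> P i1 -> P i2 -> P i3 -> forall i, P i.
Proof.
move=> h0 h1 h2 h3 [[|[|[|[|//]]]] Hi].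
- by rewrite (_ : Ordinal Hi = i0) //; apply: val_inj.
- by rewrite (_ : Ordinal Hi = i1) //; apply: val_inj.
- by rewrite (_ : Ordinal Hi = i2) //; apply: val_inj.
- by rewrite (_ : Ordinal Hi = i3) //; apply: val_inj.
Qed.

Let big4 (F : 'I_4 -> R) : \sum_i F i = F i0 + F i1 + F i2 + F i3.
Proof.
rewrite !big_ord_recl big_ord0 addr0 !addrA.
by congr (F _ + F _ + F _ + F _); apply: val_inj.
Qed.

Definition sel4 {A : Type} (a b c d : A) (i : 'I_4) : A :=
  match val i with 0%N => a | 1%N => b | 2%N => c | _ => d end.

(** The source is taken into the system as a fourth component, constant in [x]
    and equal to [eta], so that the system becomes homogeneous. *)
Lemma dual_solution_ex (h1 h2 h3 eta eta' beta beta' : R -> R) N :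
  continuous h1 -> continuous h2 -> continuous h3 ->
  continuous eta -> continuous eta' -> (forall s : R, is_derive s 1 eta (eta' s)) ->
  continuous beta -> continuous beta' -> (forall s : R, is_derive s 1 beta (beta' s)) ->
  (forall s, `|eta s| <= N) -> (forall s, `|eta' s| <= N) ->
  (forall s, `|beta s| <= N) -> (forall s, `|beta' s| <= N) ->
  exists p1 p2 p3 p1s p2s p3s p1x p2x p3x,
    dual_solution h1 h2 h3 eta beta p1 p2 p3 p1s p2s p3s p1x p2x p3x.
Proof.
move=> ch1 ch2 ch3 ce ce' de cb cb' db Ne Ne' Nb Nb'.
have ccl := @clamp01_cts R.
pose g1 := gamma1 K; pose g2 := gamma2 K; pose m := mu K.
have g1n : g1 != 0 by rewrite gt_eqF.
have g2n : g2 != 0 by rewrite gt_eqF.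
have mn : m != 0 by rewrite gt_eqF.
pose tau := sel4 g1^-1 g2^-1 (- m^-1) 0.
pose a0 (j k : 'I_4) : R -> R := sel4
  (sel4 (fun=> - g1^-1 * sigma11 K) (fun=> - g1^-1 * sigma21 K) (fun x => - g1^-1 * theta1 K x) (fun x => - g1^-1 * h1 x))
  (sel4 (fun=> - g2^-1 * sigma12 K) (fun=> - g2^-1 * sigma22 K) (fun x => - g2^-1 * theta2 K x) (fun x => - g2^-1 * h2 x))
  (sel4 (fun x => m^-1 * alpha K x) (fun x => m^-1 * alpha K x) (fun=> 0) (fun x => m^-1 * h3 x))
  (sel4 (fun=> 0) (fun=> 0) (fun=> 0) (fun=> 0)) j k.
have ca0 j k : continuous (a0 j k).
  by elim/ord4P : j; elim/ord4P : k; rewrite /a0 /sel4 /=; cts.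
have [M M0 HM] := bounded01_fin (fun jk : 'I_4 * 'I_4 => a0 jk.1 jk.2) (fun jk => ca0 _ _).
(* Clamping bounds the coefficients on the whole line. *)
pose a j k x := a0 j k (clamp01 x).
have cca j k : continuous (a j k) by have c := ca0 j k; rewrite /a; cts.
have Ha j k x : `|a j k x| <= M by apply: (HM (j, k)); exact: clamp01_itv.
pose D := sel4 (fun s => g1^-1 * (m * rho1 K) * beta s) (fun s => g2^-1 * (m * rho2 K) * beta s) beta eta.
pose D' := sel4 (fun s => g1^-1 * (m * rho1 K) * beta' s) (fun s => g2^-1 * (m * rho2 K) * beta' s) beta' eta'.
pose kap := (`|g1^-1 * (m * rho1 K)| + `|g2^-1 * (m * rho2 K)| + 1) * N.
have N0 : 0 <= N := le_trans (normr_ge0 _) (Ne 0).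
have kapP (c b : R) : `|c| <= `|g1^-1 * (m * rho1 K)| + `|g2^-1 * (m * rho2 K)| + 1 -> `|b| <= N -> `|c * b| <= kap.
  by move=> hc hb; rewrite normrM ler_pM.
have kapP1 (b : R) : `|b| <= N -> `|b| <= kap.
  by move=> hb; rewrite -[b]mul1r; apply: kapP => //; rewrite normr1 lerDr addr_ge0.
have l1 : `|g1^-1 * (m * rho1 K)| <= `|g1^-1 * (m * rho1 K)| + `|g2^-1 * (m * rho2 K)| + 1.
  by rewrite -addrA lerDl addr_ge0.
have l2 : `|g2^-1 * (m * rho2 K)| <= `|g1^-1 * (m * rho1 K)| + `|g2^-1 * (m * rho2 K)| + 1.
  by rewrite addrAC lerDr addr_ge0.
have cD j : continuous (D j) by elim/ord4P : j; rewrite /D /sel4 /=; cts.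
have cD' j : continuous (D' j) by elim/ord4P : j; rewrite /D' /sel4 /=; cts.
have bD j s : `|D j s| <= kap.
  by elim/ord4P : j; rewrite /D /sel4 /=; [apply: kapP|apply: kapP|apply: kapP1|apply: kapP1].
have bD' j s : `|D' j s| <= kap.
  by elim/ord4P : j; rewrite /D' /sel4 /=; [apply: kapP|apply: kapP|apply: kapP1|apply: kapP1].
have dD j (s : R) : is_derive s 1 (D j) (D' j s).
  by elim/ord4P : j; rewrite /D /D' /sel4 /=; [exact: derZ|exact: derZ|exact: db|exact: de].
have [ph [phs [phx [[cp [cps cpx]] dp bp eqp [B HB]]]]] :=
  cauchy_problem tau a M cca Ha M0 isT D D' kap kap cD bD cD' bD' dD.
have eta_eq s x : ph i3 s x = eta s.
  have /= d0 (y : R) : is_derive y 1 (ph i3 s) 0.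
    have := eqp i3 s y; rewrite big4 /tau /a /a0 /sel4 /= !mul0r !addr0 subr0 => E.
    by rewrite -E; have [_] := dp i3 s y.
  have := eq_increment (ph i3 s) (fun=> 0) 1 x _ d0 (fun y => derC 0 y).
  by rewrite subrr bp => /eqP; rewrite subr_eq0 => /eqP.
exists (ph i0), (ph i1), (ph i2), (phs i0), (phs i1), (phs i2), (phx i0), (phx i1), (phx i2).
split; try (move=> s x; by case: (dp i0 s x)); try (move=> s x; by case: (dp i1 s x));
  try (move=> s x; by case: (dp i2 s x)); try exact: cp; try exact: cps; try exact: cpx.
- move=> s x x01; have := eqp i0 s x; rewrite big4 /tau /a /a0 /sel4 /= eta_eq clamp01_id // -/g1 => E.
  have -> : phs i0 s x = g1 * (phx i0 s x - (phx i0 s x - g1^-1 * phs i0 s x)) by field.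
  by rewrite E; field.
- move=> s x x01; have := eqp i1 s x; rewrite big4 /tau /a /a0 /sel4 /= eta_eq clamp01_id // -/g2 => E.
  have -> : phs i1 s x = g2 * (phx i1 s x - (phx i1 s x - g2^-1 * phs i1 s x)) by field.
  by rewrite E; field.
- move=> s x x01; have := eqp i2 s x; rewrite big4 /tau /a /a0 /sel4 /= eta_eq clamp01_id // -/m => E.
  have -> : phs i2 s x = - m * (phx i2 s x - (phx i2 s x - - m^-1 * phs i2 s x)) by field.
  by rewrite E; field.
- by move=> s; rewrite bp /D /sel4 /= -/g1 -/m; field.
- by move=> s; rewrite bp /D /sel4 /= -/g2 -/m; field.
- by move=> s; rewrite bp.
- by exists B => s x x01; rewrite !HB.
Qed.

End dual.

(** * The Volterra transform of a dual solution *)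

Section volterra.
Context {R : realType}.

(** Adjoint of the operator that maps [g] to the function with value
    [int_0^x n(x, xi) g(xi) dxi] at [x]. *)
Definition volterra (n : R -> R -> R) (f : R -> R) (xi : R) : R :=
  oint (fun x => n x xi * f x) xi 1.

Lemma volterra_cts (n : R -> R -> R) (p : R -> R -> R) :
  continuous (fun z : R * R => n z.1 z.2) -> continuous (fun z : R * R => p z.1 z.2) ->
  continuous (fun z : R * R => volterra n (p z.1) z.2).
Proof.
move=> cn cp.
refine (cts_oint (fun (z : R * R) x => n x z.2 * p z.1 x) (fun z => z.2) (fun=> 1) _ _ _); cts.
Qed.

Lemma volterra_fun_cts (n : R -> R -> R) (f : R -> R) :
  continuous (fun z : R * R => n z.1 z.2) -> continuous f -> continuous (volterra n f).
Proof.
move=> cn cf; refine (cts_oint (fun y x => n x y * f x) (fun y => y) (fun=> 1) _ _ _); cts.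
Qed.

(** The kernel is differentiable along the direction [(c, - m)] and the function
    along [(1, - c)]: moving the lower end point at speed [m] while the lines of
    [der_transport] have slope [- c] uses exactly these two derivatives. *)
Lemma der_volterra (n f p q : R -> R -> R) (c m : R) :
  continuous (fun z : R * R => n z.1 z.2) -> continuous (fun z : R * R => f z.1 z.2) ->
  continuous (fun z : R * R => p z.1 z.2) -> continuous (fun z : R * R => q z.1 z.2) ->
  (forall x xi t : R, is_derive t 1 (fun t => n (x + c * t) (xi + - m * t)) (f (x + c * t) (xi + - m * t))) ->
  (forall t x : R, is_derive t 1 (fun t => p t (x - c * t)) (q t (x - c * t))) ->
  forall xi t : R, is_derive t 1 (fun t => volterra n (p t) (xi + m * t))
    (c * (n 1 (xi + m * t) * p t 1)
     - (m + c) * (n (xi + m * t) (xi + m * t) * p t (xi + m * t))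
     + oint (fun x => n x (xi + m * t) * q t x - f x (xi + m * t) * p t x) (xi + m * t) 1).
Proof.
move=> cn cf cp cq dn dp xi t.
have dn' x (s : R) : is_derive s 1 (fun t => n (x - c * t) (xi + m * t)) (- f (x - c * s) (xi + m * s)).
  have := der_comp _ _ _ _ _ (is_deriveNid s 1) (dn x xi (- s)).
  rewrite mulrN1 !mulrN !mulNr !opprK.
  by under eq_fun do rewrite mulNr !mulrN opprK.
pose P t x := n x (xi + m * t) * p t x.
pose g t x := n x (xi + m * t) * q t x - f x (xi + m * t) * p t x.
have -> : (fun t => volterra n (p t) (xi + m * t)) = fun t => oint (P t) (xi + m * t) (1 + 0 * t).
  by apply/funext => s; rewrite mul0r addr0.
have cP : continuous (fun z : R * R => P z.1 z.2) by rewrite /P; cts.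
have cg : continuous (fun z : R * R => g z.1 z.2) by rewrite /g; cts.
have dP (s x : R) : is_derive s 1 (fun s => P s (x - c * s)) (g s (x - c * s)).
  by apply: (is_derive_fct _ _ _ _ (derM _ _ _ _ _ (dn' x s) (dp s x))); rewrite /g; ring.
apply: (is_derive_fct _ _ _ _ (der_transport P g c xi m 1 0 t cP cg dP)).
by rewrite (mul0r t) addr0 add0r.
Qed.

End volterra.

Section transform.
Context {R : realType}.
Variable K : coefficients R.
Hypothesis mu0 : 0 < mu K.
Variables (n1 n2 n3 f1 f2 f3 : R -> R -> R).
Hypothesis PK : plane_kernel K n1 n2 n3 f1 f2 f3.

Definition transform (v1 v2 v3 : R -> R) (xi : R) : R :=
  v3 xi + volterra n1 v1 xi + volterra n2 v2 xi + volterra n3 v3 xi.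

Variables (h1 h2 h3 eta beta : R -> R) (p1 p2 p3 p1s p2s p3s p1x p2x p3x : R -> R -> R).
Hypothesis DS : dual_solution K h1 h2 h3 eta beta p1 p2 p3 p1s p2s p3s p1x p2x p3x.
Hypotheses (ch1 : continuous h1) (ch2 : continuous h2) (ch3 : continuous h3) (ceta : continuous eta).

Let Q s xi := transform (p1 s) (p2 s) (p3 s) xi.

Lemma transform_cts : continuous (fun z : R * R => Q z.1 z.2).
Proof.
case: PK => cn1 cn2 cn3 _ _ _ _ _ _ _ _ _ _ _ _.
case: DS => c1 c2 c3 _ _ _ _ _ _ _ _ _ _ _ _ _ _ _ _ _ _ _.
have v1 := volterra_cts n1 p1 cn1 c1; have v2 := volterra_cts n2 p2 cn2 c2.
have v3 := volterra_cts n3 p3 cn3 c3.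
rewrite /Q /transform.
cts.
Qed.

Lemma der_along (p ps px : R -> R -> R) (c : R) :
  continuous (fun z : R * R => ps z.1 z.2) ->
  (forall s x : R, is_derive s 1 (fun s => p s x) (ps s x)) ->
  (forall s x : R, is_derive x 1 (p s) (px s x)) ->
  forall t x : R, is_derive t 1 (fun t => p t (x - c * t)) (ps t (x - c * t) - c * px t (x - c * t)).
Proof.
move=> cps ds dx t x; have := der_line p ps px 0 1 x (- c) t ds dx cps.
rewrite add0r !mul1r !mulNr.
by under eq_fun do rewrite add0r mul1r mulNr.
Qed.

Let q1 t x := p1s t x - gamma1 K * p1x t x.
Let q2 t x := p2s t x - gamma2 K * p2x t x.
Let q3 t x := p3s t x - - mu K * p3x t x.

(** The derivative of the transform along its characteristics, as it comes out
    of [der_volterra] and before the kernel equations are used. It makes sense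
    for all [xi], whereas the simplification of [transform_sourceE] is confined
    to the unit interval. *)
Definition transform_source t xi :=
  q3 t xi
  + (gamma1 K * (n1 1 xi * p1 t 1) - (mu K + gamma1 K) * (n1 xi xi * p1 t xi)
     + oint (fun x => n1 x xi * q1 t x - f1 x xi * p1 t x) xi 1)
  + (gamma2 K * (n2 1 xi * p2 t 1) - (mu K + gamma2 K) * (n2 xi xi * p2 t xi)
     + oint (fun x => n2 x xi * q2 t x - f2 x xi * p2 t x) xi 1)
  + (- mu K * (n3 1 xi * p3 t 1) - (mu K + - mu K) * (n3 xi xi * p3 t xi)
     + oint (fun x => n3 x xi * q3 t x - (- f3 x xi) * p3 t x) xi 1).

Let cq1 : continuous (fun z : R * R => q1 z.1 z.2).
Proof. by case: DS => c1 c2 c3 c1s c2s c3s c1x c2x c3x _ _ _ _ _ _ _ _ _ _ _ _ _; rewrite /q1; cts. Qed.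
Let cq2 : continuous (fun z : R * R => q2 z.1 z.2).
Proof. by case: DS => c1 c2 c3 c1s c2s c3s c1x c2x c3x _ _ _ _ _ _ _ _ _ _ _ _ _; rewrite /q2; cts. Qed.
Let cq3 : continuous (fun z : R * R => q3 z.1 z.2).
Proof. by case: DS => c1 c2 c3 c1s c2s c3s c1x c2x c3x _ _ _ _ _ _ _ _ _ _ _ _ _; rewrite /q3; cts. Qed.

Lemma transform_source_cts : continuous (fun z : R * R => transform_source z.1 z.2).
Proof.
case: PK => cn1 cn2 cn3 cf1 cf2 cf3 _ _ _ _ _ _ _ _ _.
case: DS => c1 c2 c3 _ _ _ _ _ _ _ _ _ _ _ _ _ _ _ _ _ _ _.
have o1 : continuous (fun z : R * R => oint (fun x => n1 x z.2 * q1 z.1 x - f1 x z.2 * p1 z.1 x) z.2 1).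
  refine (cts_oint (fun (z : R * R) x => n1 x z.2 * q1 z.1 x - f1 x z.2 * p1 z.1 x) (fun z => z.2) (fun=> 1) _ _ _); cts.
have o2 : continuous (fun z : R * R => oint (fun x => n2 x z.2 * q2 z.1 x - f2 x z.2 * p2 z.1 x) z.2 1).
  refine (cts_oint (fun (z : R * R) x => n2 x z.2 * q2 z.1 x - f2 x z.2 * p2 z.1 x) (fun z => z.2) (fun=> 1) _ _ _); cts.
have o3 : continuous (fun z : R * R => oint (fun x => n3 x z.2 * q3 z.1 x - (- f3 x z.2) * p3 z.1 x) z.2 1).
  refine (cts_oint (fun (z : R * R) x => n3 x z.2 * q3 z.1 x - (- f3 x z.2) * p3 z.1 x) (fun z => z.2) (fun=> 1) _ _ _); cts.
rewrite /transform_source; cts.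
Qed.

Lemma der_transform (t xi : R) :
  is_derive t 1 (fun t => Q t (xi - - mu K * t)) (transform_source t (xi - - mu K * t)).
Proof.
have E s : xi - - mu K * s = xi + mu K * s by ring.
have -> : (fun t => Q t (xi - - mu K * t)) = fun t => Q t (xi + mu K * t) by apply/funext => s; rewrite E.
rewrite E.
case: PK => cn1 cn2 cn3 cf1 cf2 cf3 dn1 dn2 dn3 _ _ _ _ _ _.
case: DS => c1 c2 c3 c1s c2s c3s c1x c2x c3x d1s d2s d3s d1x d2x d3x _ _ _ _ _ _ _.
have dn3' (x xi0 s : R) : is_derive s 1 (fun t => n3 (x + - mu K * t) (xi0 + - mu K * t)) (- f3 (x + - mu K * s) (xi0 + - mu K * s)).
  have := der_comp _ _ _ _ _ (is_deriveNid s 1) (dn3 x xi0 (- s)).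
  rewrite mulrN1 !mulrN !mulNr.
  by under eq_fun do rewrite !mulrN -!mulNr.
have cf3' : continuous (fun z : R * R => - f3 z.1 z.2) by cts.
have D1 := der_volterra n1 f1 p1 q1 _ _ cn1 cf1 c1 cq1 dn1 (der_along _ _ _ _ c1s d1s d1x) xi t.
have D2 := der_volterra n2 f2 p2 q2 _ _ cn2 cf2 c2 cq2 dn2 (der_along _ _ _ _ c2s d2s d2x) xi t.
have D3 := der_volterra n3 (fun x y => - f3 x y) p3 q3 _ _ cn3 cf3' c3 cq3 dn3' (der_along _ _ _ (- mu K) c3s d3s d3x) xi t.
have D0 := der_along _ _ _ (- mu K) c3s d3s d3x t xi.
rewrite E in D0.
have {}D0 : is_derive t 1 (fun t => p3 t (xi + mu K * t)) (q3 t (xi + mu K * t)).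
  by move: D0; under eq_fun do rewrite E.
exact: (derD _ _ _ _ _ (derD _ _ _ _ _ (derD _ _ _ _ _ D0 D1) D2) D3).
Qed.

(** Each family of kernel equations removes one family of terms: the equations
    inside the triangle the integral terms, the values on the diagonal the
    coupling of the third component to the first two, and the relation at
    [x = 1] the boundary terms. *)
Lemma transform_sourceE t xi : 0 <= xi <= 1 ->
  transform_source t xi = eta t * transform h1 h2 h3 xi.
Proof.
move=> /[dup] xi01 /andP[xi0 xi1].
case: PK => cn1 cn2 cn3 cf1 cf2 cf3 _ _ _ e1 e2 e3 b1 b2 b3.
case: DS => c1 c2 c3 c1s c2s c3s c1x c2x c3x _ _ _ _ _ _ pe1 pe2 pe3 pb1 pb2 pb3 _.
have I : oint (fun x => n1 x xi * q1 t x - f1 x xi * p1 t x) xi 1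
   + oint (fun x => n2 x xi * q2 t x - f2 x xi * p2 t x) xi 1
   + oint (fun x => n3 x xi * q3 t x - (- f3 x xi) * p3 t x) xi 1
   = eta t * (volterra n1 h1 xi + volterra n2 h2 xi + volterra n3 h3 xi).
  have k1 : continuous (fun x => n1 x xi * q1 t x - f1 x xi * p1 t x) by cts.
  have k2 : continuous (fun x => n2 x xi * q2 t x - f2 x xi * p2 t x) by cts.
  have k3 : continuous (fun x => n3 x xi * q3 t x - (- f3 x xi) * p3 t x) by cts.
  have l1 : continuous (fun x => n1 x xi * h1 x) by cts.
  have l2 : continuous (fun x => n2 x xi * h2 x) by cts.
  have l3 : continuous (fun x => n3 x xi * h3 x) by cts.
  have k12 := ctsD _ _ k1 k2; have l12 := ctsD _ _ l1 l2.
  rewrite /volterra -(ointD _ _ _ _ k1 k2) -(ointD _ _ _ _ k12 k3).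
  rewrite -(ointD _ _ _ _ l1 l2) -(ointD _ _ _ _ l12 l3) -ointZ; last exact: (ctsD _ _ l12 l3).
  apply: eq_oint => //; [exact: (ctsD _ _ k12 k3)|exact: (ctsM _ _ (ctsC _ _) (ctsD _ _ l12 l3))|].
  move=> x /andP[x0 x1]; have x01 : 0 <= x <= 1 by rewrite x1 (le_trans xi0 x0).
  rewrite e1 // e2 // e3 // /q1 /q2 /q3 pe1 // pe2 // pe3 //; ring.
have q3E : q3 t xi = alpha K xi * p1 t xi + alpha K xi * p2 t xi + eta t * h3 xi.
  by rewrite /q3 pe3 //; ring.
have b1' : (mu K + gamma1 K) * (n1 xi xi * p1 t xi) = alpha K xi * p1 t xi.
  by rewrite -b1 //; ring.
have b2' : (mu K + gamma2 K) * (n2 xi xi * p2 t xi) = alpha K xi * p2 t xi.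
  by rewrite -b2 //; ring.
have B : gamma1 K * (n1 1 xi * p1 t 1) + gamma2 K * (n2 1 xi * p2 t 1) + - mu K * (n3 1 xi * p3 t 1) = 0.
  have -> : gamma1 K * (n1 1 xi * p1 t 1) = n1 1 xi * (gamma1 K * p1 t 1) by ring.
  have -> : gamma2 K * (n2 1 xi * p2 t 1) = n2 1 xi * (gamma2 K * p2 t 1) by ring.
  by rewrite pb1 pb2 pb3 b3 //; ring.
rewrite /transform_source b1' b2' q3E /transform subrr mul0r subr0.
set o1 := oint _ _ _ in I *; set o2 := oint _ _ _ in I *; set o3 := oint _ _ _ in I *.
move: I B; lra.
Qed.

Lemma transform_at1 s : Q s 1 = beta s.
Proof.
rewrite /Q /transform /volterra !oint_id !addr0; exact: du_b3 DS s.
Qed.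

(** The integral of the source over the characteristic that runs from
    [xi = 0] to [xi = 1] in time [(mu K)^-1]. *)
Hypothesis betaE : forall s, beta s =
  oint (fun r => eta (s - (mu K)^-1 + r) * transform h1 h2 h3 (clamp01 (mu K * r))) 0 (mu K)^-1.

Lemma transform_h_cts : continuous (transform h1 h2 h3).
Proof.
case: PK => cn1 cn2 cn3 _ _ _ _ _ _ _ _ _ _ _ _.
have v1 := volterra_fun_cts _ _ cn1 ch1; have v2 := volterra_fun_cts _ _ cn2 ch2.
have v3 := volterra_fun_cts _ _ cn3 ch3.
by rewrite /transform; cts.
Qed.

(** Along a characteristic the transform grows by the integral of its source;
    [beta] is that integral, so nothing is left at the foot [xi = 0]. *)
Lemma transform_at0 s : Q s 0 = 0.
Proof.
have mi : 0 <= (mu K)^-1 by rewrite invr_ge0 ltW.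
have ck := transform_h_cts; have cc := @clamp01_cts R.
have cts1 := transform_source_cts.
set k := transform h1 h2 h3 in ck *.
have D (r : R) : is_derive r 1 (fun r => Q (s + r) (0 - - mu K * r)) (transform_source (s + r) (0 - - mu K * r)).
  have h : is_derive r 1 (fun r => s + r) 1.
    by have := derD _ _ _ _ _ (derC s r) (is_derive_id r 1); rewrite add0r.
  have := der_comp _ _ _ _ _ h (der_transform (s + r) (- mu K * s)).
  have E y : - mu K * s - - mu K * (s + y) = 0 - - mu K * y by ring.
  rewrite mulr1 E.
  by under eq_fun do rewrite E.
have F := oint_ftc _ _ 0 (mu K)^-1 _ D.
have e1 : 0 - - mu K * (mu K)^-1 = 1 by rewrite mulNr opprK add0r divff // gt_eqF.
rewrite e1 mulr0 subr0 addr0 transform_at1 betaE in F.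
have {}F : oint (fun r => transform_source (s + r) (0 - - mu K * r)) 0 (mu K)^-1 =
   oint (fun r => eta (s + (mu K)^-1 - (mu K)^-1 + r) * k (clamp01 (mu K * r))) 0 (mu K)^-1 - Q s 0.
  by apply: F; cts.
suff E : oint (fun r => transform_source (s + r) (0 - - mu K * r)) 0 (mu K)^-1 =
   oint (fun r => eta (s + (mu K)^-1 - (mu K)^-1 + r) * k (clamp01 (mu K * r))) 0 (mu K)^-1.
  by move: F; rewrite E -[LHS]subr0 => /addrI/oppr_inj/esym.
apply: eq_oint => //; [by cts|by cts|].
move=> r /andP[r0 r1].
have m01 : 0 <= mu K * r <= 1.
  by rewrite mulr_ge0 ?(ltW mu0) //= mulrC -ler_pdivlMr // div1r.
by rewrite mulNr opprK add0r transform_sourceE // clamp01_id // addrK.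
Qed.

End transform.

(** * Energy estimates *)

Section estimates.
Context {R : realType}.

Lemma oint_ge0 (f : R -> R) a b : continuous f -> a <= b ->
  (forall x, a <= x <= b -> 0 <= f x) -> 0 <= oint f a b.
Proof.
move=> cf ab f0; have -> : 0 = oint (fun=> 0 * (1 : R)) a b by rewrite ointZ ?mul0r //; exact: ctsC.
by apply: le_oint => //; [exact: ctsC|move=> x /f0; rewrite mul0r].
Qed.

Lemma oint_cst (c a b : R) : oint (fun=> c) a b = c * (b - a).
Proof.
have D (x : R) : is_derive x 1 (fun x => 0 + c * x) c by exact: der_affine.
by rewrite (oint_ftc _ _ a b (ctsC _ c) D) !add0r mulrBr.
Qed.

(** Jensen's inequality on an interval of length at most one. *)
Lemma sqr_oint_le (f : R -> R) a b : continuous f -> a <= b -> b <= a + 1 ->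
  oint f a b ^+ 2 <= oint (fun x => f x ^+ 2) a b.
Proof.
move=> cf ab ab1; set c := oint f a b.
have cf2 : continuous (fun x => f x ^+ 2) by cts.
have cg : continuous (fun x => (f x - c) ^+ 2) by cts.
have := oint_ge0 _ a b cg ab (fun x _ => sqr_ge0 _).
have -> : (fun x => (f x - c) ^+ 2) = (fun x => (f x ^+ 2 + c ^+ 2) - 2 * c * f x).
  by apply/funext => x; ring.
rewrite ointB; [|by cts|by cts]; rewrite ointD //; last exact: ctsC.
rewrite ointZ // oint_cst -/c => h.
have h2 : c ^+ 2 * (b - a) <= c ^+ 2 by rewrite ler_piMr ?sqr_ge0 // lerBlDl.
have h3 : 2 * c * c = 2 * c ^+ 2 by ring.
lra.
Qed.

Lemma volterra_le (n : R -> R -> R) (f : R -> R) M xi :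
  continuous (fun z : R * R => n z.1 z.2) -> continuous f -> 0 <= xi <= 1 ->
  (forall x, xi <= x <= 1 -> `|n x xi| <= M) ->
  volterra n f xi ^+ 2 <= M ^+ 2 * oint (fun x => f x ^+ 2) xi 1.
Proof.
move=> cn cf /andP[x0 x1] nM.
have c1 : continuous (fun x => n x xi * f x) by cts.
have c2 : continuous (fun x => f x ^+ 2) by cts.
apply: le_trans (sqr_oint_le _ _ _ c1 x1 _) _; first by rewrite lerDr.
rewrite -ointZ //; apply: le_oint => //; [by cts|by cts|].
move=> x /nM h; rewrite exprMn ler_wpM2r ?sqr_ge0 //.
by rewrite -[n x xi ^+ 2]real_normK ?num_real // lerXn2r // nnegrE (le_trans _ h).
Qed.

Lemma cts_tail (f : R -> R) : continuous f -> continuous (fun x => oint f x 1).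
Proof.
move=> cf; refine (cts_oint (fun _ x => f x) (fun x => x) (fun=> 1) _ _ _); cts.
Qed.

Lemma der_expM (l x : R) : is_derive x 1 (fun x => expR (l * x)) (l * expR (l * x)).
Proof.
have h : is_derive x 1 (fun y => l * y) (l * 1) by apply: derZ; exact: is_derive_id.
by have := der_comp _ _ _ _ _ h (is_derive_expR _); rewrite mulr1 mulrC.
Qed.

Lemma cts_expM (l : R) : continuous (fun x => expR (l * x)).
Proof. have := @continuous_expR R => c; cts. Qed.

(** Integration by parts against the exponential weight: the tail integrals
    gain a factor [l^-1], which lets a large [l] absorb the Volterra terms. *)
Lemma weighted_tail_le (f : R -> R) l : 0 < l -> continuous f -> (forall x, 0 <= f x) ->
  l * oint (fun x => expR (l * x) * oint f x 1) 0 1 <= oint (fun x => expR (l * x) * f x) 0 1.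
Proof.
move=> l0 cf f0; have ct := cts_tail f cf; have ce := cts_expM l.
have dt (x : R) : is_derive x 1 (fun x => oint f x 1) (- f x).
  by have := derB _ _ _ _ _ (derC (prim f 1) x) (der_prim f x cf); rewrite sub0r.
have D (x : R) : is_derive x 1 (fun x => expR (l * x) * oint f x 1)
    (l * (expR (l * x) * oint f x 1) - expR (l * x) * f x).
  apply: (is_derive_fct _ _ _ _ (derM _ _ _ _ _ (der_expM l x) (dt x))); ring.
have c1 : continuous (fun x => expR (l * x) * oint f x 1) by cts.
have c2 : continuous (fun x => expR (l * x) * f x) by cts.
have c3 : continuous (fun x => l * (expR (l * x) * oint f x 1)) by cts.
have := oint_ftc _ _ 0 1 (ctsD _ _ c3 (ctsN _ c2)) D.
rewrite (ointB _ _ _ _ c3 c2) ointZ // oint_id mulr0 mulr0 expR0 mul1r sub0r => E.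
have := oint_ge0 f 0 1 cf ler01 (fun x _ => f0 x).
move: E; set u := oint _ _ _; set v := oint _ _ _; set w := oint _ _ _; lra.
Qed.

End estimates.

(** The energy consists of two exponentially weighted square integrals, for the
    components that travel to the left, and of one with the weight [2 - x], for
    the transform, which travels to the right. *)
Section lyapunov.
Context {R : realType}.
Variable l : R.
Hypothesis l_gt0 : 0 < l.

Definition wsq (p : R -> R) : R := oint (fun x => expR (l * x) * p x ^+ 2) 0 1.
Definition sq (p : R -> R) : R := oint (fun x => p x ^+ 2) 0 1.

Lemma young2 (c S a b : R) : `|c| <= S -> 2 * (c * (a * b)) <= S * (a ^+ 2 + b ^+ 2).
Proof.
move=> cS.
have h1 : 0 <= (a - b) ^+ 2 := sqr_ge0 _.
have h2 : 0 <= (a + b) ^+ 2 := sqr_ge0 _.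
have hs : 0 <= a ^+ 2 + b ^+ 2 by rewrite addr_ge0 ?sqr_ge0.
apply: le_trans (ler_wpM2r hs cS).
have [c0|c0] := leP 0 c; first by rewrite ger0_norm //; nra.
by rewrite ltr0_norm //; nra.
Qed.

Lemma weight_itv x : 0 <= x <= 1 -> 1 <= expR (l * x) <= expR l.
Proof.
move=> /andP[x0 x1]; rewrite ler_expR -(@expR0 R) ler_expR mulr_ge0 ?(ltW l_gt0) //=.
by rewrite ler_piMr // ltW.
Qed.

Lemma wsq_ge0 p : continuous p -> 0 <= wsq p.
Proof.
move=> cp; have ce := cts_expM l; apply: oint_ge0 => //; first by cts.
by move=> x _; rewrite mulr_ge0 ?expR_ge0 ?sqr_ge0.
Qed.

Lemma sq_ge0 p : continuous p -> 0 <= sq p.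
Proof.
by move=> cp; apply: oint_ge0 => //; [cts|move=> x _; rewrite sqr_ge0].
Qed.

Lemma sq_le_wsq p : continuous p -> sq p <= wsq p.
Proof.
move=> cp; have ce := cts_expM l; apply: le_oint => //; [by cts|by cts|].
move=> x /weight_itv/andP[w1 _]; by rewrite ler_peMl ?sqr_ge0.
Qed.

Lemma wsq_le_sq p : continuous p -> wsq p <= expR l * sq p.
Proof.
move=> cp; have ce := cts_expM l; rewrite -ointZ; last by cts.
apply: le_oint => //; [by cts|by cts|].
by move=> x /weight_itv/andP[_ w1]; rewrite ler_wpM2r ?sqr_ge0.
Qed.

(** Differentiating the exponential weight yields the term [- c * l * p^2],
    which for large [l] dominates all products of components. *)
Lemma component_rate (sa sb c S g e : R) (t p q r h : R -> R) :
  `|sa| <= S -> `|sb| <= S -> (forall x, 0 <= x <= 1 -> `|t x| <= S) -> g <= c -> 0 <= e ->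
  continuous t -> continuous p -> continuous q -> continuous r -> continuous h ->
  oint (fun x => expR (l * x) * (2 * p x * (sa * p x + sb * q x + t x * r x + e * h x) - c * l * p x ^+ 2)) 0 1
  <= (4 * S + e - g * l) * wsq p + S * wsq q + S * wsq r + e * expR l * sq h.
Proof.
move=> Sa Sb St gc e0 ct cp cq cr ch; have ce := cts_expM l.
have kp : continuous (fun x => expR (l * x) * p x ^+ 2) by cts.
have kq : continuous (fun x => expR (l * x) * q x ^+ 2) by cts.
have kr : continuous (fun x => expR (l * x) * r x ^+ 2) by cts.
have kh : continuous (fun x => h x ^+ 2) by cts.
rewrite /wsq /sq -!ointZ // -!ointD; [|by cts..].
apply: le_oint => //; [by cts|by cts|].
move=> x x01; have /andP[w1 w2] := weight_itv x x01.
have w0 : 0 <= expR (l * x) by exact: expR_ge0.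
set w := expR (l * x) in w0 w1 w2 *.
have hh : e * (w * h x ^+ 2) <= e * expR l * h x ^+ 2.
  by rewrite mulrA ler_wpM2r ?sqr_ge0 // ler_wpM2l.
apply: (@le_trans _ _ (w * ((4 * S + e - g * l) * p x ^+ 2 + S * q x ^+ 2 + S * r x ^+ 2 + e * h x ^+ 2))); last by lra.
apply: ler_wpM2l => //.
have a1 := young2 _ _ (p x) (p x) Sa.
have a2 := young2 _ _ (p x) (q x) Sb.
have a3 := young2 _ _ (p x) (r x) (St x x01).
have a4 : 2 * (e * (p x * h x)) <= e * (p x ^+ 2 + h x ^+ 2) by apply: young2; rewrite ger0_norm.
have a5 : g * l * p x ^+ 2 <= c * l * p x ^+ 2.
  by rewrite ler_wpM2r ?sqr_ge0 // ler_wpM2r // ltW.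
have -> : 2 * p x * (sa * p x + sb * q x + t x * r x + e * h x) - c * l * p x ^+ 2 =
  2 * (sa * (p x * p x)) + 2 * (sb * (p x * q x)) + 2 * (t x * (p x * r x)) + 2 * (e * (p x * h x)) - c * l * p x ^+ 2 by ring.
lra.
Qed.

Definition tsq (p : R -> R) : R := oint (fun x : R => (2 - x) * p x ^+ 2) 0 1.

(** The decreasing weight [2 - x] yields the term [- m * Q^2]; [e] is the
    value of the pulse, which Gronwall's inequality integrates to one. *)
Lemma transported_rate (B m e : R) (Q k : R -> R) : 0 <= B -> 0 <= e -> continuous Q -> continuous k ->
  oint (fun x : R => B * (- m * Q x ^+ 2 + 2 * (2 - x) * Q x * (e * k x))) 0 1
  <= - m * B * sq Q + e * (B * tsq Q + 2 * B * sq k).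
Proof.
move=> B0 e0 cQ ck.
have k1 : continuous (fun x => Q x ^+ 2) by cts.
have k2 : continuous (fun x => k x ^+ 2) by cts.
have k3 : continuous (fun x : R => (2 - x) * Q x ^+ 2) by cts.
have -> : - m * B * sq Q + e * (B * tsq Q + 2 * B * sq k) =
  - m * B * sq Q + e * B * tsq Q + e * (2 * B) * sq k by ring.
rewrite /sq /tsq -!ointZ // -!ointD; [|by cts..].
apply: le_oint => //; [by cts|by cts|].
move=> x /andP[x0 x1].
have a : 2 * (e * (Q x * k x)) <= e * (Q x ^+ 2 + k x ^+ 2) by apply: young2; rewrite ger0_norm.
have b : (2 - x) * (2 * (e * (Q x * k x))) <= (2 - x) * (e * (Q x ^+ 2 + k x ^+ 2)).
  by rewrite ler_wpM2l // subr_ge0 (le_trans x1) // ler1n.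
have c : (2 - x) * (e * k x ^+ 2) <= 2 * (e * k x ^+ 2).
  by apply: ler_wpM2r; [apply: mulr_ge0 => //; exact: sqr_ge0|lra].
have d : B * ((2 - x) * (2 * (e * (Q x * k x)))) <= B * ((2 - x) * (e * Q x ^+ 2) + 2 * (e * k x ^+ 2)).
  by apply: ler_wpM2l => //; lra.
lra.
Qed.

Lemma sq_le_tsq Q : continuous Q -> sq Q <= tsq Q <= 2 * sq Q.
Proof.
move=> cQ; rewrite /sq /tsq -ointZ; last by cts.
by apply/andP; split; apply: le_oint => //; try cts; move=> x /andP[x0 x1]; rewrite -subr_ge0; have := sqr_ge0 (Q x); nra.
Qed.

Lemma sqr_sum4 (a b c d : R) : (a + b + c + d) ^+ 2 <= 4 * (a ^+ 2 + b ^+ 2 + c ^+ 2 + d ^+ 2).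
Proof.
have h1 : 0 <= (a - b) ^+ 2 := sqr_ge0 _. have h2 : 0 <= (a - c) ^+ 2 := sqr_ge0 _.
have h3 : 0 <= (a - d) ^+ 2 := sqr_ge0 _. have h4 : 0 <= (b - c) ^+ 2 := sqr_ge0 _.
have h5 : 0 <= (b - d) ^+ 2 := sqr_ge0 _. have h6 : 0 <= (c - d) ^+ 2 := sqr_ge0 _.
nra.
Qed.

Lemma absorb_volterra_terms (N1 N2 N3 NQ V1 V2 V3 eQ : R) : N3 <= 4 * (NQ + V1 + V2 + V3) -> NQ <= eQ ->
  8 * V1 <= N1 -> 8 * V2 <= N2 -> 8 * V3 <= N3 -> N3 <= 8 * eQ + N1 + N2.
Proof. by lra. Qed.

Section kernels.
Variables (n1 n2 n3 : R -> R -> R) (M : R).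
Hypotheses (cn1 : continuous (fun z : R * R => n1 z.1 z.2))
  (cn2 : continuous (fun z : R * R => n2 z.1 z.2))
  (cn3 : continuous (fun z : R * R => n3 z.1 z.2)).
Hypotheses (M1 : forall x xi, 0 <= xi -> xi <= x -> x <= 1 -> `|n1 x xi| <= M)
  (M2 : forall x xi, 0 <= xi -> xi <= x -> x <= 1 -> `|n2 x xi| <= M)
  (M3 : forall x xi, 0 <= xi -> xi <= x -> x <= 1 -> `|n3 x xi| <= M).

(** The gain of [weighted_tail_le] makes the Volterra operators as small as
    desired in the weighted norm. *)
Lemma volterra_wsq_le (n : R -> R -> R) (p : R -> R) :
  continuous (fun z : R * R => n z.1 z.2) -> continuous p ->
  (forall x xi, 0 <= xi -> xi <= x -> x <= 1 -> `|n x xi| <= M) ->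
  l * wsq (volterra n p) <= M ^+ 2 * wsq p.
Proof.
move=> cn cp Mn; have ce := cts_expM l.
have cp2 : continuous (fun x => p x ^+ 2) by cts.
have ct := cts_tail _ cp2.
have cv := volterra_fun_cts n p cn cp.
have h := weighted_tail_le _ _ l_gt0 cp2 (fun x => sqr_ge0 (p x)).
apply: le_trans (ler_wpM2l (sqr_ge0 M) h).
rewrite mulrCA ler_wpM2l ?(ltW l_gt0) // -ointZ; last by cts.
apply: le_oint => //; [by cts|by cts|].
move=> x /[dup] x01 /andP[x0 x1]; rewrite [leRHS]mulrCA; apply: ler_wpM2l; first exact: expR_ge0.
by apply: volterra_le => // y /andP[y0 y1]; apply: Mn.
Qed.

(** For a large weight the third component is controlled by the first two and
    by its transform, without inverting the Volterra operator. *)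
Lemma third_component_le (p1 p2 p3 Q : R -> R) : 8 * M ^+ 2 <= l ->
  continuous p1 -> continuous p2 -> continuous p3 -> continuous Q ->
  (forall x, Q x = transform n1 n2 n3 p1 p2 p3 x) ->
  wsq p3 <= 8 * (expR l * sq Q) + wsq p1 + wsq p2.
Proof.
move=> lM cp1 cp2 cp3 cQ QE; have ce := cts_expM l.
have v1 := volterra_wsq_le n1 p1 cn1 cp1 M1.
have v2 := volterra_wsq_le n2 p2 cn2 cp2 M2.
have v3 := volterra_wsq_le n3 p3 cn3 cp3 M3.
have cv1 := volterra_fun_cts _ _ cn1 cp1; have cv2 := volterra_fun_cts _ _ cn2 cp2.
have cv3 := volterra_fun_cts _ _ cn3 cp3.
have h : wsq p3 <= 4 * (wsq Q + wsq (volterra n1 p1) + wsq (volterra n2 p2) + wsq (volterra n3 p3)).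
  rewrite /wsq -!ointD; [|by cts..]; rewrite -ointZ; last by cts.
  apply: le_oint => //; [by cts|by cts|].
  move=> x x01.
  have h := sqr_sum4 (Q x) (- volterra n1 p1 x) (- volterra n2 p2 x) (- volterra n3 p3 x).
  have e : Q x - volterra n1 p1 x - volterra n2 p2 x - volterra n3 p3 x = p3 x by rewrite QE /transform; ring.
  rewrite e !sqrrN in h.
  apply: le_trans (ler_wpM2l (expR_ge0 (l * x)) h) _.
  by rewrite le_eqVlt; apply/orP; left; apply/eqP; ring.
have w3 := wsq_ge0 p3 cp3; have w1 := wsq_ge0 p1 cp1; have w2 := wsq_ge0 p2 cp2.
have wQ := wsq_le_sq Q cQ.
have b (u v : R) : 0 <= v -> l * u <= M ^+ 2 * v -> 8 * u <= v.
  move=> v0 uv; rewrite -(ler_pM2l l_gt0) mulrCA.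
  apply: (le_trans (ler_wpM2l (ler0n R 8) uv)).
  by rewrite mulrA; apply: ler_wpM2r.
exact: (absorb_volterra_terms _ _ _ _ _ _ _ _ h wQ (b _ _ w1 v1) (b _ _ w2 v2) (b _ _ w3 v3)).
Qed.

Lemma transform_sq_le (h1 h2 h3 : R -> R) :
  continuous h1 -> continuous h2 -> continuous h3 ->
  sq (transform n1 n2 n3 h1 h2 h3) <= 4 * (1 + M ^+ 2) * (sq h1 + sq h2 + sq h3).
Proof.
move=> ch1 ch2 ch3.
have cv1 := volterra_fun_cts _ _ cn1 ch1; have cv2 := volterra_fun_cts _ _ cn2 ch2.
have cv3 := volterra_fun_cts _ _ cn3 ch3.
have vle n h : continuous (fun z : R * R => n z.1 z.2) -> continuous h ->
   (forall x xi, 0 <= xi -> xi <= x -> x <= 1 -> `|n x xi| <= M) ->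
   forall x, 0 <= x <= 1 -> volterra n h x ^+ 2 <= M ^+ 2 * sq h.
  move=> cn ch Mn x /[dup] x01 /andP[x0 x1].
  have ch2' : continuous (fun x => h x ^+ 2) by cts.
  apply: (le_trans (volterra_le n h M x cn ch x01 _)).
    by move=> y /andP[y0 y1]; apply: Mn.
  rewrite ler_wpM2l ?sqr_ge0 // /sq -(oint_chasles _ 0 x 1) lerDr.
  by apply: oint_ge0 => // y _; rewrite sqr_ge0.
set H := sq h1 + sq h2 + sq h3.
have k3 : continuous (fun x => h3 x ^+ 2) by cts.
have ctr : continuous (transform n1 n2 n3 h1 h2 h3) by rewrite /transform; cts.
have : sq (transform n1 n2 n3 h1 h2 h3) <= oint (fun x => 4 * h3 x ^+ 2 + 4 * (M ^+ 2 * H)) 0 1.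
  apply: le_oint => //; [by cts|by cts|].
  move=> x x01; apply: le_trans (sqr_sum4 _ _ _ _) _.
  have := vle _ _ cn1 ch1 M1 x x01; have := vle _ _ cn2 ch2 M2 x x01; have := vle _ _ cn3 ch3 M3 x x01.
  rewrite /H; lra.
rewrite ointD; [|by cts|exact: ctsC]; rewrite ointZ // oint_cst subr0 mulr1.
have := sq_ge0 h1 ch1; have := sq_ge0 h2 ch2; rewrite -/(sq h3) /H; lra.
Qed.

End kernels.

End lyapunov.

Section gronwall.
Context {R : realType}.

(** The energy is bounded on the whole time axis, so the differential
    inequality integrated from minus infinity also yields that the solution
    vanishes before the source is switched on. *)
Lemma gronwall_from_Ny (E E' H eta : R -> R) (nu h Eb : R) :
  (forall s : R, is_derive s 1 E (E' s)) -> (forall s : R, is_derive s 1 H (eta s)) ->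
  (forall s, 0 <= eta s) -> (forall s, 1 <= s -> eta s = 0) ->
  (forall s, s <= 0 -> H s = 0) -> (forall s, 0 <= H s) ->
  (forall s, E' s <= - nu * E s + eta s * (E s + h)) ->
  (forall s, E s <= Eb) -> 0 < nu -> 0 <= h ->
  forall s, E s <= expR (H s) * (expR nu * h * H s) * expR (- nu * s).
Proof.
move=> dE dH e0 e1 H0 Hge EE Ebd nu0 h0 s.
pose G s := E s * expR (nu * s - H s) - expR nu * h * H s.
pose G' s := E s * ((nu - eta s) * expR (nu * s - H s)) + expR (nu * s - H s) * E' s - expR nu * h * eta s.
have dG (x : R) : is_derive x 1 G (G' x).
  have d1 : is_derive x 1 (fun s => nu * s - H s) (nu - eta x).
    have := derB _ _ _ _ _ (derZ _ _ _ nu (is_derive_id x 1)) (dH x).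
    by rewrite mulr1.
  have d2 := der_comp _ _ _ _ _ d1 (is_derive_expR _).
  apply: (is_derive_fct _ _ _ _ (derB _ _ _ _ _ (derM _ _ _ _ _ (dE x) d2) (derZ _ _ _ (expR nu * h) (dH x)))).
  by rewrite /G' [expR _ * (nu - _)]mulrC.
have G'le x : G' x <= 0.
  rewrite /G'; set w := expR _.
  have w0 : 0 <= w by exact: expR_ge0.
  have a1 : w * E' x <= w * (- nu * E x + eta x * (E x + h)) by rewrite ler_wpM2l.
  have a2 : eta x * (w * h) <= eta x * (expR nu * h).
    have [x1|x1] := leP 1 x; first by rewrite e1 // !mul0r.
    rewrite ler_wpM2l // ler_wpM2r // ler_expR lerBlDr; apply: (@le_trans _ _ nu); last by rewrite lerDl.
    by apply: ler_piMr; exact: ltW.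
  have -> : E x * ((nu - eta x) * w) + w * E' x - expR nu * h * eta x =
     (w * E' x - w * (- nu * E x + eta x * (E x + h))) + (eta x * (w * h) - eta x * (expR nu * h)) by ring.
  by rewrite -oppr_ge0 opprD addr_ge0 // oppr_ge0 subr_le0.
have Gmono x y : x <= y -> G y <= G x.
  move=> xy; have [c _ e] := mvt_unordered G G' x y dG.
  by rewrite -subr_le0 e mulr_le0_ge0 ?subr_ge0.
have Gs0 : G s <= 0.
  apply/ler_addgt0Pl => d d0; rewrite addr0.
  pose y := (`|Eb| / d) / nu + `|s|.
  have y0 : 0 <= `|Eb| / d / nu by rewrite !divr_ge0 // ltW.
  have ys : - y <= s by rewrite /y opprD; have := ler_norm (- s); rewrite normrN; lra.
  have yn : - y <= 0 by rewrite oppr_le0 addr_ge0.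
  apply: (le_trans (Gmono _ _ ys)).
  rewrite /G H0 // mulr0 !subr0.
  apply: (le_trans (ler_wpM2r (expR_ge0 _) (le_trans (Ebd _) (ler_norm _)))).
  rewrite mulrN expRN ler_pdivrMr ?expR_gt0 // mulrC -ler_pdivrMr //.
  apply: le_trans (expR_ge1Dx _).
  have -> : nu * y = `|Eb| / d + nu * `|s| by rewrite /y; field; rewrite !gt_eqF.
  have : 0 <= nu * `|s| by rewrite mulr_ge0 // ltW.
  lra.
have {}Gs0 : E s * expR (nu * s - H s) <= expR nu * h * H s by rewrite -subr_le0.
have -> : E s = E s * expR (nu * s - H s) * (expR (H s) * expR (- nu * s)).
  rewrite -mulrA -!expRD (_ : nu * s - H s + _ = 0) ?expR0 ?mulr1 //; ring.
rewrite [X in _ <= X * _]mulrC -[leRHS]mulrA.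
by apply: ler_wpM2r => //; rewrite mulr_ge0 ?expR_ge0.
Qed.

(** The case of fixed end points: the motion relative to the characteristics
    leaves the boundary fluxes. *)
Lemma der_integral01 (P g : R -> R -> R) (c t : R) :
  continuous (fun z : R * R => P z.1 z.2) -> continuous (fun z : R * R => g z.1 z.2) ->
  (forall t x : R, is_derive t 1 (fun t => P t (x - c * t)) (g t (x - c * t))) ->
  is_derive t 1 (fun t => oint (P t) 0 1) (c * (P t 1 - P t 0) + oint (g t) 0 1).
Proof.
move=> cP cg dP.
have -> : (fun t => oint (P t) 0 1) = fun t => oint (P t) (0 + 0 * t) (1 + 0 * t).
  by apply/funext => s; rewrite !mul0r !addr0.
apply: (is_derive_fct _ _ _ _ (der_transport P g c 0 0 1 0 t cP cg dP)).
by rewrite !(mul0r t) !addr0 !add0r; ring.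
Qed.

Lemma der_wsq (l c t : R) (p q : R -> R -> R) :
  continuous (fun z : R * R => p z.1 z.2) -> continuous (fun z : R * R => q z.1 z.2) ->
  (forall t x : R, is_derive t 1 (fun t => p t (x - c * t)) (q t (x - c * t))) ->
  is_derive t 1 (fun t => wsq l (p t))
    (c * (expR l * p t 1 ^+ 2 - p t 0 ^+ 2)
     + oint (fun x => expR (l * x) * (2 * p t x * q t x - c * l * p t x ^+ 2)) 0 1).
Proof.
move=> cp cq dp; have ce := cts_expM l.
pose P t x := expR (l * x) * p t x ^+ 2.
pose g t x := expR (l * x) * (2 * p t x * q t x - c * l * p t x ^+ 2).
have cP : continuous (fun z : R * R => P z.1 z.2) by rewrite /P; have := @continuous_expR R => c2; cts.
have cg : continuous (fun z : R * R => g z.1 z.2) by rewrite /g; have := @continuous_expR R => c2; cts.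
have dP (s x : R) : is_derive s 1 (fun s => P s (x - c * s)) (g s (x - c * s)).
  have d0 : is_derive s 1 (fun s => x - c * s) (- c).
    by have := der_affine x (- c) s; under eq_fun do rewrite mulNr.
  have d1 := der_comp _ _ _ _ _ d0 (der_expM l (x - c * s)).
  have d2 := derM _ _ _ _ _ (dp s x) (dp s x).
  apply: (is_derive_fct _ _ _ _ (derM _ _ _ _ _ d1 d2)); rewrite /g; ring.
apply: (is_derive_fct _ _ _ _ (der_integral01 P g c t cP cg dP)).
by rewrite /P mulr1 mulr0 expR0 mul1r.
Qed.

Lemma der_tsq (c t : R) (Q q : R -> R -> R) :
  continuous (fun z : R * R => Q z.1 z.2) -> continuous (fun z : R * R => q z.1 z.2) ->
  (forall t x : R, is_derive t 1 (fun t => Q t (x - c * t)) (q t (x - c * t))) ->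
  is_derive t 1 (fun t => tsq (Q t))
    (c * (Q t 1 ^+ 2 - 2 * Q t 0 ^+ 2)
     + oint (fun x => c * Q t x ^+ 2 + 2 * (2 - x) * Q t x * q t x) 0 1).
Proof.
move=> cQ cq dQ.
pose P (t x : R) := (2 - x) * Q t x ^+ 2.
pose g t x := c * Q t x ^+ 2 + 2 * (2 - x) * Q t x * q t x.
have cP : continuous (fun z : R * R => P z.1 z.2) by rewrite /P; cts.
have cg : continuous (fun z : R * R => g z.1 z.2) by rewrite /g; cts.
have dP (s x : R) : is_derive s 1 (fun s => P s (x - c * s)) (g s (x - c * s)).
  have d0 : is_derive s 1 (fun s => 2 - (x - c * s)) c.
    have -> : (fun s : R => 2 - (x - c * s)) = fun s => (2 - x) + c * s by apply/funext => u; ring.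
    exact: der_affine.
  apply: (is_derive_fct _ _ _ _ (derM _ _ _ _ _ d0 (derM _ _ _ _ _ (dQ s x) (dQ s x)))); rewrite /g; ring.
apply: (is_derive_fct _ _ _ _ (der_integral01 P g c t cP cg dP)).
by rewrite /P subr0 (_ : 2 - 1 = 1) ?mul1r //; ring.
Qed.

(** The balance of all terms in the derivative of the energy, and the order in
    which the constants are fixed: [l] beats the coupling constant [S], then [B]
    beats the inflow at [x = 1] and what the third component costs in terms of
    its transform, and [nu] comes last. [N1], [N2], [N3] stand for the weighted
    squares of the components, [NQ] and [TQ] for those of the transform. *)
Lemma energy_rate_le (E' G1 G2 G3 N1 N2 N3 NQ TQ H1 H2 Hk c1 c2 m r1 r2 a1 a2 b1 b2 bt S g l eL B e nu : R) :
  0 <= N1 -> 0 <= N2 -> 0 <= NQ -> 0 <= TQ ->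
  0 < c1 -> 0 < c2 -> 0 < m -> 0 <= S -> 0 <= eL -> 0 <= B -> 0 <= e ->
  E' = c1 * (eL * b1 ^+ 2 - a1 ^+ 2) + G1 + (c2 * (eL * b2 ^+ 2 - a2 ^+ 2) + G2) + (- (m * B * bt ^+ 2) + G3) ->
  c1 * b1 = m * r1 * bt -> c2 * b2 = m * r2 * bt ->
  G1 <= (4 * S + e - g * l) * N1 + S * N2 + S * N3 + e * eL * H1 ->
  G2 <= (4 * S + e - g * l) * N2 + S * N1 + S * N3 + e * eL * H2 ->
  G3 <= - m * B * NQ + e * (B * TQ + 2 * B * Hk) ->
  N3 <= 8 * (eL * NQ) + N1 + N2 -> TQ <= 2 * NQ ->
  7 * S + 1 <= g * l ->
  eL * ((m * r1) ^+ 2 / c1 + (m * r2) ^+ 2 / c2) <= m * B ->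
  32 * S * eL <= m * B -> nu <= 1 -> nu <= m / 4 ->
  E' <= - nu * (N1 + N2 + B * TQ) + e * (N1 + N2 + B * TQ + (eL * (H1 + H2) + 2 * B * Hk)).
Proof.
move=> N10 N20 NQ0 TQ0 c10 c20 m0 S0 eL0 B0 e0 -> hb1 hb2 hG1 hG2 hG3 hN3 hTQ hgl hB1 hB2 nu1 num.
have x1 : c1 * b1 ^+ 2 = (m * r1) ^+ 2 / c1 * bt ^+ 2.
  have -> : c1 * b1 ^+ 2 = (c1 * b1) ^+ 2 / c1 by field; rewrite gt_eqF.
  by rewrite hb1 exprMn mulrAC.
have x2 : c2 * b2 ^+ 2 = (m * r2) ^+ 2 / c2 * bt ^+ 2.
  have -> : c2 * b2 ^+ 2 = (c2 * b2) ^+ 2 / c2 by field; rewrite gt_eqF.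
  by rewrite hb2 exprMn mulrAC.
have bdry : c1 * (eL * b1 ^+ 2 - a1 ^+ 2) + c2 * (eL * b2 ^+ 2 - a2 ^+ 2) - m * B * bt ^+ 2 <= 0.
  have -> : c1 * (eL * b1 ^+ 2 - a1 ^+ 2) + c2 * (eL * b2 ^+ 2 - a2 ^+ 2) - m * B * bt ^+ 2 =
     eL * (c1 * b1 ^+ 2 + c2 * b2 ^+ 2) - m * B * bt ^+ 2 - (c1 * a1 ^+ 2 + c2 * a2 ^+ 2) by ring.
  rewrite x1 x2 -mulrDl mulrA.
  have := ler_wpM2r (sqr_ge0 bt) hB1.
  have : 0 <= c1 * a1 ^+ 2 + c2 * a2 ^+ 2 by rewrite addr_ge0 // mulr_ge0 ?sqr_ge0 // ltW.
  by clear; lra.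
have s1 : S * N3 <= S * (8 * (eL * NQ) + N1 + N2) by rewrite ler_wpM2l.
have s2 : (7 * S + 1) * (N1 + N2) <= g * l * (N1 + N2) by rewrite ler_wpM2r // addr_ge0.
have s3 : 32 * S * eL * NQ <= m * B * NQ by rewrite ler_wpM2r.
have s4 : m * B * TQ <= m * B * (2 * NQ) by rewrite ler_wpM2l // mulr_ge0 // ltW.
have s5 : nu * (N1 + N2) <= 1 * (N1 + N2) by rewrite ler_wpM2r // addr_ge0.
have s6 : nu * (B * TQ) <= m / 4 * (B * TQ) by rewrite ler_wpM2r // mulr_ge0.
move: bdry hG1 hG2 hG3 s1 s2 s3 s4 s5 s6; clear; lra.
Qed.

End gronwall.

Lemma square_bound {R : realType} (n : R -> R -> R) : continuous (fun z : R * R => n z.1 z.2) ->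
  exists2 M, 0 <= M & forall x xi, 0 <= xi -> xi <= x -> x <= 1 -> `|n x xi| <= M.
Proof.
move=> cn; pose A := (`[0, 1]%classic : set R).
have c : compact ((fun z : R * R => n z.1 z.2) @` (A `*` A)).
  apply: continuous_compact; first exact: continuous_subspaceT.
  by apply: compact_setX; exact: segment_compact.
have [M [_ HM]] := compact_bounded c.
exists (`|M| + 1); first by rewrite addr_ge0.
move=> x xi xi0 xix x1; apply: (HM (`|M| + 1)); first by rewrite (le_lt_trans (ler_norm M)) // ltrDl.
exists (x, xi) => //; split; rewrite /A /= in_itv /=; first by rewrite x1 (le_trans xi0).
by rewrite xi0 (le_trans xix).
Qed.

Lemma components_le_energy {R : realType} (eL N1 N2 N3 NQ BT s1 s2 s3 : R) :
  N3 <= 8 * (eL * NQ) + N1 + N2 -> s1 <= N1 -> s2 <= N2 -> s3 <= N3 ->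
  eL * NQ <= eL * BT -> 0 <= eL * (N1 + N2) -> 0 <= BT ->
  s1 + s2 + s3 <= (2 + 8 * eL) * (N1 + N2 + BT).
Proof. by lra. Qed.

(** Exponential decay of the dual solutions, with constants that depend neither
    on the direction [h] nor on the pulse [eta]: the energy is compared with the
    primitive [H] of the pulse, which is at most one. *)
Lemma dual_decay {R : realType} (K : coefficients R) (n1 n2 n3 f1 f2 f3 : R -> R -> R) :
  0 < mu K -> 0 < gamma1 K -> 0 < gamma2 K -> continuous (theta1 K) -> continuous (theta2 K) ->
  plane_kernel K n1 n2 n3 f1 f2 f3 ->
  exists C nu : R, 0 < C /\ 0 < nu /\
  forall (h1 h2 h3 eta H beta : R -> R) (p1 p2 p3 p1s p2s p3s p1x p2x p3x : R -> R -> R),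
  continuous h1 -> continuous h2 -> continuous h3 -> continuous eta ->
  (forall s, beta s = oint (fun r => eta (s - (mu K)^-1 + r) *
     transform n1 n2 n3 h1 h2 h3 (clamp01 (mu K * r))) 0 (mu K)^-1) ->
  dual_solution K h1 h2 h3 eta beta p1 p2 p3 p1s p2s p3s p1x p2x p3x ->
  (forall s, 0 <= eta s) -> (forall s, 1 <= s -> eta s = 0) ->
  (forall s : R, is_derive s 1 H (eta s)) ->
  (forall s, s <= 0 -> H s = 0) -> (forall s, 0 <= H s <= 1) ->
  forall s, sq (p1 s) + sq (p2 s) + sq (p3 s)
    <= C * expR (- nu * s) * H s * (sq h1 + sq h2 + sq h3).
Proof.
move=> mu0 g10 g20 ct1 ct2 PK; case: (PK) => cn1 cn2 cn3 _ _ _ _ _ _ _ _ _ _ _ _.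
have [M M0 HM] : exists2 M, 0 <= M & forall x xi, 0 <= xi -> xi <= x -> x <= 1 ->
    [/\ `|n1 x xi| <= M, `|n2 x xi| <= M & `|n3 x xi| <= M].
  have [M1 p1 h1] := square_bound _ cn1; have [M2 p2 h2] := square_bound _ cn2.
  have [M3 p3 h3] := square_bound _ cn3.
  exists (M1 + M2 + M3); first by rewrite !addr_ge0.
  move=> x xi a b c; move: (h1 _ _ a b c) (h2 _ _ a b c) (h3 _ _ a b c) p1 p2 p3; clear; split; lra.
have HM1 x xi : 0 <= xi -> xi <= x -> x <= 1 -> `|n1 x xi| <= M by move=> a b c; have [] := HM x xi a b c.
have HM2 x xi : 0 <= xi -> xi <= x -> x <= 1 -> `|n2 x xi| <= M by move=> a b c; have [] := HM x xi a b c.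
have HM3 x xi : 0 <= xi -> xi <= x -> x <= 1 -> `|n3 x xi| <= M by move=> a b c; have [] := HM x xi a b c.
have [S S0 HS] := bounded01_fin (fun i => sel4 (fun=> `|sigma11 K| + `|sigma12 K| + (`|sigma21 K| + `|sigma22 K|))
   (theta1 K) (theta2 K) (theta1 K) i) (fun i => ltac:(by case: i => [[|[|[|[|]]]] ?] //; exact: ctsC)).
have {HS} [S1 St1 St2] : [/\ `|sigma11 K| + `|sigma12 K| + (`|sigma21 K| + `|sigma22 K|) <= S,
   forall x, 0 <= x <= 1 -> `|theta1 K x| <= S & forall x, 0 <= x <= 1 -> `|theta2 K x| <= S].
  split; last 2 first.
  - by move=> x; exact: (HS (@Ordinal 4 1 isT)).
  - by move=> x; exact: (HS (@Ordinal 4 2 isT)).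
  have := HS (@Ordinal 4 0 isT) 0; rewrite /sel4 /= lexx ler01 => /(_ isT).
  by rewrite ger0_norm // !addr_ge0.
have [S11 S12 S21 S22] : [/\ `|sigma11 K| <= S, `|sigma12 K| <= S, `|sigma21 K| <= S & `|sigma22 K| <= S].
  have := normr_ge0 (sigma11 K); have := normr_ge0 (sigma12 K).
  have := normr_ge0 (sigma21 K); have := normr_ge0 (sigma22 K).
  by move: S1; clear; split; lra.
pose g := Num.min (gamma1 K) (gamma2 K).
have g0 : 0 < g by rewrite lt_min g10.
have gg1 : g <= gamma1 K by rewrite ge_min lexx.
have gg2 : g <= gamma2 K by rewrite ge_min lexx orbT.
(* The first summand absorbs the couplings, the second the Volterra integrals. *)
pose l := (7 * S + 1) / g + (8 * M ^+ 2 + 1).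
have lg : 0 <= (7 * S + 1) / g by rewrite divr_ge0 ?addr_ge0 ?mulr_ge0 // ltW.
have lM : 8 * M ^+ 2 <= l by rewrite /l; move: lg; clear; lra.
have l0 : 0 < l by have := sqr_ge0 M; rewrite /l; move: lg; clear; lra.
have gl : 7 * S + 1 <= g * l.
  rewrite /l mulrDr mulrCA divff ?gt_eqF // mulr1 lerDl mulr_ge0 ?(ltW g0) //.
  by rewrite addr_ge0 // mulr_ge0 // sqr_ge0.
have eL0 : 0 <= expR l := expR_ge0 l.
pose bd := (mu K * rho1 K) ^+ 2 / gamma1 K + (mu K * rho2 K) ^+ 2 / gamma2 K.
have bd0 : 0 <= bd by rewrite addr_ge0 // divr_ge0 ?sqr_ge0 // ltW.
pose B := 1 + (expR l * bd + 32 * S * expR l) / mu K.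
have Bx0 : 0 <= expR l * bd by rewrite mulr_ge0.
have Bx1 : 0 <= 32 * S * expR l by rewrite !mulr_ge0 // ltW.
have B1 : 1 <= B by rewrite lerDl divr_ge0 ?addr_ge0 // ltW.
have B0 : 0 <= B by rewrite (le_trans _ B1).
have mB : mu K * B = mu K + (expR l * bd + 32 * S * expR l).
  by rewrite /B mulrDr mulr1 mulrCA divff ?gt_eqF // mulr1.
have mB1 : expR l * bd <= mu K * B by rewrite mB; move: (ltW mu0) Bx1; clear; lra.
have mB2 : 32 * S * expR l <= mu K * B by rewrite mB; move: (ltW mu0) Bx0; clear; lra.
pose nu := Num.min 1 (mu K / 4).
have nu0 : 0 < nu by rewrite lt_min ltr01 divr_gt0.
have nu1 : nu <= 1 by rewrite ge_min lexx.
have num : nu <= mu K / 4 by rewrite ge_min lexx orbT.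
pose C := (2 + 8 * expR l) * (expR 1 * expR nu * (expR l + 8 * B * (1 + M ^+ 2))).
exists C, nu; split.
  have := sqr_ge0 M => M2.
  by rewrite !mulr_gt0 ?expR_gt0 ?addr_gt0 ?expR_gt0 ?mulr_gt0 ?expR_gt0 ?(lt_le_trans ltr01 B1) //;
    rewrite ltr_pwDl.
split=> //.
move=> h1 h2 h3 eta H beta p1 p2 p3 p1s p2s p3s p1x p2x p3x ch1 ch2 ch3 ce betaE DS e0 e1 dH H0 H1 s.
case: (DS) => cp1 cp2 cp3 c1s c2s c3s c1x c2x c3x d1s d2s d3s d1x d2x d3x pe1 pe2 pe3 pb1 pb2 pb3 [Bd HBd].
pose Q t x := transform n1 n2 n3 (p1 t) (p2 t) (p3 t) x.
pose k := transform n1 n2 n3 h1 h2 h3.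
have ck : continuous k by exact: (transform_h_cts _ _ _ _ _ _ _ PK _ _ _ ch1 ch2 ch3).
have cQ : continuous (fun z : R * R => Q z.1 z.2) by exact: (transform_cts _ _ _ _ _ _ _ PK _ _ _ _ _ _ _ _ _ _ _ _ _ _ DS).
have c1 t : continuous (p1 t) by cts.
have c2 t : continuous (p2 t) by cts.
have c3 t : continuous (p3 t) by cts.
have cQt t : continuous (Q t) by cts.
pose src := transform_source K n1 n2 n3 f1 f2 f3 p1 p2 p3 p1s p2s p3s p1x p2x p3x.
have csrc : continuous (fun z : R * R => src z.1 z.2) by exact: (transform_source_cts _ _ _ _ _ _ _ PK _ _ _ _ _ _ _ _ _ _ _ _ _ _ DS).
have csrct t : continuous (src t) by cts.
pose q1 t x := p1s t x - gamma1 K * p1x t x.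
pose q2 t x := p2s t x - gamma2 K * p2x t x.
have cq1 : continuous (fun z : R * R => q1 z.1 z.2) by rewrite /q1; cts.
have cq2 : continuous (fun z : R * R => q2 z.1 z.2) by rewrite /q2; cts.
have cq1t t : continuous (q1 t) by cts.
have cq2t t : continuous (q2 t) by cts.
have cel := cts_expM l.
pose E t := wsq l (p1 t) + wsq l (p2 t) + B * tsq (Q t).
have dE1 t := der_wsq l (gamma1 K) t p1 q1 cp1 cq1 (der_along _ _ _ _ c1s d1s d1x).
have dE2 t := der_wsq l (gamma2 K) t p2 q2 cp2 cq2 (der_along _ _ _ _ c2s d2s d2x).
have dE3 t := der_tsq (- mu K) t Q src cQ csrc
  (der_transform K n1 n2 n3 f1 f2 f3 PK h1 h2 h3 eta beta p1 p2 p3 p1s p2s p3s p1x p2x p3x DS).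
have dE t := derD _ _ _ _ _ (derD _ _ _ _ _ (dE1 t) (dE2 t)) (derZ _ _ _ B (dE3 t)).
have Q1 t : Q t 1 = beta t.
  exact: (transform_at1 _ _ _ _ _ _ _ _ _ _ _ _ _ _ _ _ _ _ DS).
have Q0 t : Q t 0 = 0.
  exact: (transform_at0 _ mu0 _ _ _ _ _ _ PK _ _ _ _ _ _ _ _ _ _ _ _ _ _ DS ch1 ch2 ch3 ce betaE).
have wp1 t := wsq_ge0 l (p1 t) (c1 t).
have wp2 t := wsq_ge0 l (p2 t) (c2 t).
have sQ0 t := sq_ge0 (Q t) (cQt t).
have sQT t : sq (Q t) <= tsq (Q t) <= 2 * sq (Q t) by exact: sq_le_tsq.
have tQ0 t : 0 <= tsq (Q t) by have /andP[+ _] := sQT t; apply: le_trans.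
have wp3 t : wsq l (p3 t) <= 8 * (expR l * sq (Q t)) + wsq l (p1 t) + wsq l (p2 t).
  apply: (third_component_le l l0 n1 n2 n3 M cn1 cn2 cn3) => //.
pose hh := expR l * (sq h1 + sq h2) + 2 * B * sq k.
have sh1 := sq_ge0 h1 ch1; have sh2 := sq_ge0 h2 ch2; have sh3 := sq_ge0 h3 ch3.
have hh0 : 0 <= hh.
  apply: addr_ge0; first by apply: mulr_ge0 => //; exact: addr_ge0.
  by apply: mulr_ge0; [exact: mulr_ge0|exact: sq_ge0].
have EE t := energy_rate_le _ _ _ _ _ _ (wsq l (p3 t)) (sq (Q t)) _ (sq h1) (sq h2) (sq k) (gamma1 K) (gamma2 K) (mu K)
  (rho1 K) (rho2 K) (p1 t 0) (p2 t 0) (p1 t 1) (p2 t 1) (beta t) S g l (expR l) B (eta t) nu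
  (wp1 t) (wp2 t) (sQ0 t) (tQ0 t) g10 g20 mu0 (ltW S0) eL0 B0 (e0 t) erefl.
pose E' t := (gamma1 K) * (expR l * p1 t 1 ^+ 2 - p1 t 0 ^+ 2)
     + oint (fun x => expR (l * x) * (2 * p1 t x * q1 t x - gamma1 K * l * p1 t x ^+ 2)) 0 1
  + ((gamma2 K) * (expR l * p2 t 1 ^+ 2 - p2 t 0 ^+ 2)
     + oint (fun x => expR (l * x) * (2 * p2 t x * q2 t x - gamma2 K * l * p2 t x ^+ 2)) 0 1)
  + (- (mu K * B * beta t ^+ 2)
     + oint (fun x => B * (- mu K * Q t x ^+ 2 + 2 * (2 - x) * Q t x * (eta t * k x))) 0 1).
have {}dE (t : R) : is_derive t 1 E (E' t).
  apply: (is_derive_fct _ _ _ _ (dE t)); rewrite /E'; congr (_ + _).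
  rewrite Q1 Q0 expr0n mulr0 subr0 mulrDr -ointZ; last by cts.
  apply: (f_equal2 (@GRing.add R)); first by rewrite mulNr mulrN mulrCA mulrA.
  apply: eq_oint => //; [by cts|by cts|].
  move=> x x01; congr (_ * (_ + _ * _)).
  exact: (transform_sourceE _ _ _ _ _ _ _ PK _ _ _ _ _ _ _ _ _ _ _ _ _ _ DS ch1 ch2 ch3).
have {}EE t : E' t <= - nu * E t + eta t * (E t + hh).
  apply: EE => //.
  - have := component_rate l l0 (sigma11 K) (sigma21 K) (gamma1 K) S g (eta t) (theta1 K) (p1 t) (p2 t) (p3 t) h1
      S11 S21 St1 gg1 (e0 t) ct1 (c1 t) (c2 t) (c3 t) ch1.
    apply: le_trans; rewrite le_eqVlt; apply/orP; left; apply/eqP.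
    have c1t := c1 t; have c2t := c2 t; have c3t := c3 t; have cq1t' := cq1t t.
    apply: eq_oint => //; [by cts|by cts|].
    by move=> x x01; rewrite /q1 pe1 //; congr (_ * (_ * _ - _)); ring.
  - have := component_rate l l0 (sigma22 K) (sigma12 K) (gamma2 K) S g (eta t) (theta2 K) (p2 t) (p1 t) (p3 t) h2
      S22 S12 St2 gg2 (e0 t) ct2 (c2 t) (c1 t) (c3 t) ch2.
    apply: le_trans; rewrite le_eqVlt; apply/orP; left; apply/eqP.
    have c1t := c1 t; have c2t := c2 t; have c3t := c3 t; have cq2t' := cq2t t.
    apply: eq_oint => //; [by cts|by cts|].
    by move=> x x01; rewrite /q2 pe2 //; congr (_ * (_ * _ - _)); ring.
  - exact: transported_rate.
  - by have /andP[_] := sQT t.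
(* The data on [x = 1] are bounded in time, hence so is the energy. *)
have Ebd t : E t <= expR l * Bd ^+ 2 + expR l * Bd ^+ 2 + B * (2 * (4 * (1 + M ^+ 2) * (Bd ^+ 2 + Bd ^+ 2 + Bd ^+ 2))).
  have sb (p : R -> R) : continuous p -> (forall x, 0 <= x <= 1 -> `|p x| <= Bd) -> sq p <= Bd ^+ 2.
    move=> cp pB; have : sq p <= oint (fun=> Bd ^+ 2) 0 1.
      apply: le_oint => //; [by cts|exact: ctsC|].
      by move=> x /pB h; rewrite -[p x ^+ 2]real_normK ?num_real // lerXn2r // nnegrE (le_trans _ h).
    by rewrite oint_cst subr0 mulr1.
  have b1 : sq (p1 t) <= Bd ^+ 2 by apply: sb => // x x01; have [] := HBd t x x01.
  have b2 : sq (p2 t) <= Bd ^+ 2 by apply: sb => // x x01; have [] := HBd t x x01.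
  have b3 : sq (p3 t) <= Bd ^+ 2 by apply: sb => // x x01; have [] := HBd t x x01.
  have bQ : sq (Q t) <= 4 * (1 + M ^+ 2) * (sq (p1 t) + sq (p2 t) + sq (p3 t)).
    apply: (transform_sq_le n1 n2 n3 M cn1 cn2 cn3) => //.
  rewrite !lerD //.
  - by apply: (le_trans (wsq_le_sq l l0 _ (c1 t))); rewrite ler_wpM2l.
  - by apply: (le_trans (wsq_le_sq l l0 _ (c2 t))); rewrite ler_wpM2l.
  - rewrite ler_wpM2l //; have /andP[_ h] := sQT t; apply: (le_trans h).
    rewrite ler_wpM2l //; apply: (le_trans bQ).
    by rewrite ler_wpM2l ?mulr_ge0 ?addr_ge0 ?sqr_ge0 // !lerD.
have Hge t : 0 <= H t by have /andP[] := H1 t.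
have F := gronwall_from_Ny E E' H eta nu hh _ dE dH e0 e1 H0 Hge EE Ebd nu0 hh0 s.
have kb : sq k <= 4 * (1 + M ^+ 2) * (sq h1 + sq h2 + sq h3).
  apply: (transform_sq_le n1 n2 n3 M cn1 cn2 cn3) => //.
set Sh := sq h1 + sq h2 + sq h3 in kb *.
have hhb : hh <= (expR l + 8 * B * (1 + M ^+ 2)) * Sh.
  rewrite mulrDl lerD //.
    by rewrite ler_wpM2l // /Sh lerDl sq_ge0.
  have -> : 8 * B * (1 + M ^+ 2) * Sh = 2 * B * (4 * (1 + M ^+ 2) * Sh) by ring.
  by rewrite ler_wpM2l // mulr_ge0.
have Sh0 : 0 <= Sh by exact: (addr_ge0 (addr_ge0 sh1 sh2) sh3).
have lhs : sq (p1 s) + sq (p2 s) + sq (p3 s) <= (2 + 8 * expR l) * E s.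
  have a1 := sq_le_wsq l l0 _ (c1 s); have a2 := sq_le_wsq l l0 _ (c2 s); have a3 := sq_le_wsq l l0 _ (c3 s).
  have b1 : expR l * sq (Q s) <= expR l * (B * tsq (Q s)).
    rewrite ler_wpM2l //; have /andP[h _] := sQT s; apply: (le_trans h).
    by rewrite ler_peMl.
  have b2 : 0 <= expR l * (wsq l (p1 s) + wsq l (p2 s)) by rewrite mulr_ge0 // addr_ge0.
  have b3 : 0 <= B * tsq (Q s) by rewrite mulr_ge0.
  move: (wp3 s) a1 a2 a3 b1 b2 b3; rewrite /E.
  exact: components_le_energy.
apply: (le_trans lhs).
have e2 : 0 <= 2 + 8 * expR l by rewrite addr_ge0 // mulr_ge0.
apply: (le_trans (ler_wpM2l e2 F)).
have -> : C * expR (- nu * s) * H s * Sh = (2 + 8 * expR l) *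
   (expR 1 * (expR nu * ((expR l + 8 * B * (1 + M ^+ 2)) * Sh) * H s) * expR (- nu * s)) by rewrite /C; ring.
rewrite ler_wpM2l // ler_wpM2r ?expR_ge0 //.
apply: ler_pM; rewrite ?expR_ge0 ?mulr_ge0 ?expR_ge0 //.
  by rewrite ler_expR; have /andP[] := H1 s.
by rewrite ler_wpM2r // ler_wpM2l ?expR_ge0.
Qed.

(** * Dual solutions driven by a short pulse *)

Section bump.
Context {R : realType}.

Lemma der_sqr_max0 (u : R) : is_derive u 1 (fun u => Num.max 0 u ^+ 2) (2 * Num.max 0 u).
Proof.
apply/is_derive_epsP => e e0; exists e => // h he.
have H : `|Num.max 0 (u + h) ^+ 2 - Num.max 0 u ^+ 2 - 2 * Num.max 0 u * h| <= `|h| ^+ 2.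
  rewrite real_normK ?num_real // ler_norml.
  have h2 : 0 <= (u + h) ^+ 2 := sqr_ge0 _.
  have [a|a] := leP 0 u; have [b|b] := leP 0 (u + h); rewrite ?expr0n /=; nra.
by apply: (le_trans H); rewrite expr2 ler_wpM2r // ltW.
Qed.

(** The square of the positive part of [s * (d - s)], normalized: its mass is
    positive by the mean value theorem. *)
Lemma bump_ex (d : R) : 0 < d -> d <= 1 -> exists eta eta' H : R -> R,
  [/\ continuous eta /\ continuous eta' /\ (forall s : R, is_derive s 1 eta (eta' s)),
      exists N, forall s, `|eta s| <= N /\ `|eta' s| <= N,
      (forall s, 0 <= eta s) /\ (forall s, d <= s -> eta s = 0) /\ (forall s, s <= 0 -> eta s = 0),
      oint eta 0 d = 1 &
      [/\ forall s : R, is_derive s 1 H (eta s), forall s, s <= 0 -> H s = 0 & forall s, 0 <= H s <= 1]].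
Proof.
move=> d0 d1.
pose b s : R := Num.max 0 (s * (d - s)) ^+ 2.
pose b' s : R := 2 * Num.max 0 (s * (d - s)) * (d - 2 * s).
have cm : continuous (fun s : R => Num.max 0 (s * (d - s))).
  refine (cts_max (fun=> 0) _ _ _); cts.
have cb : continuous b by rewrite /b; cts.
have cb' : continuous b' by rewrite /b'; cts.
have db (s : R) : is_derive s 1 b (b' s).
  have d2 : is_derive s 1 (fun s => s * (d - s)) (d - 2 * s).
    apply: (is_derive_fct _ _ _ _ (derM _ _ _ _ _ (is_derive_id s 1) (derB _ _ _ _ _ (derC d s) (is_derive_id s 1)))).
    by ring.
  exact: (der_comp _ _ _ _ _ d2 (der_sqr_max0 _)).
have out s : s <= 0 \/ d <= s -> Num.max 0 (s * (d - s)) = 0.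
  move=> [s0|sd]; apply: max_l.
    by rewrite mulr_le0_ge0 // subr_ge0 (le_trans s0) // ltW.
  by rewrite mulr_ge0_le0 // ?subr_le0 // (le_trans _ sd) // ltW.
pose I := oint b 0 d.
have I0 : 0 < I.
  have [c ccd] := MVT d0 (fun x _ => der_prim b x cb)
     (continuous_subspaceT (fun x => der_continuous _ _ _ (der_prim b x cb))).
  rewrite -/(oint b 0 d) -/I subr0 => ->.
  move: ccd; rewrite in_itv/= => /andP[c0 c1].
  rewrite mulr_gt0 // exprn_gt0 // lt_max; apply/orP; right.
  by rewrite mulr_gt0 // subr_gt0.
have In : I != 0 by rewrite gt_eqF.
pose eta s := I^-1 * b s; pose eta' s := I^-1 * b' s.
have ce : continuous eta by rewrite /eta; cts.
have ce' : continuous eta' by rewrite /eta'; cts.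
have e0 s : 0 <= eta s by rewrite mulr_ge0 ?invr_ge0 ?(ltW I0) // sqr_ge0.
have eout s : s <= 0 \/ d <= s -> eta s = 0 by move=> /out h; rewrite /eta /b h expr0n mulr0.
have eout' s : s <= 0 \/ d <= s -> eta' s = 0 by move=> /out h; rewrite /eta' /b' h mulr0 mul0r mulr0.
have int1 : oint eta 0 d = 1 by rewrite /eta ointZ // -/I mulVf.
have zero x y : x <= y -> (forall s, x <= s <= y -> eta s = 0) -> oint eta x y = 0.
  move=> xy h; have -> : 0 = oint (fun=> 0 : R) x y by rewrite oint_cst mul0r.
  by apply: eq_oint => //; exact: ctsC.
have neg s : s <= 0 -> oint eta 0 s = 0.
  by move=> s0; rewrite oint_rev zero ?oppr0 // => x /andP[_ x0]; apply: eout; left.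
have pos x y : x <= y -> 0 <= oint eta x y by move=> xy; apply: oint_ge0.
exists eta, eta', (oint eta 0); split.
- split; first exact: ce.
  by split; [exact: ce'|move=> s; exact: derZ].
- have [N1 N10 h1] := bounded01 eta ce; have [N2 N20 h2] := bounded01 eta' ce'.
  exists (N1 + N2) => s.
  have [s0|s0] := leP s 0; first by rewrite eout ?eout' ?normr0; [rewrite addr_ge0|left|left].
  have [sd|sd] := leP d s; first by rewrite eout ?eout' ?normr0; [rewrite addr_ge0|right|right].
  have s01 : 0 <= s <= 1 by rewrite (ltW s0) (le_trans (ltW sd)).
  by rewrite (le_trans (h1 s s01)) ?lerDl // (le_trans (h2 s s01)) ?lerDr.
- by split => //; split => s hs; apply: eout; [right|left].
- exact: int1.
- split => //.
  + move=> s; have := derB _ _ _ _ _ (der_prim _ s ce) (derC (prim eta 0) s); by rewrite subr0.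
  + move=> s; have [s0|s0] := leP s 0; first by rewrite neg // lexx ler01.
    rewrite pos ?(ltW s0) //=.
    have [sd|sd] := leP d s.
      by rewrite -(oint_chasles _ 0 d s) int1 zero ?addr0 // => x /andP[dx _]; apply: eout; right.
    by rewrite -int1 -(oint_chasles _ 0 s d) lerDl pos // ltW.
Qed.

End bump.

(** Test functions for the duality argument: [h] is the direction to be
    tested, [d] the width of the time window in which it is injected. *)
Lemma dual_family {R : realType} (K : coefficients R) (n1 n2 n3 f1 f2 f3 : R -> R -> R) :
  0 < mu K -> 0 < gamma1 K -> 0 < gamma2 K ->
  continuous (alpha K) -> continuous (theta1 K) -> continuous (theta2 K) ->
  plane_kernel K n1 n2 n3 f1 f2 f3 ->
  exists C nu : R, 0 < C /\ 0 < nu /\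
  forall (h1 h2 h3 : R -> R) (d : R),
  continuous h1 -> continuous h2 -> continuous h3 -> 0 < d -> d <= 1 ->
  exists (eta beta : R -> R) (p1 p2 p3 p1s p2s p3s p1x p2x p3x : R -> R -> R),
  [/\ dual_solution K h1 h2 h3 eta beta p1 p2 p3 p1s p2s p3s p1x p2x p3x,
      continuous eta /\ oint eta 0 d = 1,
      (forall s, 0 <= eta s) /\ (forall s, d <= s -> eta s = 0),
      forall s, transform n1 n2 n3 (p1 s) (p2 s) (p3 s) 0 = 0 &
      (forall s, sq (p1 s) + sq (p2 s) + sq (p3 s)
         <= C * expR (- nu * s) * (sq h1 + sq h2 + sq h3)) /\
      sq (p1 0) + sq (p2 0) + sq (p3 0) <= 0].
Proof.
move=> mu0 g10 g20 ca ct1 ct2 PK.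
have [C [nu [C0 [nu0 HC]]]] := dual_decay K n1 n2 n3 f1 f2 f3 mu0 g10 g20 ct1 ct2 PK.
exists C, nu; split=> //; split=> // h1 h2 h3 d ch1 ch2 ch3 d0 d1.
have [eta [eta' [H [[ce [ce' de]] [N HN] [e0 [e1 em]] int1 [dH H0 H1]]]]] := bump_ex d d0 d1.
pose k := transform n1 n2 n3 h1 h2 h3.
have ck : continuous k by exact: (transform_h_cts _ _ _ _ _ _ _ PK _ _ _ ch1 ch2 ch3).
have [M M0 HM] := bounded01 k ck.
have cc := @clamp01_cts R.
pose m := (mu K)^-1.
have m0 : 0 <= m by rewrite invr_ge0 ltW.
pose beta s := oint (fun r => eta (s - m + r) * k (clamp01 (mu K * r))) 0 m.
pose beta' s := oint (fun r => eta' (s - m + r) * k (clamp01 (mu K * r))) 0 m.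
have cts_b (e : R -> R) : continuous e -> continuous (fun s => oint (fun r => e (s - m + r) * k (clamp01 (mu K * r))) 0 m).
  move=> cce; refine (cts_oint (fun s r => e (s - m + r) * k (clamp01 (mu K * r))) (fun=> 0) (fun=> m) _ _ _); cts.
have bd_b (e : R -> R) : continuous e -> (forall s, `|e s| <= N) ->
    forall s, `|oint (fun r => e (s - m + r) * k (clamp01 (mu K * r))) 0 m| <= N * M * m.
  move=> cce eN s; have cf : continuous (fun r => e (s - m + r) * k (clamp01 (mu K * r))) by cts.
  apply: (le_trans (oint_bound _ _ _ (N * M) cf _)).
    by move=> x _; rewrite normrM ler_pM // HM // clamp01_itv.
  by rewrite subr0 ger0_norm.
have db (s : R) : is_derive s 1 beta (beta' s).
  refine (der_param (fun s r => eta (s - m + r) * k (clamp01 (mu K * r)))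
    (fun s r => eta' (s - m + r) * k (clamp01 (mu K * r))) s 0 m _ _ _); [by cts|by cts|].
  move=> t r.
  have h : is_derive t 1 (fun t => t - m + r) 1.
    have := derD _ _ _ _ _ (derB _ _ _ _ _ (is_derive_id t 1) (derC m t)) (derC r t).
    by rewrite subr0 addr0.
  apply: (is_derive_fct _ _ _ _ (derM _ _ _ _ _ (der_comp _ _ _ _ _ h (de _)) (derC (k (clamp01 (mu K * r))) t))).
  by rewrite mulr0 add0r mulr1 mulrC.
have N0 : 0 <= N by have [h _] := HN 0; exact: le_trans h.
have Nle : N <= N + N * M * m by rewrite lerDl !mulr_ge0.
have Nle' : N * M * m <= N + N * M * m by rewrite lerDr.
have [p1 [p2 [p3 [p1s [p2s [p3s [p1x [p2x [p3x DS]]]]]]]]] := dual_solution_ex K mu0 g10 g20 ca ct1 ct2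
  h1 h2 h3 eta eta' beta beta' (N + N * M * m) ch1 ch2 ch3 ce ce' de (cts_b _ ce) (cts_b _ ce') db
  (fun s => le_trans (proj1 (HN s)) Nle) (fun s => le_trans (proj2 (HN s)) Nle)
  (fun s => le_trans (bd_b _ ce (fun s => proj1 (HN s)) s) Nle')
  (fun s => le_trans (bd_b _ ce' (fun s => proj2 (HN s)) s) Nle').
have bE s : beta s = oint (fun r => eta (s - (mu K)^-1 + r) * transform n1 n2 n3 h1 h2 h3 (clamp01 (mu K * r))) 0 (mu K)^-1 by [].
have D := HC _ _ _ eta H beta _ _ _ _ _ _ _ _ _ ch1 ch2 ch3 ce bE DS e0 (fun s s1 => e1 s (le_trans d1 s1)) dH H0 H1.
exists eta, beta, p1, p2, p3, p1s, p2s, p3s, p1x, p2x, p3x; split => //.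
- move=> s.
  exact: (transform_at0 _ mu0 _ _ _ _ _ _ PK _ _ _ _ _ _ _ _ _ _ _ _ _ _ DS ch1 ch2 ch3 ce bE).
- have sh : 0 <= sq h1 + sq h2 + sq h3 by exact: (addr_ge0 (addr_ge0 (sq_ge0 _ ch1) (sq_ge0 _ ch2)) (sq_ge0 _ ch3)).
  split; last by apply: (le_trans (D 0)); rewrite H0 // mulr0 mul0r.
  move=> s; apply: (le_trans (D s)); apply: ler_wpM2r => //.
  have /andP[h0 h1'] := H1 s.
  by rewrite ler_piMr // mulr_ge0 ?expR_ge0 // ltW.
Qed.

(** * Square integrable functions on an interval *)

Section square_integrable.
Context {R : realType}.
Implicit Types (f g : R -> R) (a b T : R).

Definition integ a b f : Prop := (@lebesgue_measure R).-integrable `[a, b] (EFin \o f).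

(** Integrability and value together, so that sums of integrals can be formed
    without side conditions. *)
Definition has_int a b f (v : R) : Prop :=
  integ a b f /\ \int[lebesgue_measure]_(x in `[a, b]) f x = v.

Lemma integ_cts a b f : continuous f -> integ a b f.
Proof. exact: continuous_integrable_itv. Qed.

Lemma integD a b f g : integ a b f -> integ a b g -> integ a b (fun x => f x + g x).
Proof.
by move=> hf hg; apply: eq_integrable (integrableD _ hf hg).
Qed.

Lemma integB a b f g : integ a b f -> integ a b g -> integ a b (fun x => f x - g x).
Proof.
by move=> hf hg; apply: eq_integrable (integrableB _ hf hg).
Qed.

Lemma integZ a b f c : integ a b f -> integ a b (fun x => c * f x).
Proof.
by move=> hf; apply: eq_integrable (integrableZl _ c hf).
Qed.

Lemma integ_eq a b f g : (forall x, a <= x <= b -> f x = g x) -> integ a b f -> integ a b g.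
Proof.
move=> fg; apply: eq_integrable => //.
by move=> x; rewrite inE /= in_itv /= => /fg ->.
Qed.

Lemma has_intD a b f g u v : has_int a b f u -> has_int a b g v ->
  has_int a b (fun x => f x + g x) (u + v).
Proof.
move=> [hf <-] [hg <-]; split; first exact: integD.
by rewrite RintegralD.
Qed.

Lemma has_intB a b f g u v : has_int a b f u -> has_int a b g v ->
  has_int a b (fun x => f x - g x) (u - v).
Proof.
move=> [hf <-] [hg <-]; split; first exact: integB.
by rewrite RintegralB.
Qed.

Lemma has_intZ a b f u c : has_int a b f u -> has_int a b (fun x => c * f x) (c * u).
Proof.
move=> [hf <-]; split; first exact: integZ.
by rewrite RintegralZl.
Qed.

Lemma integ_has a b f : integ a b f -> has_int a b f (\int[lebesgue_measure]_(x in `[a, b]) f x).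
Proof. by []. Qed.

Lemma integ_measurable a b f : integ a b f -> measurable_fun `[a, b] f.
Proof. by move=> /integrableP[/measurable_EFinP]. Qed.

Lemma ae_eq_Rint a b f g : measurable_fun `[a, b] f -> measurable_fun `[a, b] g ->
  {ae (@lebesgue_measure R), forall x, a <= x <= b -> f x = g x} ->
  \int[lebesgue_measure]_(x in `[a, b]) f x = \int[lebesgue_measure]_(x in `[a, b]) g x.
Proof.
move=> mf mg fg; rewrite /Rintegral; congr fine; apply: ae_eq_integral => //.
- exact/measurable_EFinP.
- exact/measurable_EFinP.
- move: fg => [N [mN N0 sub]]; exists N; split => // x Hx; apply: sub => h; apply: Hx.
  by rewrite /= in_itv /= => /h ->.
Qed.

Lemma le_Rint a b f g : integ a b f -> integ a b g -> (forall x, a <= x <= b -> f x <= g x) ->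
  \int[lebesgue_measure]_(x in `[a, b]) f x <= \int[lebesgue_measure]_(x in `[a, b]) g x.
Proof.
move=> hf hg fg; apply: le_Rintegral => //.
Qed.

Lemma L2_integ a b f : L2_on `[a, b] f -> integ a b (fun x => f x ^+ 2).
Proof.
move=> [mf fi]; apply/integrableP; split.
  by apply/measurable_EFinP; exact: measurable_funX.
apply: le_lt_trans fi; rewrite le_eqVlt; apply/orP; left; apply/eqP.
by apply: eq_integral => x _ /=; rewrite ger0_norm ?sqr_ge0.
Qed.

Lemma integ_L2 a b f : measurable_fun `[a, b] f -> integ a b (fun x => f x ^+ 2) -> L2_on `[a, b] f.
Proof.
move=> mf /integrableP[_ fi]; split => //; apply: le_lt_trans fi.
rewrite le_eqVlt; apply/orP; left; apply/eqP.
by apply: eq_integral => x _ /=; rewrite ger0_norm ?sqr_ge0.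
Qed.

Lemma integ_le a b f g : measurable_fun `[a, b] f -> (forall x, a <= x <= b -> `|f x| <= g x) ->
  integ a b g -> integ a b f.
Proof.
move=> mf fg; apply: le_integrable => //; first exact/measurable_EFinP.
move=> x; rewrite /= in_itv /= => /fg h; rewrite lee_fin.
by apply: (le_trans h); exact: ler_norm.
Qed.

Lemma L2_mul a b f g : L2_on `[a, b] f -> L2_on `[a, b] g -> integ a b (fun x => f x * g x).
Proof.
move=> Lf Lg; have hf := L2_integ _ _ _ Lf; have hg := L2_integ _ _ _ Lg.
apply: integ_le (integD _ _ _ _ hf hg).
  by apply: measurable_funM; [case: Lf|case: Lg].
move=> x _; rewrite ler_norml.
have h1 : 0 <= (f x - g x) ^+ 2 := sqr_ge0 _.
have h2 : 0 <= (f x + g x) ^+ 2 := sqr_ge0 _.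
have h3 : 0 <= f x ^+ 2 := sqr_ge0 _.
have h4 : 0 <= g x ^+ 2 := sqr_ge0 _.
by apply/andP; split; nra.
Qed.

Lemma L2_cts a b f : continuous f -> L2_on `[a, b] f.
Proof.
move=> cf; apply: integ_L2; first exact: integ_measurable (integ_cts _ _ _ cf).
by apply: integ_cts; cts.
Qed.

Lemma L2_sub a b f g : L2_on `[a, b] f -> L2_on `[a, b] g -> L2_on `[a, b] (fun x => f x - g x).
Proof.
move=> Lf Lg; have hf := L2_integ _ _ _ Lf; have hg := L2_integ _ _ _ Lg.
have mfg : measurable_fun `[a, b] (fun x => f x - g x).
  by apply: measurable_funB; [case: Lf|case: Lg].
apply: integ_L2 => //.
have := integB _ _ _ _ (integD _ _ _ _ hf hg) (integZ _ _ _ 2 (L2_mul _ _ _ _ Lf Lg)).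
by apply: integ_eq => x _; ring.
Qed.

Definition ip f g : R := \int[lebesgue_measure]_(x in `[0, 1]) (f x * g x).

Lemma L2norm_sqr f : L2norm f ^+ 2 = \int[lebesgue_measure]_(x in `[0, 1]) (f x) ^+ 2.
Proof. by rewrite sqr_sqrtr // Rintegral_ge0 // => x _; exact: sqr_ge0. Qed.

Lemma L2norm_ge0 f : 0 <= L2norm f. Proof. exact: sqrtr_ge0. Qed.

(** The square of [s * f + t * g] has nonnegative integral; the choice
    [s = |g|], [t = - |f|] or [|f|] gives the two bounds when both norms are
    nonzero. *)
Lemma cauchy_schwarz f g : L2_on `[0, 1] f -> L2_on `[0, 1] g ->
  `|ip f g| <= L2norm f * L2norm g.
Proof.
move=> Lf Lg.
have hf := L2_integ _ _ _ Lf; have hg := L2_integ _ _ _ Lg; have hfg := L2_mul _ _ _ _ Lf Lg.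
have Q (s t : R) : 0 <= s ^+ 2 * L2norm f ^+ 2 + 2 * s * t * ip f g + t ^+ 2 * L2norm g ^+ 2.
  rewrite !L2norm_sqr /ip.
  have := has_intD _ _ _ _ _ _ (has_intD _ _ _ _ _ _ (has_intZ _ _ _ _ (s ^+ 2) (integ_has _ _ _ hf))
     (has_intZ _ _ _ _ (2 * s * t) (integ_has _ _ _ hfg))) (has_intZ _ _ _ _ (t ^+ 2) (integ_has _ _ _ hg)).
  move=> [_ <-]; apply: Rintegral_ge0 => x _.
  have -> : s ^+ 2 * f x ^+ 2 + 2 * s * t * (f x * g x) + t ^+ 2 * g x ^+ 2 = (s * f x + t * g x) ^+ 2 by ring.
  exact: sqr_ge0.
have a0 := L2norm_ge0 f; have b0 := L2norm_ge0 g.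
set A := L2norm f in Q a0 *; set B := L2norm g in Q b0 *; set X := ip f g in Q *.
clear -Q a0 b0.
have [AB0|AB0] := eqVneq (A * B) 0.
  have X0 : X = 0.
    apply/eqP; move/eqP: AB0; rewrite mulf_eq0 => /orP[/eqP A0|/eqP B0].
    - have h1 := Q (- (B ^+ 2 + 1)) X; rewrite A0 in h1.
      by rewrite -sqrf_eq0 eq_le sqr_ge0 andbT; nra.
    - have h1 := Q X (- (A ^+ 2 + 1)); rewrite B0 in h1.
      by rewrite -sqrf_eq0 eq_le sqr_ge0 andbT; nra.
  by rewrite X0 normr0 mulr_ge0.
have AB : 0 < A * B by rewrite lt_def AB0 mulr_ge0.
have h1 := Q B A; have h2 := Q B (- A).
rewrite ler_norml; apply/andP; split; rewrite -(ler_pM2l AB); nra.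
Qed.

End square_integrable.

(** * Weak solutions tested against smooth families *)

Section pairing.
Context {R : realType}.
Implicit Types (f g : R -> R) (v : trajectory R) (G phi phit phix : R -> R -> R).

Lemma has_ip f g : L2_on `[0, 1] f -> L2_on `[0, 1] g -> has_int 0 1 (fun x => f x * g x) (ip f g).
Proof. by move=> Lf Lg; split => //; exact: L2_mul. Qed.

Lemma ipBl f f' g : L2_on `[0, 1] f -> L2_on `[0, 1] f' -> L2_on `[0, 1] g ->
  ip (fun x => f x - f' x) g = ip f g - ip f' g.
Proof.
move=> Lf Lf' Lg; have [_ <-] := has_intB _ _ _ _ _ _ (has_ip _ _ Lf Lg) (has_ip _ _ Lf' Lg).
by apply: eq_Rintegral => x _; rewrite mulrBl.
Qed.

Lemma ipDr f g g' : L2_on `[0, 1] f -> L2_on `[0, 1] g -> L2_on `[0, 1] g' ->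
  ip f (fun x => g x + g' x) = ip f g + ip f g'.
Proof.
move=> Lf Lg Lg'; have [_ <-] := has_intD _ _ _ _ _ _ (has_ip _ _ Lf Lg) (has_ip _ _ Lf Lg').
by apply: eq_Rintegral => x _; rewrite mulrDr.
Qed.

Lemma ipZr f g c : L2_on `[0, 1] f -> L2_on `[0, 1] g ->
  ip f (fun x => c * g x) = c * ip f g.
Proof.
move=> Lf Lg; have [_ <-] := has_intZ _ _ _ _ c (has_ip _ _ Lf Lg).
by apply: eq_Rintegral => x _; rewrite mulrCA.
Qed.

Lemma ipBr f g g' : L2_on `[0, 1] f -> L2_on `[0, 1] g -> L2_on `[0, 1] g' ->
  ip f (fun x => g x - g' x) = ip f g - ip f g'.
Proof.
move=> Lf Lg Lg'; have [_ <-] := has_intB _ _ _ _ _ _ (has_ip _ _ Lf Lg) (has_ip _ _ Lf Lg').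
by apply: eq_Rintegral => x _; rewrite mulrBr.
Qed.

Lemma eq_ip f g g' : (forall x, 0 <= x <= 1 -> g x = g' x) -> ip f g = ip f g'.
Proof.
move=> gg; apply: eq_Rintegral => x; rewrite inE /= in_itv /= => /gg ->.
by [].
Qed.

Lemma ip_oint f g : continuous f -> continuous g -> ip f g = oint (fun x => f x * g x) 0 1.
Proof. by move=> cf cg; rewrite oint_Rint //; cts. Qed.

Lemma L2norm_sq g : continuous g -> L2norm g ^+ 2 = sq g.
Proof. by move=> cg; rewrite L2norm_sqr /sq oint_Rint //; cts. Qed.

Lemma L2norm_le g M : continuous g -> 0 <= M -> (forall x, 0 <= x <= 1 -> `|g x| <= M) -> L2norm g <= M.
Proof.
move=> cg M0 gM; rewrite -(@ler_pXn2r _ 2) ?nnegrE ?L2norm_ge0 // L2norm_sq //.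
have h : sq g <= oint (fun=> M ^+ 2) 0 1.
  apply: le_oint => //; [by cts|exact: ctsC|].
  by move=> x /gM h; rewrite -[g x ^+ 2]real_normK ?num_real // lerXn2r // nnegrE.
by rewrite oint_cst subr0 mulr1 in h.
Qed.

(** Continuity in time with values in L^2 makes the pairing with a continuous
    family continuous, hence integrable, in time. *)
Lemma ip_within_cts v G T : L2_trajectory v ->
  continuous (fun z : R * R => G z.1 z.2) ->
  {within `[0, T], continuous (fun t => ip (profile v t) (G t))}.
Proof.
move=> [_ L2v cv _ _] cG; apply/subspace_continuousP => t0.
rewrite /= in_itv /= => /andP[t00 t0T].
have cGt t : continuous (G t) by cts.
apply/cvgrPdist_le => e e0.
have [Gb Gb0 GbP] := bounded01 (G t0) (cGt t0).
have Gb1 : 0 < Gb + 1 by rewrite ltr_wpDl.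
set N := L2norm (profile v t0).
have N1 : 0 < N + 1 by rewrite ltr_wpDl // L2norm_ge0.
pose d := Num.min 1 (e / 2 / (N + 1)).
have d0 : 0 < d by rewrite lt_min ltr01 /= !divr_gt0.
have tub := tube G t0 1 d cG d0.
have e1 : 0 < e / 2 / (Gb + 1) by rewrite !divr_gt0.
have := cv t0 t00 => /cvgrPdist_le /(_ _ e1) cv0.
rewrite !near_withinE in cv0 *.
near=> t; rewrite /= in_itv /= => /andP[t1 tT].
have hv : L2norm (fun x => profile v t x - profile v t0 x) <= e / 2 / (Gb + 1).
  have : `|0 - L2norm (fun x => profile v t x - profile v t0 x)| <= e / 2 / (Gb + 1).
    have : `[0, +oo[%classic t -> `|0 - L2norm (fun x => profile v t x - profile v t0 x)| <= e / 2 / (Gb + 1).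
      by near: t.
    by apply; rewrite /= in_itv /= t1.
  by rewrite sub0r normrN ger0_norm // L2norm_ge0.
have hG : forall y, `|y| <= 1 -> `|G t y - G t0 y| <= d by near: t.
have hG' y : 0 <= y <= 1 -> `|G t y - G t0 y| <= d.
  by move=> /andP[y0 y1]; apply: hG; rewrite ger0_norm.
have L1 := L2v t t1; have L0 := L2v t0 t00.
have Ld := L2_sub _ _ _ _ L1 L0.
have LG := L2_cts 0 1 _ (cGt t); have LG0 := L2_cts 0 1 _ (cGt t0).
have LdG := L2_sub _ _ _ _ LG LG0.
have -> : ip (profile v t0) (G t0) - ip (profile v t) (G t) =
  - (ip (fun x => profile v t x - profile v t0 x) (G t) + ip (profile v t0) (fun x => G t x - G t0 x)).
  by rewrite ipBl // ipBr //; ring.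
rewrite normrN (le_trans (ler_normD _ _)) // [leRHS](splitr e) lerD //.
  apply: (le_trans (cauchy_schwarz _ _ Ld LG)).
  have : L2norm (G t) <= Gb + 1.
    apply: L2norm_le => //; first exact: ltW.
    move=> x x01; have := hG' x x01; have := GbP x x01.
    have : d <= 1 by rewrite ge_min lexx.
    have := ler_normD (G t0 x) (G t x - G t0 x); rewrite addrC subrK.
    by move=> k1 kd k2 k3; rewrite (le_trans k1) // lerD // (le_trans k3).
  move=> h; apply: (le_trans (ler_pM (L2norm_ge0 _) (L2norm_ge0 _) hv h)).
  by rewrite divfK // gt_eqF.
apply: (le_trans (cauchy_schwarz _ _ L0 LdG)).
have h : L2norm (fun x => G t x - G t0 x) <= d.
  apply: L2norm_le => //; [by have c1 := cGt t; have c2 := cGt t0; cts|exact: ltW].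
have h2 : d <= e / 2 / (N + 1) by rewrite ge_min lexx orbT.
rewrite -/N; apply: (le_trans (ler_wpM2l (L2norm_ge0 _) (le_trans h h2))).
rewrite mulrCA -[leRHS]mulr1 ler_wpM2l ?divr_ge0 ?(ltW e0) // ler_pdivrMr // mul1r lerDl //.
Unshelve. all: by end_near. Qed.

Lemma integ_ip v G T : L2_trajectory v ->
  continuous (fun z : R * R => G z.1 z.2) -> integ 0 T (fun t => ip (profile v t) (G t)).
Proof.
move=> Lv cG; apply: continuous_compact_integrable; first exact: segment_compact.
exact: ip_within_cts.
Qed.

(** The weak formulation for a source of the form met in plant and observer, with
    all terms gathered in one time integral. The initial value is replaced by
    the trajectory at time [0], with which it agrees almost everywhere. *)
Lemma weak_identity (c : R) v (f : R -> R -> R) (v0 : R -> R) (u1 u2 u3 : trajectory R)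
    (a1 a2 a3 b y : R -> R) phi phit phix T :
  weak_transport c v f v0 -> L2_on `[0, 1] v0 ->
  L2_trajectory u1 -> L2_trajectory u2 -> L2_trajectory u3 ->
  continuous a1 -> continuous a2 -> continuous a3 -> continuous b -> L2loc y ->
  (forall t x, 0 <= t -> 0 <= x <= 1 ->
     f t x = a1 x * profile u1 t x + a2 x * profile u2 t x + a3 x * profile u3 t x + b x * y t) ->
  C1_test phi phit phix -> continuous (fun z : R * R => phi z.1 z.2) -> 0 <= T ->
  has_int 0 T (fun t => ip (profile v t) (fun x => phit t x + c * phix t x)
     + ip (profile u1 t) (fun x => a1 x * phi t x)
     + ip (profile u2 t) (fun x => a2 x * phi t x)
     + ip (profile u3 t) (fun x => a3 x * phi t x)
     + y t * ip b (phi t)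
     - c * (trace1 v t * phi t 1 - trace0 v t * phi t 0))
    (ip (profile v T) (phi T) - ip (profile v 0) (phi 0)).
Proof.
move=> [Lv v0E wk] Lv0 L1 L2 L3 ca1 ca2 ca3 cb Ly fE Ctest cphi T0.
have [dt dx cphit cphix] := Ctest.
have W := wk _ _ _ Ctest T T0.
have [_ L2v _ Ltr0 Ltr1] := Lv.
have cphi1 : continuous (fun t => phi t 1).
  by refine (cts2 _ _ _ phi (fun t => t) (fun=> 1) cphi _ _); cts.
have cphi0 : continuous (fun t => phi t 0).
  by refine (cts2 _ _ _ phi (fun t => t) (fun=> 0) cphi _ _); cts.
have cphit' t : continuous (phi t) by cts.
have k0 : continuous (fun z : R * R => phit z.1 z.2 + c * phix z.1 z.2) by cts.
have k1 : continuous (fun z : R * R => a1 z.2 * phi z.1 z.2) by cts.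
have k2 : continuous (fun z : R * R => a2 z.2 * phi z.1 z.2) by cts.
have k3 : continuous (fun z : R * R => a3 z.2 * phi z.1 z.2) by cts.
have h0 := integ_ip v (fun t x => phit t x + c * phix t x) T Lv k0.
have h1 := integ_ip u1 (fun t x => a1 x * phi t x) T L1 k1.
have h2 := integ_ip u2 (fun t x => a2 x * phi t x) T L2 k2.
have h3 := integ_ip u3 (fun t x => a3 x * phi t x) T L3 k3.
have h4 : integ 0 T (fun t => y t * ip b (phi t)).
  have -> : (fun t => y t * ip b (phi t)) = fun t => y t * oint (fun x => b x * phi t x) 0 1.
    by apply/funext => t; rewrite ip_oint.
  apply: L2_mul; first exact: Ly.
  apply: L2_cts; refine (cts_oint (fun t x => b x * phi t x) (fun=> 0) (fun=> 1) _ _ _); cts.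
have h5 : integ 0 T (fun t => trace1 v t * phi t 1 - trace0 v t * phi t 0).
  by apply: integB; apply: L2_mul; [exact: Ltr1|exact: L2_cts|exact: Ltr0|exact: L2_cts].
have hin := integD _ _ _ _ (integD _ _ _ _ (integD _ _ _ _ (integD _ _ _ _ h0 h1) h2) h3) h4.
have Z := has_intB _ _ _ _ _ _ (integ_has _ _ _ hin) (has_intZ _ _ _ _ c (integ_has _ _ _ h5)).
pose F t := ip (profile v t) (fun x => phit t x + c * phix t x) + ip (profile u1 t) (fun x => a1 x * phi t x)
  + ip (profile u2 t) (fun x => a2 x * phi t x) + ip (profile u3 t) (fun x => a3 x * phi t x) + y t * ip b (phi t).
have -> : ip (profile v T) (phi T) - ip (profile v 0) (phi 0) =
  \int[lebesgue_measure]_(t in `[0, T]) F t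
  - c * \int[lebesgue_measure]_(t in `[0, T]) (trace1 v t * phi t 1 - trace0 v t * phi t 0); last exact: Z.
have e0 : ip (profile v 0) (phi 0) = \int[lebesgue_measure]_(x in `[0, 1]) (v0 x * phi 0 x).
  apply: ae_eq_Rint.
  - by apply: integ_measurable; apply: L2_mul; [exact: L2v|exact: L2_cts].
  - by apply: integ_measurable; apply: L2_mul; [exact: Lv0|exact: L2_cts].
  - move: v0E => [N [mN N0 sub]]; exists N; split => // x Hx; apply: sub => h; apply: Hx.
    by move=> x01; rewrite h.
have -> : \int[lebesgue_measure]_(t in `[0, T]) F t =
  \int[lebesgue_measure]_(t in `[0, T])
            (\int[lebesgue_measure]_(x in `[0, 1])
               (profile v t x * (phit t x + c * phix t x) + f t x * phi t x)).
  rewrite /F; apply: eq_Rintegral => t; rewrite inE /= in_itv /= => /andP[t0 tT].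
  have [_ M1 _ _ _] := L1; have [_ M2 _ _ _] := L2; have [_ M3 _ _ _] := L3.
  have l0 : continuous (fun x => phit t x + c * phix t x) by cts.
  have l1 : continuous (fun x => a1 x * phi t x) by cts.
  have l2 : continuous (fun x => a2 x * phi t x) by cts.
  have l3 : continuous (fun x => a3 x * phi t x) by cts.
  have i0 := has_ip _ (fun x => phit t x + c * phix t x) (L2v t t0) (L2_cts _ _ _ l0).
  have i1 := has_ip _ (fun x => a1 x * phi t x) (M1 t t0) (L2_cts _ _ _ l1).
  have i2 := has_ip _ (fun x => a2 x * phi t x) (M2 t t0) (L2_cts _ _ _ l2).
  have i3 := has_ip _ (fun x => a3 x * phi t x) (M3 t t0) (L2_cts _ _ _ l3).
  have i4 := has_intZ _ _ _ _ (y t) (has_ip _ (phi t) (L2_cts 0 1 _ cb) (L2_cts _ _ _ (cphit' t))).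
  have [_ <-] := has_intD _ _ _ _ _ _ (has_intD _ _ _ _ _ _ (has_intD _ _ _ _ _ _ (has_intD _ _ _ _ _ _ i0 i1) i2) i3) i4.
  apply: eq_Rintegral => x; rewrite inE /= in_itv /= => x01.
  by rewrite fE //; ring.
rewrite -W e0 /ip; ring.
Qed.

End pairing.

(** * The duality identity *)

Section duality.
Context {R : realType}.

Lemma reversed_test (p ps px : R -> R -> R) (T : R) :
  continuous (fun z : R * R => ps z.1 z.2) -> continuous (fun z : R * R => px z.1 z.2) ->
  (forall s x : R, is_derive s 1 (fun s => p s x) (ps s x)) ->
  (forall s x : R, is_derive x 1 (p s) (px s x)) ->
  C1_test (fun t x => p (T - t) x) (fun t x => - ps (T - t) x) (fun t x => px (T - t) x).
Proof.
move=> cs cx ds dx; split.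
- move=> t x.
  have h : is_derive t 1 (fun t => T - t) (-1).
    by have := derB _ _ _ _ _ (derC T t) (is_derive_id t 1); rewrite sub0r.
  by have := der_comp _ _ _ _ _ h (ds _ x); rewrite mulrN1.
- by move=> t x; exact: dx.
- by cts.
- by cts.
Qed.

(** The boundary values of plant ([a], [w]) and observer ([a'], [w']) occur only
    through their differences. At [x = 1] the control [u] drops out and the
    conditions on the test functions cancel the rest; at [x = 0] the traces of
    the first two components agree, and what remains of the third is opposite to
    the injection term [B1 + B2 + B3]. *)
Lemma boundary_terms_cancel (g1 g2 m r1 r2 be a1 a2 a3 a1' a2' a3' u w w' q1 q2 f11 f10 f21 f20 f31 f30 B1 B2 B3 : R) :
  g1 * f11 = m * r1 * be -> g2 * f21 = m * r2 * be -> f31 = be ->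
  a3 = r1 * a1 + r2 * a2 + u -> a3' = r1 * a1' + r2 * a2' + u ->
  B1 + B2 + B3 = - m * f30 ->
  - g1 * (a1 * f11 - q1 * w * f10) + g1 * (a1' * f11 - q1 * w * f10)
  - g2 * (a2 * f21 - q2 * w * f20) + g2 * (a2' * f21 - q2 * w * f20)
  - - m * (a3 * f31 - w * f30) + - m * (a3' * f31 - w' * f30)
  - (w - w') * (B1 + B2 + B3) = 0.
Proof.
move=> e1 e2 -> -> -> ->.
have -> : - g1 * (a1 * f11 - q1 * w * f10) + g1 * (a1' * f11 - q1 * w * f10) = (a1' - a1) * (g1 * f11) by ring.
have -> : (a1' - a1) * (g1 * f11) - g2 * (a2 * f21 - q2 * w * f20) + g2 * (a2' * f21 - q2 * w * f20)
  = (a1' - a1) * (g1 * f11) + (a2' - a2) * (g2 * f21) by ring.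
by rewrite e1 e2; ring.
Qed.

Lemma ip_collapse (v f0 f1 f2 f3 f : R -> R) : L2_on `[0, 1] v ->
  continuous f0 -> continuous f1 -> continuous f2 -> continuous f3 ->
  (forall x, 0 <= x <= 1 -> f0 x + f1 x + f2 x + f3 x = - 1 * f x) -> continuous f ->
  ip v f0 = - ip v f - ip v f1 - ip v f2 - ip v f3.
Proof.
move=> Lv c0 c1 c2 c3 E cf.
have E' : ip v (fun x => f0 x + f1 x + f2 x + f3 x) = ip v (fun x => - 1 * f x) by apply: eq_ip.
have k1 : continuous (fun x => f0 x + f1 x) by cts.
have k2 : continuous (fun x => f0 x + f1 x + f2 x) by cts.
rewrite ipZr ?(ipDr _ (fun x => f0 x + f1 x + f2 x)) ?(ipDr _ (fun x => f0 x + f1 x)) ?ipDr in E'; try (exact: L2_cts); try exact: Lv.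
move: E'; move: (ip v f0) (ip v f1) (ip v f2) (ip v f3) (ip v f); clear=> a b c d e; lra.
Qed.

Lemma ae_conj (P Q : R -> Prop) :
  {ae (@lebesgue_measure R), forall x, P x} -> {ae (@lebesgue_measure R), forall x, Q x} ->
  {ae (@lebesgue_measure R), forall x, P x /\ Q x}.
Proof.
move=> hP hQ; have := negligibleU hP hQ; apply: negligibleS.
move=> x /= nPQ; apply: contrapT => /not_orP[/contrapT px /contrapT qx].
exact: nPQ.
Qed.

Variables (K : coefficients R) (n1 n2 n3 f1 f2 f3 : R -> R -> R).
Hypotheses (ca : continuous (alpha K)) (ct1 : continuous (theta1 K)) (ct2 : continuous (theta2 K)).
Hypothesis PK : plane_kernel K n1 n2 n3 f1 f2 f3.
Variables (g1 g2 g3 : R -> R).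
Hypothesis (gE : forall x, 0 <= x <= 1 ->
  [/\ g1 x = - mu K * n1 x 0, g2 x = - mu K * n2 x 0 & g3 x = - mu K * n3 x 0]).

Variables (h1 h2 h3 eta beta : R -> R) (p1 p2 p3 p1s p2s p3s p1x p2x p3x : R -> R -> R).
Hypotheses (ch1 : continuous h1) (ch2 : continuous h2) (ch3 : continuous h3) (ce : continuous eta).
Hypothesis DS : dual_solution K h1 h2 h3 eta beta p1 p2 p3 p1s p2s p3s p1x p2x p3x.
Hypothesis Q0 : forall s, transform n1 n2 n3 (p1 s) (p2 s) (p3 s) 0 = 0.

Variables (U : R -> R) (z0 zhat0 : triple (R -> R)) (z zhat : triple (trajectory R)).
Hypotheses (Lz0 : L2_triple z0) (Lzhat0 : L2_triple zhat0).
Hypothesis (Pz : plant K U z0 z).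
Hypothesis (Oz : observer K g1 g2 g3 U (measured_output z) zhat0 zhat).

Let e1 t := comp1 (observer_error z zhat t).
Let e2 t := comp2 (observer_error z zhat t).
Let e3 t := comp3 (observer_error z zhat t).

(** The six weak formulations, three for the plant and three for the observer, are
    tested with the same functions; the equations of the dual system and the
    boundary conditions leave only the source [eta h] and the states at the two
    ends of [[0, T]]. *)
Lemma duality_identity T : 0 <= T ->
  ip (e1 0) (p1 T) + ip (e2 0) (p2 T) + ip (e3 0) (p3 T)
  - (ip (e1 T) (p1 0) + ip (e2 T) (p2 0) + ip (e3 T) (p3 0)) =
  \int[lebesgue_measure]_(t in `[0, T])
     (eta (T - t) * (ip (e1 t) h1 + ip (e2 t) h2 + ip (e3 t) h3)).
Proof.
move=> T0.
case: PK => cn1 cn2 cn3 _ _ _ _ _ _ _ _ _ _ _ _.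
case: DS => c1 c2 c3 c1s c2s c3s c1x c2x c3x d1s d2s d3s d1x d2x d3x pe1 pe2 pe3 pb1 pb2 pb3 _.
have [W1 W2 W3 bcz] := Pz; have [V1 V2 V3 bczh] := Oz.
have [Lz1 Lz2 Lz3] := Lz0; have [Ly1 Ly2 Ly3] := Lzhat0.
have [L1 _ _] := W1; have [L2 _ _] := W2; have [L3 _ _] := W3.
have [M1 _ _] := V1; have [M2 _ _] := V2; have [M3 _ _] := V3.
have T1 := reversed_test p1 p1s p1x T c1s c1x d1s d1x.
have T2 := reversed_test p2 p2s p2x T c2s c2x d2s d2x.
have T3 := reversed_test p3 p3s p3x T c3s c3x d3s d3x.
have k1 : continuous (fun z : R * R => p1 (T - z.1) z.2) by cts.
have k2 : continuous (fun z : R * R => p2 (T - z.1) z.2) by cts.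
have k3 : continuous (fun z : R * R => p3 (T - z.1) z.2) by cts.
pose Y t := measured_output z t - trace0 (comp3 zhat) t.
have LY : L2loc Y.
  move=> t t0; apply: L2_sub; first by have [_ _ _ h _] := L3; exact: h.
  by have [_ _ _ h _] := M3; exact: h.
have L00 : L2loc (fun _ : R => 0 : R) by move=> t t0; exact: L2_cts (@ctsC _ _ _).
have cC (r : R) : continuous (fun _ : R => r) by exact: ctsC.
(* The gains extended continuously to the line. *)
pose b1 x := mu K * n1 x 0; pose b2 x := mu K * n2 x 0; pose b3 x := mu K * n3 x 0.
have cb1 : continuous b1.
  by refine (ctsM _ _ (ctsC _ _) (cts2 _ _ _ n1 (fun x => x) (fun=> 0) cn1 _ _)); cts.
have cb2 : continuous b2.
  by refine (ctsM _ _ (ctsC _ _) (cts2 _ _ _ n2 (fun x => x) (fun=> 0) cn2 _ _)); cts.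
have cb3 : continuous b3.
  by refine (ctsM _ _ (ctsC _ _) (cts2 _ _ _ n3 (fun x => x) (fun=> 0) cn3 _ _)); cts.
have bE x : 0 <= x <= 1 -> [/\ b1 x = - g1 x, b2 x = - g2 x & b3 x = - g3 x].
  by move=> /gE[-> -> ->]; rewrite /b1 /b2 /b3; split; ring.
have I1 := weak_identity _ _ _ _ (comp1 z) (comp2 z) (comp3 z) (fun=> sigma11 K) (fun=> sigma12 K) (alpha K)
  (fun=> 0) (fun=> 0) _ _ _ T W1 Lz1 L1 L2 L3 (cC _) (cC _) ca (cC _) L00
  (fun t x _ _ => ltac:(rewrite mulr0 addr0; reflexivity)) T1 k1 T0.
have I2 := weak_identity _ _ _ _ (comp1 z) (comp2 z) (comp3 z) (fun=> sigma21 K) (fun=> sigma22 K) (alpha K)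
  (fun=> 0) (fun=> 0) _ _ _ T W2 Lz2 L1 L2 L3 (cC _) (cC _) ca (cC _) L00
  (fun t x _ _ => ltac:(rewrite mulr0 addr0; reflexivity)) T2 k2 T0.
have I3 := weak_identity _ _ _ _ (comp1 z) (comp2 z) (comp3 z) (theta1 K) (theta2 K) (fun=> 0)
  (fun=> 0) (fun=> 0) _ _ _ T W3 Lz3 L1 L2 L3 ct1 ct2 (cC _) (cC _) L00
  (fun t x _ _ => ltac:(rewrite mul0r mulr0 !addr0; reflexivity)) T3 k3 T0.
have J1 := weak_identity _ _ _ _ (comp1 zhat) (comp2 zhat) (comp3 zhat) (fun=> sigma11 K) (fun=> sigma12 K) (alpha K)
  b1 Y _ _ _ T V1 Ly1 M1 M2 M3 (cC _) (cC _) ca cb1 LY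
  (fun t x _ x01 => ltac:(have [-> _ _] := bE x x01; rewrite mulNr; reflexivity)) T1 k1 T0.
have J2 := weak_identity _ _ _ _ (comp1 zhat) (comp2 zhat) (comp3 zhat) (fun=> sigma21 K) (fun=> sigma22 K) (alpha K)
  b2 Y _ _ _ T V2 Ly2 M1 M2 M3 (cC _) (cC _) ca cb2 LY
  (fun t x _ x01 => ltac:(have [_ -> _] := bE x x01; rewrite mulNr; reflexivity)) T2 k2 T0.
have J3 := weak_identity _ _ _ _ (comp1 zhat) (comp2 zhat) (comp3 zhat) (theta1 K) (theta2 K) (fun=> 0)
  b3 Y _ _ _ T V3 Ly3 M1 M2 M3 ct1 ct2 (cC _) cb3 LY
  (fun t x _ x01 => ltac:(have [_ _ ->] := bE x x01; rewrite mul0r addr0 mulNr; reflexivity)) T3 k3 T0.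
have [iT ST] := has_intD _ _ _ _ _ _ (has_intD _ _ _ _ _ _ (has_intB _ _ _ _ _ _ I1 J1) (has_intB _ _ _ _ _ _ I2 J2))
  (has_intB _ _ _ _ _ _ I3 J3).
have [_ K1 _ _ _] := L1; have [_ K2 _ _ _] := L2; have [_ K3 _ _ _] := L3.
have [_ N1 _ _ _] := M1; have [_ N2 _ _ _] := M2; have [_ N3 _ _ _] := M3.
pose G1 t x := eta (T - t) * h1 x; pose G2 t x := eta (T - t) * h2 x; pose G3 t x := eta (T - t) * h3 x.
have cG1 : continuous (fun z : R * R => G1 z.1 z.2) by rewrite /G1; cts.
have cG2 : continuous (fun z : R * R => G2 z.1 z.2) by rewrite /G2; cts.
have cG3 : continuous (fun z : R * R => G3 z.1 z.2) by rewrite /G3; cts.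
pose S t := (ip (profile (comp1 z) t) (G1 t) - ip (profile (comp1 zhat) t) (G1 t))
  + (ip (profile (comp2 z) t) (G2 t) - ip (profile (comp2 zhat) t) (G2 t))
  + (ip (profile (comp3 z) t) (G3 t) - ip (profile (comp3 zhat) t) (G3 t)).
have iS : integ 0 T S.
  by apply: integD; [apply: integD|]; apply: integB; exact: integ_ip.
have cp1 t : continuous (p1 t) by cts.
have cp2 t : continuous (p2 t) by cts.
have cp3 t : continuous (p3 t) by cts.
have cp1s t : continuous (p1s t) by cts.
have cp2s t : continuous (p2s t) by cts.
have cp3s t : continuous (p3s t) by cts.
have cp1x t : continuous (p1x t) by cts.
have cp2x t : continuous (p2x t) by cts.
have cp3x t : continuous (p3x t) by cts.
have bV (n : R -> R -> R) (b p : R -> R) : continuous (fun z : R * R => n z.1 z.2) -> continuous p ->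
    b = (fun x => mu K * n x 0) -> continuous b -> ip b p = mu K * volterra n p 0.
  move=> cn cp bn cb; rewrite ip_oint // /volterra -ointZ.
    by congr (oint _ _ _); apply/funext => x; rewrite bn mulrA.
  refine (ctsM _ _ (cts2 _ _ _ n (fun x => x) (fun=> 0) cn _ _) cp); cts.
(* The injection terms equal the boundary term at [x = 0] because the transform
   vanishes there. *)
have BB s : ip b1 (p1 s) + ip b2 (p2 s) + ip b3 (p3 s) = - mu K * p3 s 0.
  rewrite (bV n1) // (bV n2) // (bV n3) //.
  have := Q0 s; rewrite /transform.
  move: (volterra _ _ _) (volterra _ _ _) (volterra _ _ _) (p3 s 0) => u v w p E.
  by rewrite (_ : p = - (w + v + u)); [ring|apply/eqP; rewrite -addr_eq0 !addrA E].
have FS : \int[lebesgue_measure]_(t in `[0, T]) (- 1 * S t) =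
    - (ip (e1 0) (p1 T) + ip (e2 0) (p2 T) + ip (e3 0) (p3 T)
       - (ip (e1 T) (p1 0) + ip (e2 T) (p2 0) + ip (e3 T) (p3 0))).
  have LT1 := L2_cts 0 1 _ (cp1 0); have LT2 := L2_cts 0 1 _ (cp2 0); have LT3 := L2_cts 0 1 _ (cp3 0).
  have L01 := L2_cts 0 1 _ (cp1 T); have L02 := L2_cts 0 1 _ (cp2 T); have L03 := L2_cts 0 1 _ (cp3 T).
  have l0 : 0 <= (0 : R) by [].
  rewrite /e1 /e2 /e3 /=.
  rewrite !ipBl //; try exact: K1; try exact: K2; try exact: K3; try exact: N1; try exact: N2; try exact: N3.
  rewrite !subrr !subr0 in ST.
  transitivity (\int[lebesgue_measure]_(t in `[0, T]) (- 1 * S t)); first by [].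
  move: ST; set V := (X in _ = X -> _) => ST.
  have -> : - (ip (profile (comp1 z) 0) (p1 T) - ip (profile (comp1 zhat) 0) (p1 T) +
     (ip (profile (comp2 z) 0) (p2 T) - ip (profile (comp2 zhat) 0) (p2 T)) +
     (ip (profile (comp3 z) 0) (p3 T) - ip (profile (comp3 zhat) 0) (p3 T)) -
     (ip (profile (comp1 z) T) (p1 0) - ip (profile (comp1 zhat) T) (p1 0) +
      (ip (profile (comp2 z) T) (p2 0) - ip (profile (comp2 zhat) T) (p2 0)) +
      (ip (profile (comp3 z) T) (p3 0) - ip (profile (comp3 zhat) T) (p3 0)))) = V by rewrite /V; ring.
  rewrite -ST; apply: ae_eq_Rint.
  - by apply: integ_measurable; exact: integZ.
  - exact: integ_measurable iT.
  move: (ae_conj _ _ bcz bczh) => [N [mN N0 sub]]; exists N; split => // t Ht; apply: sub => h; apply: Ht.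
  move=> /andP[t0 tT]; have [bp bo] := h; have [q1E q2E w1E] := bp t0; have [q1E' q2E' w1E'] := bo t0.
  have A1 v : L2_on `[0, 1] v -> ip v (fun x => - p1s (T - t) x + gamma1 K * p1x (T - t) x) =
     - ip v (G1 t) - ip v (fun x => sigma11 K * p1 (T - t) x) - ip v (fun x => sigma21 K * p2 (T - t) x)
     - ip v (fun x => theta1 K x * p3 (T - t) x).
    move=> Lv; apply: ip_collapse => //; [by have c := cp1s (T - t); have c' := cp1x (T - t); cts|by have c := cp1 (T - t); cts
      |by have c := cp2 (T - t); cts|by have c := cp3 (T - t); cts| |by rewrite /G1; cts].
    by move=> x x01; rewrite pe1 // /G1; ring.
  have A2 v : L2_on `[0, 1] v -> ip v (fun x => - p2s (T - t) x + gamma2 K * p2x (T - t) x) =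
     - ip v (G2 t) - ip v (fun x => sigma12 K * p1 (T - t) x) - ip v (fun x => sigma22 K * p2 (T - t) x)
     - ip v (fun x => theta2 K x * p3 (T - t) x).
    move=> Lv; apply: ip_collapse => //; [by have c := cp2s (T - t); have c' := cp2x (T - t); cts|by have c := cp1 (T - t); cts
      |by have c := cp2 (T - t); cts|by have c := cp3 (T - t); cts| |by rewrite /G2; cts].
    by move=> x x01; rewrite pe2 // /G2; ring.
  have A3 v : L2_on `[0, 1] v -> ip v (fun x => - p3s (T - t) x + - mu K * p3x (T - t) x) =
     - ip v (G3 t) - ip v (fun x => alpha K x * p1 (T - t) x) - ip v (fun x => alpha K x * p2 (T - t) x)
     - ip v (fun x => 0 * p3 (T - t) x).
    move=> Lv; apply: ip_collapse => //; [by have c := cp3s (T - t); have c' := cp3x (T - t); cts|by have c := cp1 (T - t); cts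
      |by have c := cp2 (T - t); cts|by have c := cp3 (T - t); cts| |by rewrite /G3; cts].
    by move=> x x01; rewrite pe3 // /G3; ring.
  rewrite /= (A1 _ (K1 t t0)) (A2 _ (K2 t t0)) (A3 _ (K3 t t0)) (A1 _ (N1 t t0)) (A2 _ (N2 t t0)) (A3 _ (N3 t t0)).
  have BA := boundary_terms_cancel _ _ _ _ _ _ (trace1 (comp1 z) t) (trace1 (comp2 z) t) (trace1 (comp3 z) t)
    (trace1 (comp1 zhat) t) (trace1 (comp2 zhat) t) (trace1 (comp3 zhat) t) (U t) (trace0 (comp3 z) t) (trace0 (comp3 zhat) t)
    (q1 K) (q2 K) _ (p1 (T - t) 0) _ (p2 (T - t) 0) _ _ _ _ _
    (pb1 (T - t)) (pb2 (T - t)) (pb3 (T - t)) w1E w1E' (BB (T - t)).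
  rewrite q1E q2E q1E' q2E' /S /Y /measured_output.
  apply/eqP; rewrite eq_sym -subr_eq0; apply/eqP; rewrite -[RHS]BA.
  ring.
have -> : \int[lebesgue_measure]_(t in `[0, T])
     (eta (T - t) * (ip (e1 t) h1 + ip (e2 t) h2 + ip (e3 t) h3)) = \int[lebesgue_measure]_(t in `[0, T]) S t.
  apply: eq_Rintegral => t; rewrite inE /= in_itv /= => /andP[t0 tT].
  have lh1 := L2_cts 0 1 _ ch1; have lh2 := L2_cts 0 1 _ ch2; have lh3 := L2_cts 0 1 _ ch3.
  rewrite /S /e1 /e2 /e3 /= !ipBl // /G1 /G2 /G3 ?ipZr //; try exact: K1; try exact: K2; try exact: K3;
    try exact: N1; try exact: N2; try exact: N3.
  by ring.
have [_ FS'] := has_intZ _ _ _ _ (- 1) (integ_has _ _ _ iS).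
by rewrite FS' mulN1r in FS; apply: oppr_inj; rewrite FS.
Qed.

End duality.

(** * Norms tested by continuous functions *)

Section density.
Context {R : realType}.

Definition trunc (N : nat) (y : R) : R := Num.max (- N%:R) (Num.min y N%:R).

Lemma trunc_le N y : `|trunc N y| <= N%:R.
Proof.
have N0 : 0 <= (N%:R : R) by rewrite ler0n.
by rewrite ler_norml /trunc le_max lexx /= ge_max ge_min lexx orbT andbT; lra.
Qed.

Lemma trunc_cts N : continuous (trunc N).
Proof.
by refine (cts_max (fun=> _) _ _ (cts_min id (fun=> _) _ _)); cts.
Qed.

Lemma truncP N y : [\/ trunc N y = y, trunc N y = N%:R /\ N%:R <= y | trunc N y = - N%:R /\ y <= - N%:R].
Proof.
have N0 : - N%:R <= (N%:R : R) by have := ler0n R N; lra.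
rewrite /trunc; have [a|a] := leP y N%:R; last by rewrite max_r //; apply: Or32; split => //; exact: ltW.
by have [c|c] := leP (- N%:R) y; [exact: Or31|apply: Or33; split => //; exact: ltW].
Qed.

Lemma trunc_lip N y z : `|trunc N y - trunc N z| <= `|y - z|.
Proof.
have := ler_norm (y - z); have := ler_norm (- (y - z)); rewrite normrN => h1 h2.
have := trunc_le N y; have := trunc_le N z; rewrite !ler_norml => /andP[a1 a2] /andP[b1 b2].
by apply/andP; have [E|[E c]|[E c]] := truncP N y; have [F|[F d]|[F d]] := truncP N z; split; lra.
Qed.

Lemma trunc_sqr N y : trunc N y ^+ 2 <= y * trunc N y.
Proof.
have N0 := ler0n R N; rewrite expr2.
by have [->|[-> c]|[-> c]] := truncP N y => //; nra.
Qed.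

Lemma trunc_id N y : `|y| <= N%:R -> trunc N y = y.
Proof. by rewrite ler_norml /trunc => /andP[a b]; rewrite min_l // max_r. Qed.

Lemma measurable_trunc (a b : R) N (f : R -> R) : measurable_fun `[a, b] f ->
  measurable_fun `[a, b] (fun x => trunc N (f x)).
Proof.
by move=> mf; exact: (measurableT_comp (continuous_measurable_fun (trunc_cts N)) mf).
Qed.

Lemma integ_bounded (a b : R) (f : R -> R) M : measurable_fun `[a, b] f -> (forall x, `|f x| <= M) -> integ a b f.
Proof.
have cM : continuous (fun _ : R => M) by exact: ctsC.
by move=> mf fM; exact: (integ_le _ _ _ _ mf (fun x _ => fM x) (integ_cts a b _ cM)).
Qed.

Lemma L2norm_triangle (f g : R -> R) : L2_on `[0, 1] f -> L2_on `[0, 1] g ->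
  L2norm g <= L2norm f + L2norm (fun x => g x - f x).
Proof.
move=> Lf Lg; have Ld := L2_sub _ _ _ _ Lg Lf.
have cs := cauchy_schwarz _ _ Lf Ld.
have e : L2norm g ^+ 2 = L2norm f ^+ 2 + 2 * ip f (fun x => g x - f x) + L2norm (fun x => g x - f x) ^+ 2.
  rewrite !L2norm_sqr.
  have [_ <-] := has_intD _ _ _ _ _ _ (has_intD _ _ _ _ _ _ (integ_has _ _ _ (L2_integ _ _ _ Lf))
    (has_intZ _ _ _ _ 2 (has_ip _ _ Lf Ld))) (integ_has _ _ _ (L2_integ _ _ _ Ld)).
  by apply: eq_Rintegral => x _; ring.
have a0 := L2norm_ge0 f; have b0 := L2norm_ge0 (fun x => g x - f x); have c0 := L2norm_ge0 g.
rewrite -(@ler_pXn2r _ 2) ?nnegrE ?addr_ge0 // e.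
move: cs a0 b0; rewrite ler_norml; clear; set X := ip _ _; set u := L2norm _; set v := L2norm _.
by move=> /andP[_ h] _ _; nra.
Qed.

(** A square integrable function is tested in norm by the continuous ones:
    truncation reduces the claim to bounded functions, for which approximation
    in the mean implies approximation in the square mean. *)
Lemma L2norm_le_dual (f : R -> R) (B : R) : L2_on `[0, 1] f -> 0 <= B ->
  (forall h, continuous h -> `|ip f h| <= B * L2norm h) -> L2norm f <= B.
Proof.
move=> Lf B0 H; have [mf _] := Lf.
have sqf := L2_integ _ _ _ Lf.
(* A truncation [fN] satisfies [|fN|^2 <= <f, fN>], and [<f, fN>] is close to
   [<f, h>] for a continuous [h]. *)
have step N : L2norm (fun x => trunc N (f x)) <= B.
  pose fN x := trunc N (f x).
  have mfN : measurable_fun (`[0, 1]%classic : set R) fN by exact: measurable_trunc.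
  have LfN : L2_on `[0, 1] fN.
    apply: integ_L2 => //; apply: (integ_bounded _ _ _ (N%:R ^+ 2)); first exact: measurable_funX.
    by move=> x; rewrite normrX lerXn2r // ?nnegrE // trunc_le.
  have ifN : integ 0 1 fN by apply: (integ_bounded _ _ _ N%:R) => // x; exact: trunc_le.
  have fin : (@lebesgue_measure R (`[0%R, 1%R]%classic : set R) < +oo)%E.
    by rewrite lebesgue_measure_itv /= lte01 /= oppr0 adde0 ltry.
  have [//|g_ [cg ig lim]] := approximation_continuous_integrable _ fin ifN.
  have key (e : R) : 0 < e -> ip f fN <= B * L2norm fN + (B + L2norm f) * e.
    move=> e0.
    have c0 : 0 < 2 * N%:R + 1 :> R by rewrite ltr_wpDl // mulr_ge0.
    have e2 : 0 < e ^+ 2 / (2 * N%:R + 1) by rewrite divr_gt0 ?exprn_gt0.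
    have nb : nbhs (0%E : \bar R) [set y | (y < (e ^+ 2 / (2 * N%:R + 1))%:E)%E].
      by apply: open_nbhs_nbhs; split; [exact: open_ereal_lt_ereal|rewrite /= lte_fin].
    have [k _ /(_ k (leqnn k)) /= hk] := lim _ nb.
    (* Truncating the approximation as well keeps the difference bounded, so
       that its square is controlled by its absolute value. *)
    pose h x := trunc N (g_ k x).
    have ch : continuous h by have c1 := cg k; have c2 := trunc_cts N; rewrite /h; cts.
    have Lh := L2_cts 0 1 _ ch.
    have Ld := L2_sub _ _ _ _ Lh LfN.
    have ifg := integB _ _ _ _ ifN (ig k).
    have iabs : integ 0 1 (fun x => `|fN x - g_ k x|) by exact: integrable_norm.
    have hk' : \int[lebesgue_measure]_(x in `[0, 1]) `|fN x - g_ k x| <= e ^+ 2 / (2 * N%:R + 1).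
      rewrite -lee_fin /Rintegral fineK; first exact: ltW.
      exact: integrable_fin_num iabs.
    have de : L2norm (fun x => h x - fN x) <= e.
      rewrite -(@ler_pXn2r _ 2) ?nnegrE ?L2norm_ge0 ?(ltW e0) // L2norm_sqr.
      apply: (@le_trans _ _ (2 * N%:R * (e ^+ 2 / (2 * N%:R + 1)))); last first.
        rewrite mulrCA ler_piMr ?sqr_ge0 // ler_pdivrMr // mul1r lerDl //.
      have [i2 E2] := has_intZ _ _ _ _ (2 * N%:R) (integ_has _ _ _ iabs).
      apply: (@le_trans _ _ (2 * N%:R * \int[lebesgue_measure]_(x in `[0, 1]) `|fN x - g_ k x|)).
        rewrite -E2; apply: le_Rint => //; first exact: L2_integ.
        move=> x _; rewrite -[_ ^+ 2]real_normK ?num_real // expr2.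
        have b1 : `|h x - fN x| <= `|fN x - g_ k x|.
          rewrite distrC -[fN x](trunc_id N) ?trunc_le // [X in _ <= `|X - _|]trunc_id ?trunc_le //.
          exact: trunc_lip.
        apply: ler_pM => //; apply: (le_trans (ler_normB _ _)).
        by rewrite mulrDl mul1r lerD // trunc_le.
      by rewrite ler_wpM2l // mulr_ge0.
    have -> : ip f fN = ip f h - ip f (fun x => h x - fN x).
      by rewrite ipBr //; ring.
    have a1 := le_trans (ler_norm _) (H h ch).
    have a2 := cauchy_schwarz _ _ Lf Ld.
    have a3 := L2norm_triangle _ _ LfN Lh.
    have a4 : L2norm f * L2norm (fun x => h x - fN x) <= L2norm f * e by rewrite ler_wpM2l ?L2norm_ge0.
    have a5 : B * L2norm h <= B * (L2norm fN + e).
      by rewrite ler_wpM2l // (le_trans a3) // lerD2l.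
    have a6 : - ip f (fun x => h x - fN x) <= L2norm f * L2norm (fun x => h x - fN x).
      by rewrite (le_trans _ a2) // -normrN ler_norm.
    rewrite mulrDl addrA -mulrDr; apply: lerD; first exact: le_trans a1 a5.
    exact: le_trans a6 a4.
  have key2 : ip f fN <= B * L2norm fN.
    apply/ler_addgt0Pl => e e0.
    have c0 : 0 < B + L2norm f + 1 by rewrite ltr_wpDl // addr_ge0 // L2norm_ge0.
    apply: (le_trans (key (e / (B + L2norm f + 1)) (divr_gt0 e0 c0))).
    rewrite addrC lerD2r mulrCA ler_piMr ?(ltW e0) // ler_pdivrMr // mul1r lerDl //.
  have key3 : L2norm fN ^+ 2 <= ip f fN.
    rewrite L2norm_sqr; apply: le_Rint; [exact: L2_integ|exact: L2_mul|].
    by move=> x _; exact: trunc_sqr.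
  have [z|z] := eqVneq (L2norm fN) 0; first by rewrite -/fN z.
  have pos : 0 < L2norm fN by rewrite lt_def z L2norm_ge0.
  by rewrite -(ler_pM2r pos) -expr2 (le_trans key3).
rewrite -(@ler_pXn2r _ 2) ?nnegrE ?L2norm_ge0 // L2norm_sqr.
have mtr N : measurable_fun (`[0, 1]%classic : set R) (fun x => trunc N (f x)) by exact: measurable_trunc.
have tc x : (trunc N (f x) ^+ 2)%:E @[N --> \oo] --> (f x ^+ 2)%:E.
  apply: cvg_near_cst; exists (Num.truncn `|f x|).+1 => // N /= hN.
  rewrite trunc_id //; apply: (le_trans (ltW (truncnS_gt _))).
  by rewrite ler_nat.
have D : (\int[lebesgue_measure]_(x in `[0%R, 1%R]) (trunc N (f x) ^+ 2)%:E)%E @[N --> \oo] -->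
    (\int[lebesgue_measure]_(x in `[0%R, 1%R]) (f x ^+ 2)%:E)%E.
  apply: (dominated_cvg _ _ _ _ sqf) => //.
  - by move=> N; apply/measurable_EFinP; exact: (measurable_funX _ (mtr N)).
  - move=> N x _; rewrite /= lee_fin ger0_norm ?sqr_ge0 //.
    have N0 := ler0n R N; rewrite !expr2.
    by have [->|[-> c]|[-> c]] := truncP N (f x) => //; nra.
have LN N : L2_on `[0, 1] (fun x => trunc N (f x)).
  apply: integ_L2 => //; apply: (integ_bounded _ _ _ (N%:R ^+ 2)); first exact: measurable_funX.
  by move=> x; rewrite normrX lerXn2r // ?nnegrE // trunc_le.
have up N : (\int[lebesgue_measure]_(x in `[0%R, 1%R]) (trunc N (f x) ^+ 2)%:E <= (B ^+ 2)%:E)%E.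
  have i2 := L2_integ _ _ _ (LN N).
  rewrite -[leLHS]fineK; last exact: integrable_fin_num i2.
  rewrite lee_fin -[fine _]/(\int[lebesgue_measure]_(x in `[0, 1]) (trunc N (f x) ^+ 2)) -L2norm_sqr.
  by rewrite lerXn2r ?nnegrE ?L2norm_ge0.
have : (\int[lebesgue_measure]_(x in `[0%R, 1%R]) (f x ^+ 2)%:E <= (B ^+ 2)%:E)%E.
  rewrite -(cvg_lim _ D) //; apply: lime_le; first by apply/cvg_ex; eexists; exact: D.
  exact: nearW.
rewrite -[leLHS]fineK ?lee_fin //; exact: integrable_fin_num sqf.
Qed.

End density.

(** * Decay of the observer error *)

Section concentration.
Context {R : realType}.

Lemma oint_reflect (f : R -> R) T : continuous f -> oint (fun t => f (T - t)) 0 T = oint f 0 T.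
Proof.
move=> cf.
have D (t : R) : is_derive t 1 (fun t => - 1 * prim f (T - t)) (f (T - t)).
  have h : is_derive t 1 (fun t => T - t) (-1).
    by have := derB _ _ _ _ _ (derC T t) (is_derive_id t 1); rewrite sub0r.
  apply: (is_derive_fct _ _ _ _ (derZ _ _ _ (- 1) (der_comp _ _ _ _ _ h (der_prim f (T - t) cf)))).
  by ring.
rewrite (oint_ftc _ _ 0 T _ D); last by cts.
by rewrite subrr subr0 /oint; ring.
Qed.

(** Pulses of mass one on shrinking windows before the final time converge to
    the evaluation at that time. *)
Lemma concentrate (g : R -> R) (T A : R) : 0 < T -> {within `[0, T], continuous g} ->
  (forall d, 0 < d -> d <= 1 -> exists eta : R -> R,
     [/\ continuous eta /\ oint eta 0 d = 1, forall s, 0 <= eta s, forall s, d <= s -> eta s = 0 &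
       `|\int[lebesgue_measure]_(t in `[0, T]) (eta (T - t) * g t)| <= A]) ->
  `|g T| <= A.
Proof.
move=> T0 cg H; apply/ler_addgt0Pl => e e0.
have TT : `[0, T]%classic T by rewrite /= in_itv /= lexx ltW.
move: (cg) => /subspace_continuousP /(_ T TT) /cvgrPdist_le /(_ _ e0).
rewrite near_withinE => -[r /= r0 Hr].
pose d := Num.min 1 (Num.min T (r / 2)).
have d0 : 0 < d by rewrite !lt_min ltr01 T0 divr_gt0.
have d1 : d <= 1 by rewrite ge_min lexx.
have dT : d <= T by rewrite !ge_min lexx orbT.
have dr : d <= r / 2 by rewrite !ge_min lexx !orbT.
have [eta [[ce int1] e_ge e_out HA]] := H d d0 d1.
have cer : continuous (fun t => eta (T - t)) by cts.
have int1' : \int[lebesgue_measure]_(t in `[0, T]) eta (T - t) = 1.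
  rewrite -oint_Rint ?(ltW T0) // oint_reflect // -(oint_chasles _ 0 d T) int1.
  rewrite (eq_oint _ (fun=> 0)) ?oint_cst ?mul0r ?addr0 //; first exact: ctsC.
  by move=> s /andP[ds _]; exact: e_out.
have ig : integ 0 T (fun t => eta (T - t) * g t).
  apply: continuous_compact_integrable; first exact: segment_compact.
  apply: (@ctsM R (subspace `[0, T]%classic) (fun t => eta (T - t)) g _ cg).
  exact: continuous_subspaceT.
have ie : integ 0 T (fun t => eta (T - t)) by exact: integ_cts.
have [i1 E1] := has_intB _ _ _ _ _ _ (has_intZ _ _ _ _ (g T) (integ_has _ _ _ ie)) (integ_has _ _ _ ig).
have [i2 E2] := has_intZ _ _ _ _ e (integ_has _ _ _ ie).
rewrite int1' mulr1 in E1; rewrite int1' mulr1 in E2.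
have B : `|g T - \int[lebesgue_measure]_(t in `[0, T]) (eta (T - t) * g t)| <= e.
  rewrite -E1 -[leRHS]E2.
  apply: (le_trans (le_normr_Rintegral _ i1)) => //.
  apply: le_Rint => //; first exact: integrable_norm.
  move=> t /andP[t0 tT].
  have -> : g T * eta (T - t) - eta (T - t) * g t = eta (T - t) * (g T - g t) by ring.
  rewrite normrM ger0_norm // mulrC.
  have [dt|dt] := leP d (T - t); first by rewrite e_out // !mulr0.
  apply: ler_wpM2r => //; apply: Hr; last by rewrite /= in_itv /= t0.
  by rewrite /ball_ /= ger0_norm ?subr_ge0 //; lra.
have := ler_normD (g T - \int[lebesgue_measure]_(t in `[0, T]) (eta (T - t) * g t))
  (\int[lebesgue_measure]_(t in `[0, T]) (eta (T - t) * g t)).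
by rewrite subrK => h; apply: (le_trans h); exact: lerD.
Qed.

End concentration.

Lemma summand_le {R : realType} (x y z b : R) : 0 <= x -> 0 <= y -> 0 <= z -> x + y + z <= b ->
  [/\ x <= b, y <= b & z <= b].
Proof. by move=> *; split; lra. Qed.

Lemma norm_sum3 {R : realType} (x y z b : R) : `|x| <= b -> `|y| <= b -> `|z| <= b -> `|x + y + z| <= 3 * b.
Proof. by rewrite !ler_norml => /andP[? ?] /andP[? ?] /andP[? ?]; apply/andP; split; lra. Qed.

Lemma sqrt_sum3 {R : realType} (x y z b : R) : 0 <= x -> 0 <= y -> 0 <= z -> x <= b -> y <= b -> z <= b ->
  Num.sqrt (x ^+ 2 + y ^+ 2 + z ^+ 2) <= 2 * b.
Proof.
move=> x0 y0 z0 xb yb zb; have b0 := le_trans x0 xb.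
rewrite -(@ler_pXn2r _ 2) ?nnegrE ?sqrtr_ge0 ?mulr_ge0 // sqr_sqrtr ?addr_ge0 ?sqr_ge0 //.
by nra.
Qed.

(** The dual state vanishes at [s = 0], so that [duality_identity] bounds the
    average of the final error over a short window by the initial error times
    the size of the dual state at [s = T], which [dual_family] controls
    uniformly in the width of the window. *)
Lemma error_decay (R : realType) (K : coefficients R) (m1 m2 m3 : R -> R -> R) (p1 p2 p3 : R -> R) :
  0 < mu K -> 0 < gamma1 K -> 0 < gamma2 K ->
  continuous (alpha K) -> continuous (theta1 K) -> continuous (theta2 K) ->
  continuous_on_triangle m1 -> continuous_on_triangle m2 -> continuous_on_triangle m3 ->
  observer_kernel K m1 m2 m3 ->
  (forall x, 0 <= x <= 1 -> p1 x = - mu K * m1 x 0) ->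
  (forall x, 0 <= x <= 1 -> p2 x = - mu K * m2 x 0) ->
  (forall x, 0 <= x <= 1 -> p3 x = - mu K * m3 x 0) ->
  exists C nu : R, 0 < C /\ 0 < nu /\
    forall (U : R -> R) (z0 zhat0 : triple (R -> R)) (z zhat : triple (trajectory R)),
    L2_triple z0 -> L2_triple zhat0 ->
    plant K U z0 z -> observer K p1 p2 p3 U (measured_output z) zhat0 zhat ->
    forall t : R, 0 <= t ->
      L2norm_triple (observer_error z zhat t)
      <= C * expR (- nu * t) * L2norm_triple (observer_error z zhat 0).
Proof.
move=> mu0 g10 g20 ca ct1 ct2 cm1 cm2 cm3 obs p1E p2E p3E.
have [n1 [n2 [n3 [f1 [f2 [f3 [PK nE]]]]]]] :=
  plane_kernel_ex K m1 m2 m3 mu0 g10 g20 ca ct1 ct2 cm1 cm2 cm3 obs.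
have [C [nu [C0 [nu0 HC]]]] := dual_family K n1 n2 n3 f1 f2 f3 mu0 g10 g20 ca ct1 ct2 PK.
have pE x : 0 <= x <= 1 -> [/\ p1 x = - mu K * n1 x 0, p2 x = - mu K * n2 x 0 & p3 x = - mu K * n3 x 0].
  by move=> x01; have [-> -> ->] := nE x x01; rewrite p1E // p2E // p3E.
pose c := Num.sqrt C.
have c0 : 0 <= c by exact: sqrtr_ge0.
exists (6 * c + 1), (nu / 2); split; first by rewrite ltr_wpDl // mulr_ge0.
split; first by rewrite divr_gt0.
move=> U z0 zhat0 z zhat Lz0 Lzh0 Pz Oz T T0.
pose e1 t := comp1 (observer_error z zhat t).
pose e2 t := comp2 (observer_error z zhat t).
pose e3 t := comp3 (observer_error z zhat t).
have [[L1 _ _] [L2 _ _] [L3 _ _] _] := Pz; have [[M1 _ _] [M2 _ _] [M3 _ _] _] := Oz.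
have [_ K1 _ _ _] := L1; have [_ K2 _ _ _] := L2; have [_ K3 _ _ _] := L3.
have [_ N1 _ _ _] := M1; have [_ N2 _ _ _] := M2; have [_ N3 _ _ _] := M3.
have Le1 t : 0 <= t -> L2_on `[0, 1] (e1 t) by move=> t0; apply: L2_sub; [exact: K1|exact: N1].
have Le2 t : 0 <= t -> L2_on `[0, 1] (e2 t) by move=> t0; apply: L2_sub; [exact: K2|exact: N2].
have Le3 t : 0 <= t -> L2_on `[0, 1] (e3 t) by move=> t0; apply: L2_sub; [exact: K3|exact: N3].
set n0 := L2norm_triple (observer_error z zhat 0).
have n00 : 0 <= n0 by exact: sqrtr_ge0.
have n0E : n0 ^+ 2 = L2norm (e1 0) ^+ 2 + L2norm (e2 0) ^+ 2 + L2norm (e3 0) ^+ 2.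
  by rewrite sqr_sqrtr // !addr_ge0 // sqr_ge0.
have le_n0 (u : R) : 0 <= u -> u ^+ 2 <= n0 ^+ 2 -> u <= n0.
  by move=> u0; rewrite ler_pXn2r ?nnegrE.
have q1 := sqr_ge0 (L2norm (e1 0)); have q2 := sqr_ge0 (L2norm (e2 0)); have q3 := sqr_ge0 (L2norm (e3 0)).
have le1 : L2norm (e1 0) <= n0 by apply: le_n0; [exact: L2norm_ge0|rewrite n0E -addrA lerDl addr_ge0].
have le2 : L2norm (e2 0) <= n0 by apply: le_n0; [exact: L2norm_ge0|rewrite n0E addrAC lerDr addr_ge0].
have le3 : L2norm (e3 0) <= n0 by apply: le_n0; [exact: L2norm_ge0|rewrite n0E lerDr addr_ge0].
have [->|Tn] := eqVneq T 0.
  by rewrite mulr0 expR0 mulr1 -/n0 ler_peMl // lerDr mulr_ge0.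
have {Tn} Tpos : 0 < T by rewrite lt_def Tn.
pose w := expR (- (nu / 2) * T).
have w0 : 0 <= w := expR_ge0 _.
have w2 : w ^+ 2 = expR (- nu * T).
  by rewrite expr2 /w -expRD; congr expR; field.
(* The final error tested in the direction [h]. *)
have test (h1 h2 h3 : R -> R) : continuous h1 -> continuous h2 -> continuous h3 ->
   `|ip (e1 T) h1 + ip (e2 T) h2 + ip (e3 T) h3| <= 3 * (n0 * (c * w * Num.sqrt (sq h1 + sq h2 + sq h3))).
  move=> ch1 ch2 ch3.
  set Sh := sq h1 + sq h2 + sq h3.
  have Sh0 : 0 <= Sh by exact: (addr_ge0 (addr_ge0 (sq_ge0 _ ch1) (sq_ge0 _ ch2)) (sq_ge0 _ ch3)).
  have B0 : 0 <= c * w * Num.sqrt Sh by rewrite !mulr_ge0 // sqrtr_ge0.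
  have B2 : (c * w * Num.sqrt Sh) ^+ 2 = C * expR (- nu * T) * Sh.
    by rewrite !exprMn w2 !sqr_sqrtr // ltW.
  apply: (concentrate (fun t => ip (e1 t) h1 + ip (e2 t) h2 + ip (e3 t) h3) T) => //.
    have cc (v : trajectory R) (h : R -> R) : L2_trajectory v -> continuous h ->
       {within `[0, T], continuous (fun t => ip (profile v t) h)}.
      by move=> Lv ch; apply: (ip_within_cts v (fun _ x => h x)) => //; cts.
    have E t : t \in (`[0, T]%classic : set R) -> ip (profile (comp1 z) t) h1 - ip (profile (comp1 zhat) t) h1
      + (ip (profile (comp2 z) t) h2 - ip (profile (comp2 zhat) t) h2)
      + (ip (profile (comp3 z) t) h3 - ip (profile (comp3 zhat) t) h3) = ip (e1 t) h1 + ip (e2 t) h2 + ip (e3 t) h3.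
      rewrite inE /= in_itv /= => /andP[t0 _].
      have lh1 := L2_cts 0 1 _ ch1; have lh2 := L2_cts 0 1 _ ch2; have lh3 := L2_cts 0 1 _ ch3.
      by rewrite -!ipBl //; [exact: K3|exact: N3|exact: K2|exact: N2|exact: K1|exact: N1].
    apply: (subspace_eq_continuous E).
    have sub (f g : R -> R) : {within `[0, T], continuous f} -> {within `[0, T], continuous g} ->
       {within `[0, T], continuous (fun t => f t - g t)}.
      by move=> cf cg; exact: (@ctsD R (subspace `[0, T]%classic) f (fun t => - g t) cf (@ctsN R (subspace `[0, T]%classic) g cg)).
    have add (f g : R -> R) : {within `[0, T], continuous f} -> {within `[0, T], continuous g} ->
       {within `[0, T], continuous (fun t => f t + g t)}.
      by move=> cf cg; exact: (@ctsD R (subspace `[0, T]%classic) f g cf cg).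
    exact: (add _ _ (add _ _ (sub _ _ (cc _ _ L1 ch1) (cc _ _ M1 ch1)) (sub _ _ (cc _ _ L2 ch2) (cc _ _ M2 ch2)))
      (sub _ _ (cc _ _ L3 ch3) (cc _ _ M3 ch3))).
  move=> d d0 d1.
  have [eta [beta [v1 [v2 [v3 [v1s [v2s [v3s [v1x [v2x [v3x [DS [ce int1] [ege eout] Q0 [dec ini]]]]]]]]]]]]] :=
    HC h1 h2 h3 d ch1 ch2 ch3 d0 d1.
  exists eta; split => //.
  have D := duality_identity K n1 n2 n3 f1 f2 f3 ca ct1 ct2 PK p1 p2 p3 pE h1 h2 h3 eta beta v1 v2 v3 v1s v2s v3s v1x v2x v3x
    ch1 ch2 ch3 ce DS Q0 U z0 zhat0 z zhat Lz0 Lzh0 Pz Oz T T0.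
  rewrite -D.
  have k1 t : continuous (v1 t) by have k := du_c1 _ _ _ _ _ _ _ _ _ _ _ _ _ _ _ DS; cts.
  have k2 t : continuous (v2 t) by have k := du_c2 _ _ _ _ _ _ _ _ _ _ _ _ _ _ _ DS; cts.
  have k3 t : continuous (v3 t) by have k := du_c3 _ _ _ _ _ _ _ _ _ _ _ _ _ _ _ DS; cts.
  have zero (e v : R -> R) : L2_on `[0, 1] e -> continuous v -> sq v <= 0 -> ip e v = 0.
    move=> Le cv v0; have := cauchy_schwarz _ _ Le (L2_cts 0 1 _ cv).
    suff -> : L2norm v = 0 by rewrite mulr0 normr_le0 => /eqP.
    by apply/eqP; rewrite -sqrf_eq0 L2norm_sq // eq_le v0 sq_ge0.
  have bd (e v : R -> R) : L2_on `[0, 1] e -> continuous v -> L2norm e <= n0 ->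
     sq v <= C * expR (- nu * T) * Sh -> `|ip e v| <= n0 * (c * w * Num.sqrt Sh).
    move=> Le cv en vb; apply: (le_trans (cauchy_schwarz _ _ Le (L2_cts 0 1 _ cv))).
    apply: ler_pM => //; [exact: L2norm_ge0|exact: L2norm_ge0|].
    by rewrite -(@ler_pXn2r _ 2) ?nnegrE ?L2norm_ge0 // B2 L2norm_sq.
  have decT := dec T.
  have [s1 s2 s3] := And3 (sq_ge0 _ (k1 0)) (sq_ge0 _ (k2 0)) (sq_ge0 _ (k3 0)).
  have [t1 t2 t3] := And3 (sq_ge0 _ (k1 T)) (sq_ge0 _ (k2 T)) (sq_ge0 _ (k3 T)).
  have [i1 i2 i3] := summand_le _ _ _ _ s1 s2 s3 ini.
  have [j1 j2 j3] := summand_le _ _ _ _ t1 t2 t3 decT.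
  rewrite (zero _ _ (Le1 T T0) (k1 0) i1) (zero _ _ (Le2 T T0) (k2 0) i2) (zero _ _ (Le3 T T0) (k3 0) i3).
  rewrite !addr0 subr0.
  have b1 := bd _ _ (Le1 0 (lexx 0)) (k1 T) le1 j1.
  have b2 := bd _ _ (Le2 0 (lexx 0)) (k2 T) le2 j2.
  have b3 := bd _ _ (Le3 0 (lexx 0)) (k3 T) le3 j3.
  exact: norm_sum3.
have c00 : continuous (fun _ : R => 0 : R) by exact: ctsC.
have ip0 (e : R -> R) : ip e (fun=> 0) = 0.
  by rewrite /ip; under eq_Rintegral do rewrite mulr0; rewrite /Rintegral integral0.
have sq0 : sq (fun _ : R => 0 : R) = 0 by rewrite /sq expr0n /= oint_cst mul0r.
have nsq (h : R -> R) : continuous h -> Num.sqrt (sq h) = L2norm h.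
  by move=> ch; rewrite -L2norm_sq // sqrtr_sqr ger0_norm // L2norm_ge0.
have D0 : 0 <= 3 * (n0 * (c * w)) by rewrite !mulr_ge0.
have one (e : R -> R) : L2_on `[0, 1] e ->
   (forall h, continuous h -> `|ip e h| <= 3 * (n0 * (c * w * Num.sqrt (sq h)))) ->
   L2norm e <= 3 * (n0 * (c * w)).
  move=> Le H; apply: L2norm_le_dual => // h ch.
  have -> : 3 * (n0 * (c * w)) * L2norm h = 3 * (n0 * (c * w * Num.sqrt (sq h))) by rewrite nsq //; ring.
  exact: H.
have f1' : L2norm (e1 T) <= 3 * (n0 * (c * w)).
  apply: one; first exact: Le1.
  by move=> h ch; have := test h _ _ ch c00 c00; rewrite !ip0 sq0 !addr0.
have f2' : L2norm (e2 T) <= 3 * (n0 * (c * w)).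
  apply: one; first exact: Le2.
  by move=> h ch; have := test _ h _ c00 ch c00; rewrite !ip0 sq0 !addr0 !add0r.
have f3' : L2norm (e3 T) <= 3 * (n0 * (c * w)).
  apply: one; first exact: Le3.
  by move=> h ch; have := test _ _ h c00 c00 ch; rewrite !ip0 sq0 !add0r.
apply: (le_trans (sqrt_sum3 _ _ _ _ (L2norm_ge0 _) (L2norm_ge0 _) (L2norm_ge0 _) f1' f2' f3')).
rewrite -/w -/n0; have nw : 0 <= n0 * w by rewrite mulr_ge0.
have -> : 2 * (3 * (n0 * (c * w))) = 6 * c * (n0 * w) by ring.
have -> : (6 * c + 1) * w * n0 = 6 * c * (n0 * w) + n0 * w by ring.
by rewrite lerDl.
Qed.

Theorem theorem2 (R : realType) (g a Cf H V l1 l2 l3 q1 q2 rho1 rho2 : R)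
    (g_gt0 : 0 < g) (a_gt0 : 0 < a) (Cf_gt0 : 0 < Cf)
    (H_gt0 : 0 < H) (V_gt0 : 0 < V)
    (Fr_neq1 : froude g H V < 1 \/ 1 < froude g H V)
    (eig1 : eigenvalue (sve_matrix g a H V) l1)
    (eig2 : eigenvalue (sve_matrix g a H V) l2)
    (eig3 : eigenvalue (sve_matrix g a H V) l3)
    (l1_lt0 : l1 < 0) (l2_gt0 : 0 < l2) (l2_lt_l3 : l2 < l3)
    (K : coefficients R)
    (K_def : K = sve_coefficients Cf H V l1 l2 l3 q1 q2 rho1 rho2)
    (m1 m2 m3 : R -> R -> R)
    (m1_cont : continuous_on_triangle m1)
    (m2_cont : continuous_on_triangle m2)
    (m3_cont : continuous_on_triangle m3)
    (m_kernel : observer_kernel K m1 m2 m3)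
    (p1 p2 p3 : R -> R)
    (p1_def : forall x : R, 0 <= x <= 1 -> p1 x = - mu K * m1 x 0)
    (p2_def : forall x : R, 0 <= x <= 1 -> p2 x = - mu K * m2 x 0)
    (p3_def : forall x : R, 0 <= x <= 1 -> p3 x = - mu K * m3 x 0) :
  exists C nu : R, 0 < C /\ 0 < nu /\
    forall (U : R -> R) (z0 zhat0 : triple (R -> R))
      (z zhat : triple (trajectory R)),
    L2loc U -> L2_triple z0 -> L2_triple zhat0 ->
    plant K U z0 z ->
    observer K p1 p2 p3 U (measured_output z) zhat0 zhat ->
    forall t : R, 0 <= t ->
      L2norm_triple (observer_error z zhat t)
      <= C * expR (- nu * t) * L2norm_triple (observer_error z zhat 0).
Proof.
have l3_gt0 : 0 < l3 := lt_trans l2_gt0 l2_lt_l3.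
have mu0 : 0 < mu K by rewrite K_def /= oppr_gt0.
have g10 : 0 < gamma1 K by rewrite K_def.
have g20 : 0 < gamma2 K by rewrite K_def.
have cexp (b1 b2 : R) : continuous (fun x : R => b2 * expR (b1 * x / - l1)).
  by apply: ctsM; [exact: ctsC|apply: (cts1 _ _ (@continuous_expR R)); cts].
have ca : continuous (alpha K) by rewrite K_def; exact: cexp.
have ct1 : continuous (theta1 K) by rewrite K_def; exact: cexp.
have ct2 : continuous (theta2 K) by rewrite K_def; exact: cexp.
have [C [nu [C0 [nu0 HC]]]] := error_decay R K m1 m2 m3 p1 p2 p3 mu0 g10 g20 ca ct1 ct2
  m1_cont m2_cont m3_cont m_kernel p1_def p2_def p3_def.
exists C, nu; split => //; split => // U z0 zhat0 z zhat _.
exact: HC.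
Qed.
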